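(* Let $f$ be a pseudo-polynomial. There exist an exponent $\eta>0$ and a constant $C>0$, both depending only on $f$, such that for every real number $\xi$ and every sufficiently large $N\in\mathbb{N}$, \[\min_{\substack{1\le p\le N\\ p\text{ prime}}}\lVert\xi\lfloor f(p)\rfloor\rVert\le C N^{-\eta}.\]
   Context: A pseudo-polynomial is a function $f(x)=\alpha_1x^{\theta_1}+\cdots+\alpha_dx^{\theta_d}$ where $\alpha_1,\dots,\alpha_d,\theta_1,\dots,\theta_d$ are positive reals with $1\le\theta_1<\cdots<\theta_d$ and at least one $\theta_j\notin\mathbb{Z}$. $\lVert x\rVert$ denotes the distance from $x$ to the nearest integer, and $\lfloor\cdot\rfloor$ the floor function. *)

(* Defs.v *)
From Stdlib Require Import Reals Lra Lia ZArith Znumtheory List.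
Open Scope R_scope.

Definition floorZ (x : R) : Z := (up x - 1)%Z.

Definition dist_int (x : R) : R :=
  Rmin (x - IZR (floorZ x)) (IZR (floorZ x) + 1 - x).

(* A pseudo-polynomial given by coefficients alpha_1..alpha_d and exponents
   theta_1..theta_d (indices 0..d-1): f(x) = sum_j alpha_j x^theta_j. *)
Definition is_pseudo_poly (d : nat) (alpha theta : nat -> R) : Prop :=
  (1 <= d)%nat /\
  (forall j, (j < d)%nat -> 0 < alpha j) /\
  1 <= theta 0%nat /\
  (forall j, (S j < d)%nat -> theta j < theta (S j)) /\
  (exists j, (j < d)%nat /\ forall z : Z, theta j <> IZR z).

Definition pseudo_poly (d : nat) (alpha theta : nat -> R) (x : R) : R :=
  fold_right Rplus 0 (map (fun j => alpha j * Rpower x (theta j)) (seq 0 d)).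

(* Main.v *)
Require Import Defs.
From Stdlib Require Import Reals Lra Lia ZArith Znumtheory List.
From Stdlib Require Import Classical.
From Coquelicot Require Complex.
From HB Require structures.
From mathcomp Require all_boot zify.
Open Scope R_scope.

(** Write f for the pseudo-polynomial and e(t) = exp(2 pi i t).

    The core is a power saving for the sum of Lambda(n) e(beta f(n)) over
    M <= n < 2M, uniformly for M^(-1/16) <= |beta| <= M^(1/16). Vaughan's
    identity reduces it to sums of e(g(n)) over intervals, with g(n) = beta f(Dn)
    or g(n) = beta (f(c n) - f(c' n)). The derivatives of g of order k > deg f
    are governed by the largest non-integral exponent of f, so k Weyl
    differencings on blocks of suitable length followed by the Kusmin-Landau
    estimate give the saving.

    Given xi and N, two cases arise. If |q xi - a| < N^(-1/64) for a small q,
    it suffices to find a prime p, up to a small power of N, for which q divides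
    floor(f(p)), i.e. f(p)/q lies in [0, 1/q) modulo 1. Otherwise every frequency
    k + h xi with small h, k lies in the admissible range of beta, so
    (f(p), xi f(p)) is well distributed modulo 1 and for some p <= N both f(p)
    and xi f(p) are slightly above, resp. close to, an integer. In both cases
    the prime is detected by mean squares of Dirichlet kernels. *)

(** The lower bound on the frequency shapes the case distinction: a frequency [k + h xi] too close
    to 0 escapes the exponential sum bound, and that happens only when a small multiple of [xi] is
    nearly an integer. In that case [q | floor (f p)] multiplies the error [|q xi - a|] by
    [floor (f p) / q], so [p] has to be so small that [f p] cannot outweigh this error. In the other
    case [f p] is asked to lie just above an integer [z], because [z] is then its floor and [xi z]
    stays near [xi f p]. An integral exponent may dominate [f], but differentiating beyond the
    degree annihilates it, while every non-integral exponent survives. The number [k] of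
    differencings is also large enough for the blocks to have length a power of [M] even in the
    short inner sums. The primes enter through a single dyadic block whose weight is at least its
    length up to a factor [M^eps]. The power saving outweighs this loss, so Chebyshev's bound and
    the pigeonhole principle supply the block. All exponents come from [f]; [xi] only affects how
    large [N] must be. *)

Module PrimeValues.
Import Coquelicot.Complex.
Import HB.structures.
Import mathcomp.boot.all_boot mathcomp.zify.zify.
Set Implicit Arguments. Unset Strict Implicit. Unset Printing Implicit Defensive.
(* [all_boot] rebinds the key [R] to [ring_scope]. *)
Delimit Scope R_scope with R.
Open Scope R_scope.

(** * Finite sums *)

HB.instance Definition _ := Monoid.isComLaw.Build R 0 Rplus
  (fun x y z => esym (Rplus_assoc x y z)) Rplus_comm Rplus_0_l.
HB.instance Definition _ := Monoid.isComLaw.Build C (RtoC 0) Cplus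
  Cplus_assoc Cplus_comm Cplus_0_l.

Reserved Notation "\rsum_ ( m <= i < n | P ) F"
  (at level 41, F at level 41, i, m, n at level 50).
Reserved Notation "\rsum_ ( m <= i < n ) F"
  (at level 41, F at level 41, i, m, n at level 50).
Reserved Notation "\csum_ ( m <= i < n | P ) F"
  (at level 41, F at level 41, i, m, n at level 50).
Reserved Notation "\csum_ ( m <= i < n ) F"
  (at level 41, F at level 41, i, m, n at level 50).
Notation "\rsum_ ( m <= i < n | P ) F" :=
  (\big[Rplus/0]_(m%N <= i < n%N | P%B) F%R).
Notation "\rsum_ ( m <= i < n ) F" := (\big[Rplus/0]_(m%N <= i < n%N) F%R).
Notation "\csum_ ( m <= i < n | P ) F" :=
  (\big[Cplus/(RtoC 0)]_(m%N <= i < n%N | P%B) F%C).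
Notation "\csum_ ( m <= i < n ) F" := (\big[Cplus/(RtoC 0)]_(m%N <= i < n%N) F%C).

Section Sums.
Implicit Types (a b m n : nat) (P : pred nat) (F G : nat -> R) (z w : nat -> C).

Lemma rsum_mull c a b P F :
  c * (\rsum_(a <= i < b | P i) F i) = \rsum_(a <= i < b | P i) (c * F i).
Proof. exact: (big_morph _ (Rmult_plus_distr_l c) (Rmult_0_r c)). Qed.

Lemma rsum_mulr c a b P F :
  (\rsum_(a <= i < b | P i) F i) * c = \rsum_(a <= i < b | P i) (F i * c).
Proof. by rewrite Rmult_comm rsum_mull; apply: eq_bigr => i _; rewrite Rmult_comm. Qed.

Lemma csum_mull c a b P z :
  (c * (\csum_(a <= i < b | P i) z i))%C = \csum_(a <= i < b | P i) (c * z i).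
Proof. exact: (big_morph _ (Cmult_plus_distr_l c) (Cmult_0_r c)). Qed.

Lemma csum_mulr c a b P z :
  ((\csum_(a <= i < b | P i) z i) * c)%C = \csum_(a <= i < b | P i) (z i * c).
Proof. by rewrite Cmult_comm csum_mull; apply: eq_bigr => i _; rewrite Cmult_comm. Qed.

Lemma csum_conj a b P z :
  Cconj (\csum_(a <= i < b | P i) z i) = \csum_(a <= i < b | P i) Cconj (z i).
Proof. by apply: (big_morph _ Cplus_conj); rewrite /Cconj /= Ropp_0. Qed.

Lemma Re_csum a b P z :
  Re (\csum_(a <= i < b | P i) z i) = \rsum_(a <= i < b | P i) Re (z i).
Proof. by apply: (big_morph Re). Qed.

Lemma RtoC_rsum a b P F :
  RtoC (\rsum_(a <= i < b | P i) F i) = \csum_(a <= i < b | P i) RtoC (F i).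
Proof. exact: (big_morph _ RtoC_plus). Qed.

Lemma rsum_le a b P F G :
  (forall i, (a <= i < b)%N -> P i -> F i <= G i) ->
  \rsum_(a <= i < b | P i) F i <= \rsum_(a <= i < b | P i) G i.
Proof.
move=> FG; rewrite big_nat_cond [X in _ <= X]big_nat_cond.
apply: (big_ind2 (fun x y => x <= y)); first lra; first by move=> *; lra.
by move=> i /andP[ai Pi]; apply: FG.
Qed.

Lemma rsum_ge0 a b P F :
  (forall i, (a <= i < b)%N -> P i -> 0 <= F i) ->
  0 <= \rsum_(a <= i < b | P i) F i.
Proof.
move=> F0; rewrite big_nat_cond; apply: (big_ind (fun x => 0 <= x)); first lra.
  by move=> *; lra.
by move=> i /andP[ai Pi]; apply: F0.
Qed.

Lemma rsum_le_cond a b P F :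
  (forall i, (a <= i < b)%N -> 0 <= F i) ->
  \rsum_(a <= i < b | P i) F i <= \rsum_(a <= i < b) F i.
Proof.
move=> F0; rewrite big_mkcond; apply: rsum_le => i ai _.
by case: (P i); [lra|apply: F0].
Qed.

Lemma rsum_const a b c : \rsum_(a <= i < b) c = INR (b - a) * c.
Proof.
rewrite big_const_nat; elim: (b - a)%N => [|n IH]; first by rewrite /=; lra.
by rewrite iterS IH S_INR; lra.
Qed.

Lemma rsum_le_const a b P F c : 0 <= c ->
  (forall i, (a <= i < b)%N -> P i -> F i <= c) ->
  \rsum_(a <= i < b | P i) F i <= INR (b - a) * c.
Proof.
move=> c0 Fc; rewrite -rsum_const.
apply: Rle_trans (rsum_le_cond _ _); last by move=> *.
exact: rsum_le.
Qed.

Lemma Cmod_csum a b P z :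
  Cmod (\csum_(a <= i < b | P i) z i) <= \rsum_(a <= i < b | P i) Cmod (z i).
Proof.
apply: (big_ind2 (fun x y => Cmod x <= y)); first by rewrite Cmod_0; lra.
  by move=> x1 x2 y1 y2 h1 h2; have := Cmod_triangle x1 y1; lra.
by move=> i _; lra.
Qed.

Lemma csum_le_const a b P z c : 0 <= c ->
  (forall i, (a <= i < b)%N -> P i -> Cmod (z i) <= c) ->
  Cmod (\csum_(a <= i < b | P i) z i) <= INR (b - a) * c.
Proof. by move=> c0 zc; apply: Rle_trans (Cmod_csum _ _ _ _) _; apply: rsum_le_const. Qed.

(** The quadratic form [s^2 y - 2 s r x + r^2 t] is a sum of squares, and [(s, r) = (t, x)] gives
    [t (y t - x^2) >= 0]. The case [t = 0] is settled by [(x / y, 1)], or by [(x, 1)] when [y]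
    vanishes too. *)
Lemma rsum_cauchy a b P F G :
  (\rsum_(a <= i < b | P i) (F i * G i)) ^ 2 <=
  (\rsum_(a <= i < b | P i) F i ^ 2) * (\rsum_(a <= i < b | P i) G i ^ 2).
Proof.
set x := \rsum_(a <= i < b | P i) (F i * G i).
set y := \rsum_(a <= i < b | P i) F i ^ 2.
set t := \rsum_(a <= i < b | P i) G i ^ 2.
have q s r : 0 <= s ^ 2 * y - 2 * (s * r) * x + r ^ 2 * t.
  rewrite /x /y /t !rsum_mull.
  suff -> : \rsum_(a <= i < b | P i) (s ^ 2 * F i ^ 2) -
     \rsum_(a <= i < b | P i) (2 * (s * r) * (F i * G i)) +
     \rsum_(a <= i < b | P i) (r ^ 2 * G i ^ 2) =
     \rsum_(a <= i < b | P i) ((s * F i - r * G i) ^ 2).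
    by apply: rsum_ge0 => i _ _; apply: pow2_ge_0.
  rewrite [RHS](eq_bigr (fun i => (s ^ 2 * F i ^ 2 + (-1) * (2 * (s * r) * (F i * G i)))
     + r ^ 2 * G i ^ 2)); last by move=> i _; ring.
  by rewrite !big_split /= -(rsum_mull (-1)); ring.
have y0 : 0 <= y by apply: rsum_ge0 => i _ _; apply: pow2_ge_0.
have t0 : 0 <= t by apply: rsum_ge0 => i _ _; apply: pow2_ge_0.
case: (Req_dec t 0) => [t00|tn0].
  case: (Req_dec y 0) => [y00|yn0].
    have := q x 1; have := q 1 x; rewrite t00 y00; nra.
  have := q (x / y) 1; rewrite t00.
  have -> : (x / y) ^ 2 * y - 2 * (x / y * 1) * x + 1 ^ 2 * 0 = - (x ^ 2 / y) by field.
  have : 0 < y by lra.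
  move=> yp h. have : x ^ 2 / y * y <= 0 * y by apply: Rmult_le_compat_r; lra.
  have -> : x ^ 2 / y * y = x ^ 2 by field; lra.
  move=> ?; lra.
have := q t x; have tp : 0 < t by lra.
have -> : t ^ 2 * y - 2 * (t * x) * x + x ^ 2 * t = t * (y * t - x ^ 2) by ring.
move=> h; apply: Rnot_lt_le => h'; nra.
Qed.

Lemma rsum_pow2_le m F :
  (\rsum_(0 <= i < m) F i) ^ 2 <= INR m * \rsum_(0 <= i < m) F i ^ 2.
Proof.
have := rsum_cauchy 0 m xpredT (fun=> 1) F.
have -> : \rsum_(0 <= i < m) (1 * F i) = \rsum_(0 <= i < m) F i.
  by apply: eq_bigr => i _; ring.
have -> // : \rsum_(0 <= i < m) 1 ^ 2 = INR m.
by rewrite rsum_const subn0 pow1 Rmult_1_r.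
Qed.

(** Cauchy-Schwarz iterated [j] times. Only exponents [2 ^ j] occur, since each Weyl differencing
    squares the sum. *)
Lemma rsum_power_mean j m F : (forall i, 0 <= F i) ->
  (\rsum_(0 <= i < m) F i) ^ (2 ^ j) <=
  INR m ^ (2 ^ j - 1) * \rsum_(0 <= i < m) F i ^ (2 ^ j).
Proof.
elim: j F => [|j IH] F F0.
  by rewrite /= !Rmult_1_r Rmult_1_l; apply: Req_le; apply: eq_bigr => i _; rewrite Rmult_1_r.
have pj : (0 < 2 ^ j)%N by rewrite expn_gt0.
have e2 : (2 ^ j.+1 = 2 * 2 ^ j)%N by rewrite expnS.
rewrite e2 -[(2 * 2 ^ j)%N]/(Nat.mul 2 (2 ^ j)) pow_mult.
have S0 : 0 <= \rsum_(0 <= i < m) F i by apply: rsum_ge0.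
apply: Rle_trans (pow_incr _ (INR m * \rsum_(0 <= i < m) F i ^ 2) _ _) _.
  by split; [apply: pow2_ge_0|apply: rsum_pow2_le].
rewrite Rpow_mult_distr.
have := IH (fun i => F i ^ 2) (fun i => pow2_ge_0 _).
have -> : \rsum_(0 <= i < m) (F i ^ 2) ^ (2 ^ j) = \rsum_(0 <= i < m) F i ^ (Nat.mul 2 (2 ^ j)).
  by apply: eq_bigr => i _; rewrite pow_mult.
move=> h.
have -> : (Nat.mul 2 (2 ^ j) - 1)%N = Nat.add (2 ^ j) (2 ^ j - 1)%N by lia.
rewrite pow_add Rmult_assoc; apply: Rmult_le_compat_l h.
by apply: pow_le; apply: pos_INR.
Qed.

(** Range conditions such as [M <= D * n < 2 * M], and conjunctions of them, are convex in [n]. A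
    sum restricted by them thus becomes a sum over an interval, as the exponential sum bounds
    require. *)
Lemma csum_convex P n z :
  (forall i j k, (i <= j <= k)%N -> P i -> P k -> P j) ->
  exists a b, (forall i, (a <= i < b)%N -> P i /\ (i < n)%N) /\
   \csum_(0 <= i < n | P i) z i = \csum_(a <= i < b) z i.
Proof.
move=> cv.
suff [a [b [hab hP]]] : exists a b, (a <= b <= n)%N /\
    (forall i, (i < n)%N -> P i = (a <= i < b)%N).
  exists a, b; split=> [i iab|]; first by rewrite hP; lia.
  rewrite (@big_cat_nat _ _ _ a 0 n) ?(@big_cat_nat _ _ _ b a n) //=; try lia.
  rewrite big1_seq ?[X in (_ + (_ + X))%C]big1_seq => [||].
  - rewrite Cplus_0_l Cplus_0_r big_mkcond; apply: eq_big_nat => i iab.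
    by rewrite hP ?iab //; lia.
  - by move=> i /andP[Pi]; rewrite mem_index_iota => ib; move: Pi; rewrite hP; lia.
  - by move=> i /andP[Pi]; rewrite mem_index_iota => ib; move: Pi; rewrite hP; lia.
elim: n => [|n [a [b [hab hP]]]]; first by exists 0%N, 0%N; split.
case Pn: (P n); last first.
  exists a, b; split=> [|i]; first lia.
  by rewrite ltnS leq_eqVlt => /orP[/eqP->|/hP //]; rewrite Pn; lia.
case: (ltnP a b) => ab; last first.
  exists n, n.+1; split=> [|i]; first lia.
  by rewrite ltnS leq_eqVlt => /orP[/eqP->|/[dup] /hP ->]; rewrite ?Pn; lia.
have bn : b = n.
  apply/eqP; apply: contraT => bn.
  have Pa : P a by rewrite hP; lia.
  have : P b by apply: (cv a b n) => //; lia.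
  by rewrite hP; lia.
exists a, n.+1; split=> [|i]; first lia.
by rewrite ltnS leq_eqVlt => /orP[/eqP->|/[dup] /hP ->]; rewrite ?Pn; lia.
Qed.

End Sums.

(** * Exponential sums: Kusmin-Landau and Weyl differencing *)

Definition expi (t : R) : C := (cos (2 * PI * t), sin (2 * PI * t)).

Lemma expiD s t : expi (s + t) = (expi s * expi t)%C.
Proof.
rewrite /expi /Cmult /= Rmult_plus_distr_l cos_plus sin_plus.
by congr (_, _); ring.
Qed.

Lemma expi_conj t : Cconj (expi t) = expi (- t).
Proof. by rewrite /expi /Cconj /= Ropp_mult_distr_r_reverse cos_neg sin_neg. Qed.

Lemma expi0 : expi 0 = RtoC 1.
Proof. by rewrite /expi Rmult_0_r cos_0 sin_0. Qed.

Lemma Cmod_expi t : Cmod (expi t) = 1.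
Proof.
rewrite /Cmod /expi /= !Rmult_1_r.
have := sin2_cos2 (2 * PI * t); rewrite /Rsqr => h.
by rewrite Rplus_comm h sqrt_1.
Qed.

Lemma expi_nat (n : nat) : expi (INR n) = RtoC 1.
Proof.
rewrite /expi; have -> : 2 * PI * INR n = 0 + 2 * INR n * PI by ring.
by rewrite cos_period sin_period cos_0 sin_0.
Qed.

Lemma expi_IZR (k : Z) : expi (IZR k) = RtoC 1.
Proof.
case: (Z_le_gt_dec 0 k) => k0.
  by rewrite -(Z2Nat.id k) // -INR_IZR_INZ expi_nat.
have -> : IZR k = - INR (Z.to_nat (- k)).
  by rewrite INR_IZR_INZ Z2Nat.id ?opp_IZR; [ring|lia].
by rewrite -expi_conj expi_nat /Cconj /= Ropp_0.
Qed.

Lemma Cmod_1_expi t : Cmod (1 - expi t) = 2 * Rabs (sin (PI * t)).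
Proof.
rewrite -[RHS]Rabs_pos_eq; last by have := Rabs_pos (sin (PI * t)); lra.
rewrite -sqrt_Rsqr_abs /Cmod; congr sqrt.
rewrite /expi /Cminus /Cplus /Copp /= /Rsqr.
have -> : 2 * PI * t = 2 * (PI * t) by ring.
rewrite cos_2a_sin sin_2a.
have -> : 2 * Rabs (sin (PI * t)) * (2 * Rabs (sin (PI * t))) = 4 * (Rabs (sin (PI * t)) * Rabs (sin (PI * t))) by ring.
rewrite -Rabs_mult Rabs_pos_eq; last by nra.
have := sin2_cos2 (PI * t); rewrite /Rsqr => h.
set s := sin _ in h *; set c := cos _ in h *.
have hc : c * c = 1 - s * s by lra.
transitivity (4 * (s * s) * (s * s) + 4 * (s * s) * (c * c)); first by ring.
by rewrite hc; ring.
Qed.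

(** Duplication gives [sin x = 2 sin (x/2) cos (x/2)], and [sin (x/2)] is [x/2] times the cosine of
    an intermediate point. Both cosines are at least [cos (PI/4)], whose square is 1/2. *)
Lemma sin_ge_half x : 0 <= x <= PI / 2 -> x / 2 <= sin x.
Proof.
move=> [x0 x1]; case: (Req_dec x 0) => [->|xn0]; first by rewrite sin_0; lra.
have hp := PI_RGT_0.
have [c [hc [c0 c1]]] := MVT_cor2 sin cos 0 (x / 2) ltac:(lra) (fun c _ => derivable_pt_lim_sin c).
rewrite sin_0 in hc.
have c4 : cos (PI / 4) * cos (PI / 4) = / 2.
  have := cos_2a_cos (PI / 4); have -> : 2 * (PI / 4) = PI / 2 by field.
  by rewrite cos_PI2; lra.
have c4p : 0 < cos (PI / 4) by apply: cos_gt_0; lra.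
have h1 : cos (PI / 4) <= cos c by apply: cos_decr_1; lra.
have h2 : cos (PI / 4) <= cos (x / 2) by apply: cos_decr_1; lra.
have -> : x = 2 * (x / 2) by field.
rewrite sin_2a; have -> : sin (x / 2) = cos c * (x / 2) by lra.
have : cos (PI / 4) * cos (PI / 4) <= cos c * cos (x / 2) by apply: Rmult_le_compat; lra.
rewrite c4; set p := cos c * cos (x / 2) => hp'.
have -> : 2 * (cos c * (x / 2)) * cos (x / 2) = x * p by rewrite /p; field.
nra.
Qed.

Lemma Cmod_1_expi_ge t : Rabs t <= / 2 -> Rabs t <= Cmod (1 - expi t).
Proof.
move=> ht; rewrite Cmod_1_expi; have hp := PI_RGT_0; have hp3 := PI2_3_2.
have h : PI * Rabs t / 2 <= sin (PI * Rabs t).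
  by apply: sin_ge_half; have := Rabs_pos t; nra.
have hs : Rabs (sin (PI * t)) = Rabs (sin (PI * Rabs t)).
  case: (Rcase_abs t) => t0; last by rewrite (Rabs_right t).
  by rewrite (Rabs_left t) // Ropp_mult_distr_r_reverse sin_neg Rabs_Ropp.
rewrite hs; have := Rle_abs (sin (PI * Rabs t)).
have := Rabs_pos t; nra.
Qed.

Lemma Cmod_1_expi_le t : Cmod (1 - expi t) <= 8 * Rabs t.
Proof.
rewrite Cmod_1_expi; have hp := PI_RGT_0; have hp4 := PI_4.
have h x : 0 <= x -> Rabs (sin x) <= x.
  move=> x0; case: (Rle_dec x 1) => x1.
    rewrite Rabs_pos_eq; last by apply: sin_ge_0; [|have := PI2_1]; lra.
    case: (Req_dec x 0) => [->|xn0]; first by rewrite sin_0; lra.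
    by apply: Rlt_le; apply: sin_lt_x; lra.
  by have := SIN_bound x => hb; apply: Rabs_le; lra.
have hs : Rabs (sin (PI * t)) = Rabs (sin (PI * Rabs t)).
  case: (Rcase_abs t) => t0; last by rewrite (Rabs_right t).
  by rewrite (Rabs_left t) // Ropp_mult_distr_r_reverse sin_neg Rabs_Ropp.
rewrite hs; have := h (PI * Rabs t) ltac:(have := Rabs_pos t; nra).
have := Rabs_pos t; nra.
Qed.

Lemma Cmod_expi_sub s t : Cmod (expi s - expi t) <= 8 * Rabs (s - t).
Proof.
have -> : (expi s - expi t = expi s * (1 - expi (t - s)))%C.
  have -> : expi t = (expi s * expi (t - s))%C by rewrite -expiD; congr expi; ring.
  by ring.
by rewrite Cmod_mult Cmod_expi Rmult_1_l Rabs_minus_sym; apply: Cmod_1_expi_le.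
Qed.

Section KusminLandau.
Variables (u : nat -> R) (L H : nat) (lam K : R).
Hypotheses (lam0 : 0 < lam) (lam1 : lam <= / 2) (K0 : 0 <= K) (LH : (L <= H)%N).
Hypothesis d1 : forall n, (n.+1 < L)%N -> lam <= Rabs (u n.+1 - u n) <= / 2.
Hypothesis d2 : forall n, (n.+2 < L)%N ->
  Rabs (u n.+2 - 2 * u n.+1 + u n) * INR H <= K * lam.

(** The telescoping factor: [expi (u n) = c n * (expi (u n) - expi (u n.+1))]. *)
Let c n : C := (/ (1 - expi (u n.+1 - u n)))%C.

Let den n : (n.+1 < L)%N -> lam <= Cmod (1 - expi (u n.+1 - u n)).
Proof. by move/d1 => [h1 h2]; have := Cmod_1_expi_ge h2; lra. Qed.

Let den0 n : (n.+1 < L)%N -> (1 - expi (u n.+1 - u n))%C <> RtoC 0.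
Proof. by move=> /den h hn; move: h; rewrite hn Cmod_0; lra. Qed.

Let c_le n : (n.+1 < L)%N -> Cmod (c n) <= / lam.
Proof.
by move=> hn; rewrite Cmod_inv; [apply: Rinv_le_contravar => //; apply: den|apply: den0].
Qed.

Let c_step n : (n.+1 < L)%N -> expi (u n) = (c n * (expi (u n) - expi (u n.+1)))%C.
Proof.
move=> hn; have h := den0 hn.
have e : expi (u n.+1) = (expi (u n) * expi (u n.+1 - u n))%C by rewrite -expiD; congr expi; ring.
by rewrite /c e; field.
Qed.

Let c_diff n : (n.+2 < L)%N -> Cmod (c n.+1 - c n) * INR H <= 8 * K / lam.
Proof.
move=> hn; have h1 := den0 hn; have h0 : (n.+1 < L)%N by lia.
have h2 := den0 h0.
have -> : (c n.+1 - c n = (expi (u n.+2 - u n.+1) - expi (u n.+1 - u n)) * c n.+1 * c n)%C.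
  by rewrite /c; field.
rewrite !Cmod_mult.
have hs : Cmod (expi (u n.+2 - u n.+1) - expi (u n.+1 - u n)) * INR H <= 8 * (K * lam).
  apply: Rle_trans (Rmult_le_compat_r _ _ _ (pos_INR H) (Cmod_expi_sub _ _)) _.
  have -> : u n.+2 - u n.+1 - (u n.+1 - u n) = u n.+2 - 2 * u n.+1 + u n by ring.
  by have := d2 hn; lra.
have c1 := c_le hn; have c0 := c_le h0.
have hi : 0 < / lam by apply: Rinv_0_lt_compat.
have cc : Cmod (c n.+1) * Cmod (c n) <= / lam * / lam.
  by apply: Rmult_le_compat => //; apply: Cmod_ge_0.
have ge1 := Cmod_ge_0 (expi (u n.+2 - u n.+1) - expi (u n.+1 - u n)).
have ge2 : 0 <= Cmod (c n.+1) * Cmod (c n) by apply: Rmult_le_pos; apply: Cmod_ge_0.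
set x := Cmod _ in hs ge1 *; set y := Cmod _ in cc ge2 *; set t := Cmod _ in cc ge2 *.
have -> : x * y * t * INR H = (x * INR H) * (y * t) by ring.
apply: Rle_trans (_ : 8 * (K * lam) * (/ lam * / lam) <= _).
  by apply: Rmult_le_compat => //; apply: Rmult_le_pos => //; apply: pos_INR.
by apply: Req_le; field; lra.
Qed.

(** Partial summation with the factor [c]. The classical argument controls its variation by monotone
    differences of [u]; here each of fewer than [H] steps varies by at most [8 K / (lam H)], by the
    bound on second differences. A difference of modulus at most 1/2 has 0 as a nearest integer,
    hence [1 / lam] bounds [c]. *)
Lemma kusmin_landau :
  Cmod (\csum_(0 <= n < L) expi (u n)) <= (3 + 8 * K) / lam.
Proof.
have hi : 2 <= / lam.
  by rewrite -(Rinv_inv 2); apply: Rinv_le_contravar; lra.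
(* The boundary term stays attached: passing to [m.+1] then only adds
   [(c m.+1 - c m) * expi (u m.+1)]. *)
have key m : (m.+1 < L)%N ->
    Cmod (\csum_(0 <= n < m.+1) expi (u n) + c m * expi (u m.+1)) * INR H
     <= / lam * INR H + INR m * (8 * K / lam).
  elim: m => [|m IH] hm.
    rewrite big_nat1 {1}(c_step hm).
    have -> : (c 0%N * (expi (u 0%N) - expi (u 1%N)) + c 0%N * expi (u 1%N) = c 0%N * expi (u 0%N))%C by ring.
    rewrite Cmod_mult Cmod_expi Rmult_1_r /= Rmult_0_l Rplus_0_r.
    by apply: Rmult_le_compat_r (c_le hm); apply: pos_INR.
  have hm' : (m.+1 < L)%N by lia.
  rewrite big_nat_recr // {1}(c_step hm) S_INR.
  set s := \csum_(0 <= n < m.+1) _ in IH *.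
  have -> : (s + c m.+1 * (expi (u m.+1) - expi (u m.+2)) + c m.+1 * expi (u m.+2)
    = (s + c m * expi (u m.+1)) + (c m.+1 - c m) * expi (u m.+1))%C by ring.
  have h1 := Cmod_triangle (s + c m * expi (u m.+1)) ((c m.+1 - c m) * expi (u m.+1)).
  rewrite Cmod_mult Cmod_expi Rmult_1_r in h1.
  have := IH hm'; have := c_diff hm.
  have := Rmult_le_compat_r _ _ _ (pos_INR H) h1; lra.
case: (posnP L) => [->|Lp].
  rewrite big_geq // Cmod_0; apply: Rmult_le_pos; lra.
case: (ltnP 1 L) => L1; last first.
  have -> : L = 1%N by lia.
  rewrite big_nat1 Cmod_expi /Rdiv; nra.
have [m hm] : exists m, L = m.+2 by exists L.-2; lia.
have hm1 : (m.+1 < L)%N by lia.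
have hk := key m hm1.
have Hp : 0 < INR H by apply: lt_0_INR; lia.
have hmH : INR m <= INR H by apply: le_INR; lia.
have h8 : 0 <= 8 * K / lam by apply: Rmult_le_pos; lra.
have {}hk : Cmod (\csum_(0 <= n < m.+1) expi (u n) + c m * expi (u m.+1)) <= / lam + 8 * K / lam.
  by apply: (Rmult_le_reg_r (INR H)) => //; nra.
rewrite hm big_nat_recr //=; set s := \csum_(0 <= n < m.+1) _ in hk *.
have -> : (s + expi (u m.+1) = (s + c m * expi (u m.+1)) + (1 - c m) * expi (u m.+1))%C by ring.
apply: Rle_trans (Cmod_triangle _ _) _; rewrite Cmod_mult Cmod_expi Rmult_1_r.
have := Cmod_triangle 1 (- c m); rewrite Cmod_opp Cmod_1.
have := c_le hm1; rewrite /Rdiv in hk *; rewrite -/(Cminus _ _).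
by rewrite Rmult_plus_distr_r; lra.
Qed.

End KusminLandau.

(** The square is expanded and the pairs are grouped by their distance [h]; the two orders of a pair
    are conjugate, whence the factor 2. *)
Lemma weyl_differencing L (z : nat -> C) : (forall n, Cmod (z n) <= 1) ->
  Cmod (\csum_(0 <= n < L) z n) ^ 2 <=
  INR L + 2 * \rsum_(1 <= h < L) Cmod (\csum_(0 <= n < L - h) (z (n + h)%N * Cconj (z n))).
Proof.
move=> z1.
have key : Cmod (\csum_(0 <= n < L) z n) ^ 2 = \rsum_(0 <= n < L) Cmod (z n) ^ 2 +
   2 * Re (\csum_(1 <= h < L) \csum_(0 <= n < L - h) (z (n + h)%N * Cconj (z n))).
  elim: L => [|L IH].
    by rewrite !big_geq // Cmod_0 /=; ring.
  (* The pairs that involve the new term are [(L, L - h)], one for each [h] from 1 to [L]. *)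
  have -> : \csum_(1 <= h < L.+1) \csum_(0 <= n < L.+1 - h) (z (n + h)%N * Cconj (z n)) =
      (\csum_(1 <= h < L) \csum_(0 <= n < L - h) (z (n + h)%N * Cconj (z n)) +
       z L * Cconj (\csum_(0 <= n < L) z n))%C.
    rewrite csum_conj csum_mull.
    have -> : \csum_(0 <= n < L) (z L * Cconj (z n)) = \csum_(1 <= h < L.+1) (z L * Cconj (z (L - h)%N)).
      rewrite big_add1 /= big_nat_rev /= add0n; apply: eq_big_nat => i hi.
      by rewrite subnS.
    case: L {IH} => [|L]; first by rewrite !big_geq //; ring.
    have -> : \csum_(1 <= h < L.+1) \csum_(0 <= n < L.+1 - h) (z (n + h)%N * Cconj (z n)) =
        \csum_(1 <= h < L.+2) \csum_(0 <= n < L.+1 - h) (z (n + h)%N * Cconj (z n)).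
      by rewrite [RHS]big_nat_recr //= subnn [X in (_ + X)%C]big_geq // Cplus_0_r.
    rewrite -big_split /=; apply: eq_big_nat => h hh.
    have -> : (L.+2 - h = (L.+1 - h).+1)%N by lia.
    rewrite big_nat_recr //=; congr (_ + _ * _)%C; congr z; lia.
  rewrite !big_nat_recr //.
  set s := \csum_(0 <= n < L) z n in IH *.
  set t := \csum_(1 <= h < L) _ in IH *.
  have -> : Cmod (s + z L) ^ 2 = Cmod s ^ 2 + Cmod (z L) ^ 2 + 2 * Re (z L * Cconj s).
    rewrite !Cmod2_alt; case: (s) => a b; case: (z L) => a' b' /=; ring.
  by rewrite IH; case: (t) => a b; case: (z L * Cconj s)%C => a' b'; rewrite /Re /=; ring.
rewrite key; apply: Rplus_le_compat.
  rewrite -[X in _ <= X](Rmult_1_r (INR L)) -{2}(subn0 L); apply: rsum_le_const; first lra.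
  move=> i _ _; have := z1 i; have := Cmod_ge_0 (z i); nra.
apply: Rmult_le_compat_l; first lra.
rewrite Re_csum; apply: rsum_le => h _ _.
by apply: Rle_trans (re_le_Cmod _); apply: Rle_abs.
Qed.

(* All [j]-fold differences of the phase [u] with steps [h_1, ..., h_j] satisfy
   the hypotheses of [kusmin_landau] with parameter [lam * h_1 * ... * h_j]. *)
Fixpoint vdc_phase (K : R) (H j : nat) (u : nat -> R) (lam : R) (L : nat) : Prop :=
  if j is i.+1 then
    forall h, (0 < h < L)%N ->
      vdc_phase K H i (fun n => u (n + h)%N - u n) (lam * INR h) (L - h)
  else
    (forall n, (n.+1 < L)%N -> lam <= Rabs (u n.+1 - u n) <= / 2) /\
    (forall n, (n.+2 < L)%N -> Rabs (u n.+2 - 2 * u n.+1 + u n) * INR H <= K * lam).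

Lemma pow_sum_le m a b : 0 <= a -> 0 <= b -> (a + b) ^ m <= 2 ^ m * (a ^ m + b ^ m).
Proof.
move=> a0 b0.
have [ha hb] : 0 <= a ^ m /\ 0 <= b ^ m by split; apply: pow_le.
have p0 : 0 <= 2 ^ m by apply: pow_le; lra.
case: (Rle_dec a b) => ab.
  apply: Rle_trans (pow_incr _ (2 * b) m _) _; first lra.
  by rewrite Rpow_mult_distr; nra.
apply: Rle_trans (pow_incr _ (2 * a) m _) _; first lra.
by rewrite Rpow_mult_distr; nra.
Qed.

(** Induction on [j]: one differencing, the power mean over the steps [h], then the bound for [j]
    differencings with [lam * h] in place of [lam]. The sum of [1 / h] costs one factor [l].
    Normalising by a fixed [H] instead of [L] keeps the statement stable while the differenced sums
    get shorter. *)
Lemma vdc_bound K j : 0 <= K -> exists C, 0 < C /\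
  forall u lam L H l, 0 < lam -> lam * INR H ^ j <= / 2 -> (L <= H)%N -> (0 < H)%N ->
    \rsum_(1 <= h < H) / INR h <= l -> vdc_phase K H j u lam L ->
  Cmod (\csum_(0 <= n < L) expi (u n)) ^ (2 ^ j) <=
  C * INR H ^ (2 ^ j) * (/ INR H + l ^ j / (lam * INR H ^ j.+1)).
Proof.
move=> K0; elim: j => [|j [C [C0 IH]]].
  exists (3 + 8 * K); split; first lra.
  move=> u lam L H l lam0 lam1 LH H0 _ [h1 h2].
  rewrite expn0 pow_1 /= !Rmult_1_r in lam1 *.
  have HH : 0 < INR H by apply: lt_0_INR; lia.
  apply: Rle_trans (kusmin_landau lam0 lam1 K0 LH h1 h2) _.
  have -> : (3 + 8 * K) * INR H * (/ INR H + 1 / (lam * INR H)) = (3 + 8 * K) + (3 + 8 * K) / lam.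
    by field; lra.
  lra.
set m := (2 ^ j)%N; have m0 : (0 < m)%N by rewrite expn_gt0.
(* From [(H + 2 X)^m <= 2^m (H^m + 2^m X^m)], where [X] is the sum of the differenced moduli. *)
exists (2 ^ m + 2 ^ m * 2 ^ m * C); split.
  have : 0 < 2 ^ m by apply: pow_lt; lra.
  by move=> p; have := Rmult_lt_0_compat _ _ p p; nra.
move=> u lam L H l lam0 lam1 LH H0 hl hQ.
have HH : 1 <= INR H by apply: (le_INR 1); lia.
have Hj i : 0 < INR H ^ i by apply: pow_lt; lra.
have hinv h : (0 < h)%N -> 0 < / INR h.
  by move=> h0; apply: Rinv_0_lt_compat; apply: lt_0_INR; lia.
have l0 : 0 <= l.
  by apply: Rle_trans hl; apply: rsum_ge0 => i hi _; apply: Rlt_le; apply: hinv; lia.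
pose S h := Cmod (\csum_(0 <= n < L - h) expi (u (n + h)%N - u n)).
have hS : forall h, (0 < h < L)%N ->
    S h ^ m <= C * INR H ^ m * (/ INR H + l ^ j / (lam * INR H ^ j.+1) * / INR h).
  move=> h hh; have h1 : 1 <= INR h by apply: (le_INR 1); lia.
  have hH : INR h <= INR H by apply: le_INR; lia.
  have := IH (fun n => u (n + h)%N - u n) (lam * INR h) (L - h)%N H l.
  rewrite -/m -/(S h) => {}IH; apply: Rle_trans (IH _ _ _ _ hl _) _ => //.
  - by apply: Rmult_lt_0_compat; lra.
  - apply: Rle_trans lam1; rewrite /= -Rmult_assoc.
    by apply: Rmult_le_compat_r; [apply: Rlt_le; apply: Hj|nra].
  - by lia.
  - exact: hQ.
  apply: Req_le; field; repeat split; try lra; exact: not_eq_sym (Rlt_not_eq _ _ (Hj _)).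
have hX : (\rsum_(1 <= h < L) S h) ^ m <=
    INR H ^ (m - 1) * (C * INR H ^ m * (1 + l ^ j.+1 / (lam * INR H ^ j.+1))).
  rewrite big_add1 /=.
  apply: Rle_trans (rsum_power_mean j _ _) _; first by move=> i; apply: Cmod_ge_0.
  rewrite -/m; apply: Rmult_le_compat.
  - by apply: pow_le; apply: pos_INR.
  - by apply: rsum_ge0 => i _ _; apply: pow_le; apply: Cmod_ge_0.
  - by apply: pow_incr; split; [apply: pos_INR|apply: le_INR; lia].
  have -> : \rsum_(0 <= i < L.-1) S i.+1 ^ m = \rsum_(1 <= h < L) S h ^ m.
    by rewrite [RHS]big_add1.
  apply: Rle_trans (rsum_le (G := fun h => C * INR H ^ m * (/ INR H + l ^ j / (lam * INR H ^ j.+1) * / INR h)) _) _.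
    by move=> h hh _; apply: hS; lia.
  rewrite -rsum_mull; apply: Rmult_le_compat_l.
    by have := Hj m; nra.
  rewrite big_split /= rsum_const -rsum_mull; apply: Rplus_le_compat.
    apply: (Rmult_le_reg_r (INR H)); first lra.
    rewrite Rmult_assoc Rinv_l ?Rmult_1_r ?Rmult_1_l; try lra.
    by apply: le_INR; lia.
  have -> : l * l ^ j / (lam * (INR H * INR H ^ j)) = l ^ j / (lam * (INR H * INR H ^ j)) * l.
    by rewrite /Rdiv; ring.
  apply: Rmult_le_compat_l.
    apply: Rmult_le_pos; first exact: pow_le.
    apply: Rlt_le; apply: Rinv_0_lt_compat; apply: Rmult_lt_0_compat => //.
    exact: (Hj j.+1).
  apply: Rle_trans hl.
  case: (posnP L) => [->|L0]; first by rewrite big_geq //; apply: rsum_ge0 => i hi _; apply: Rlt_le; apply: hinv; lia.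
  rewrite (@big_cat_nat _ _ _ L 1 H) //=.
  rewrite -[X in X <= _]Rplus_0_r; apply: Rplus_le_compat_l.
  by apply: rsum_ge0 => i hi _; apply: Rlt_le; apply: hinv; lia.
have hW := @weyl_differencing L (fun n => expi (u n)) (fun n => Req_le _ _ (Cmod_expi _)).
have hS0 : 0 <= \rsum_(1 <= h < L) S h by apply: rsum_ge0 => i _ _; apply: Cmod_ge_0.
have {}hW : Cmod (\csum_(0 <= n < L) expi (u n)) ^ 2 <= INR H + 2 * \rsum_(1 <= h < L) S h.
  apply: Rle_trans hW _; apply: Rplus_le_compat; first by apply: le_INR; lia.
  apply: Rmult_le_compat_l; first lra.
  apply: Req_le; apply: eq_bigr => h _; congr Cmod; apply: eq_bigr => n _.
  by rewrite expi_conj -expiD.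
have -> : (2 ^ j.+1)%N = Nat.mul 2 m by rewrite expnS.
rewrite !pow_mult.
apply: Rle_trans (pow_incr _ _ m (conj (pow2_ge_0 _) hW)) _.
apply: Rle_trans (pow_sum_le _ _ _) _; [lra|lra|].
rewrite Rpow_mult_distr.
set X := _ ^ m in hX *.
have p0 : 0 < 2 ^ m by apply: pow_lt; lra.
set Y := l ^ j.+1 / (lam * INR H ^ j.+1) in hX.
have Y0 : 0 <= Y.
  by apply: Rmult_le_pos; [apply: pow_le|apply: Rlt_le; apply: Rinv_0_lt_compat; apply: Rmult_lt_0_compat].
have e1 : INR H ^ m = INR H * INR H ^ (m - 1).
  by rewrite -{1}[m](@subnK 1) // addn1.
have -> : / INR H + l ^ j.+1 / (lam * INR H ^ j.+2) = / INR H * (1 + Y).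
  rewrite /Y -[INR H ^ j.+2]/(INR H * INR H ^ j.+1); field; repeat split; try lra.
  exact: not_eq_sym (Rlt_not_eq _ _ (Hj _)).
have -> : (INR H ^ 2) ^ m = INR H ^ m * INR H ^ m.
  by rewrite -pow_mult -pow_add; congr pow; lia.
have p1 := Hj (m - 1)%N; have p2 := Hj m.
have hge : 1 <= INR H ^ (m - 1) by apply: pow_R1_Rle.
apply: Rle_trans (_ : 2 ^ m * (INR H ^ m + 2 ^ m * (INR H ^ (m - 1) * (C * INR H ^ m * (1 + Y)))) <= _).
  apply: Rmult_le_compat_l; first lra.
  by apply: Rplus_le_compat_l; apply: Rmult_le_compat_l; lra.
have -> : (2 ^ m + 2 ^ m * 2 ^ m * C) * (INR H ^ m * INR H ^ m) * (/ INR H * (1 + Y)) =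
  (2 ^ m + 2 ^ m * 2 ^ m * C) * (INR H ^ (m - 1) * INR H ^ m) * (1 + Y).
  by rewrite {1}e1; field; lra.
set A := INR H ^ (m - 1) in p1 hge *; set B := INR H ^ m in p2 *; set P := 2 ^ m in p0 *.
have : P * B <= P * (A * B) * (1 + Y).
  have h1 : B <= A * B by nra.
  have h2 : P * B <= P * (A * B) by apply: Rmult_le_compat_l; lra.
  have h3 : 0 <= P * (A * B) * Y by apply: Rmult_le_pos => //; nra.
  nra.
nra.
Qed.

Lemma eq_vdc_phase K H j u v lam L : (forall n, u n = v n) ->
  vdc_phase K H j u lam L -> vdc_phase K H j v lam L.
Proof.
elim: j u v lam L => [|j IH] u v lam L uv /=.
  by move=> [h1 h2]; split=> n hn; rewrite -!uv; [apply: h1|apply: h2].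
by move=> hu h hh; apply: IH (hu h hh) => n; rewrite !uv.
Qed.

(** By the mean value theorem a difference with step [h] is [h] times the next derivative at an
    intermediate point. Each differencing therefore multiplies all three bounds by [h] and shortens
    the interval by [h]; as [h <= H], the condition on [mu * H ^ j] leaves first differences of size
    at most 1/2. *)
Lemma vdc_phase_deriv K H j (g : nat -> R -> R) x0 Y L lam mu kap :
  (forall i x, x0 <= x <= x0 + Y -> derivable_pt_lim (g i) x (g i.+1 x)) ->
  (forall x, x0 <= x <= x0 + Y -> lam <= g j.+1 x <= mu) ->
  (forall x, x0 <= x <= x0 + Y -> Rabs (g j.+2 x) <= kap) ->
  0 < lam -> mu * INR H ^ j <= / 2 -> kap * INR H <= K * lam ->
  INR L <= Y + 1 -> (L <= H)%N ->
  vdc_phase K H j (fun n => g 0%N (x0 + INR n)) lam L.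
Proof.
elim: j g Y L lam mu kap => [|j IH] g Y L lam mu kap dg g1 g2 lam0 hmu hkap LY LH.
  rewrite /= Rmult_1_r in hmu; split=> n hn; cbv beta.
    have hn' : INR n + 1 + 1 <= INR L by rewrite -!S_INR; apply: le_INR; lia.
    have n0 := pos_INR n.
    have [c [hc [c0 c1]]] := MVT_cor2 (g 0%N) (g 1%N) (x0 + INR n) (x0 + INR n.+1)
      ltac:(rewrite S_INR; lra) (fun c hc => dg 0%N c ltac:(rewrite S_INR in hc; lra)).
    rewrite hc S_INR; rewrite S_INR in c1.
    have -> : x0 + (INR n + 1) - (x0 + INR n) = 1 by ring.
    by have := g1 c ltac:(lra); rewrite Rmult_1_r => h; rewrite Rabs_pos_eq; lra.
  have hn' : INR n + 1 + 1 + 1 <= INR L by rewrite -!S_INR; apply: le_INR; lia.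
  have n0 := pos_INR n; rewrite !S_INR.
  (* The second difference is the increment of [x |-> g 0 (x + 1) - g 0 x], so two mean values turn
     it into a value of [g 2]. *)
  have hd c : x0 + INR n <= c <= x0 + INR n + 1 ->
      derivable_pt_lim (fun x => g 0%N (x + 1) - g 0%N x) c (g 1%N (c + 1) - g 1%N c).
    move=> hc; apply: derivable_pt_lim_minus; last by apply: dg; lra.
    have -> : g 1%N (c + 1) = g 1%N (c + 1) * (1 + 0) by ring.
    apply: (derivable_pt_lim_comp (fun x => x + 1) (g 0%N)); last by apply: dg; lra.
    by apply: derivable_pt_lim_plus; [apply: derivable_pt_lim_id|apply: derivable_pt_lim_const].
  have [c [hc [c0 c1]]] := MVT_cor2 _ _ (x0 + INR n) (x0 + INR n + 1) ltac:(lra) hd.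
  have [c' [hc' [c0' c1']]] := MVT_cor2 (g 1%N) (g 2%N) c (c + 1) ltac:(lra) (fun c hc => dg 1%N c ltac:(lra)).
  have -> : g 0%N (x0 + (INR n + 1 + 1)) - 2 * g 0%N (x0 + (INR n + 1)) + g 0%N (x0 + INR n) = g 2%N c'.
    rewrite hc' in hc.
    have -> : x0 + (INR n + 1 + 1) = x0 + INR n + 1 + 1 by ring.
    have -> : x0 + (INR n + 1) = x0 + INR n + 1 by ring.
    lra.
  apply: Rle_trans hkap; apply: Rmult_le_compat_r; first exact: pos_INR.
  by apply: g2; lra.
move=> h hh; have h1 : 1 <= INR h by apply: (le_INR 1); lia.
have hL : INR h + 1 <= INR L by rewrite -S_INR; apply: le_INR; lia.
have hH : INR h <= INR H by apply: le_INR; lia.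
have mvt i x : x0 <= x <= x0 + (Y - INR h) ->
    exists c, g i (x + INR h) - g i x = g i.+1 c * INR h /\ x0 <= c <= x0 + Y.
  move=> hx; have [c [hc [c0 c1]]] := MVT_cor2 (g i) (g i.+1) x (x + INR h) ltac:(lra)
    (fun c hc => dg i c ltac:(lra)).
  by exists c; split; [rewrite hc; ring|lra].
apply: (@eq_vdc_phase _ _ _ (fun n => g 0%N (x0 + INR n + INR h) - g 0%N (x0 + INR n))).
  by move=> n; rewrite plus_INR -/addn; congr (g 0%N _ - _); ring.
apply: (IH (fun i x => g i (x + INR h) - g i x) (Y - INR h) _ _ (mu * INR h) (kap * INR h)).
- move=> i x hx; apply: derivable_pt_lim_minus; last by apply: dg; lra.
  have -> : g i.+1 (x + INR h) = g i.+1 (x + INR h) * (1 + 0) by ring.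
  apply: (derivable_pt_lim_comp (fun x => x + INR h) (g i)); last by apply: dg; lra.
  by apply: derivable_pt_lim_plus; [apply: derivable_pt_lim_id|apply: derivable_pt_lim_const].
- by move=> x /(mvt j.+1)[c [-> hc]]; have := g1 c hc; nra.
- move=> x /(mvt j.+2)[c [-> hc]]; have := g2 c hc; rewrite Rabs_mult (Rabs_pos_eq (INR h)); nra.
- by nra.
- have hp : 0 <= INR H ^ j by apply: pow_le; apply: pos_INR.
  have hl := g1 x0 ltac:(lra).
  apply: Rle_trans hmu; rewrite /= -Rmult_assoc; apply: Rmult_le_compat_r => //.
  by apply: Rmult_le_compat_l; lra.
- by nra.
- by rewrite minus_INR; [lra|lia].
- by lia.
Qed.

Lemma block_sum_le (z : nat -> C) (H : nat) E a b : (0 < H)%N -> 0 <= E ->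
  (forall c d, (a <= c)%N -> (d <= b)%N -> (d - c <= H)%N -> Cmod (\csum_(c <= n < d) z n) <= E) ->
  Cmod (\csum_(a <= n < b) z n) <= (INR (b - a) / INR H + 1) * E.
Proof.
move=> H0 E0; have HH : 0 < INR H by apply: lt_0_INR; lia.
have q0 m : 0 <= INR m / INR H.
  by apply: Rmult_le_pos; [apply: pos_INR|apply: Rlt_le; apply: Rinv_0_lt_compat].
have [m hm] : exists m, (b - a <= m)%N by exists (b - a)%N.
elim: m a hm => [|m IH] a hm hE.
  rewrite big_geq; last by lia.
  rewrite Cmod_0; apply: Rmult_le_pos => //.
  by have := q0 (b - a)%N; lra.
case: (leqP (b - a) H) => hH.
  apply: Rle_trans (hE _ _ _ _ hH) _ => //.
  by have := q0 (b - a)%N; nra.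
rewrite (@big_cat_nat _ _ _ (a + H)) //=; try lia.
apply: Rle_trans (Cmod_triangle _ _) _.
have h1 : Cmod (\csum_(a <= n < a + H) z n) <= E by apply: hE; lia.
have h2 := IH (a + H)%N ltac:(lia) (fun c d hc => hE c d ltac:(lia)).
have e : INR (b - a) = INR (b - (a + H)) + INR H by rewrite -plus_INR; congr INR; lia.
have -> : INR (b - a) / INR H = INR (b - (a + H)) / INR H + 1 by rewrite e; field; lra.
lra.
Qed.

(** * Growth comparisons *)

Arguments INR : simpl never.

Lemma Rpower_gt0 x y : 0 < Rpower x y.
Proof. exact: exp_pos. Qed.

Lemma Rpower_anti x y a : 0 < x <= y -> a <= 0 -> Rpower y a <= Rpower x a.
Proof.
move=> [x0 xy] a0; have -> : a = - (- a) by ring.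
rewrite !(Rpower_Ropp _ (- a)); apply: Rinv_le_contravar; first exact: Rpower_gt0.
by apply: Rle_Rpower_l; lra.
Qed.

Lemma Rpower_ge1 x a : 1 <= x -> 0 <= a -> 1 <= Rpower x a.
Proof. by move=> x1 a0; rewrite -(Rpower_O x); [apply: Rle_Rpower|lra]. Qed.

Lemma pow_le_Rpower_inv x z m : (0 < m)%N -> 0 <= x -> 0 < z -> x ^ m <= z ->
  x <= Rpower z (/ INR m).
Proof.
move=> m0 x0 z0 h; case: (Req_dec x 0) => [->|xn0]; first by apply: Rlt_le; apply: Rpower_gt0.
have mp : 0 < INR m by apply: lt_0_INR; lia.
have {1}-> : x = Rpower (x ^ m) (/ INR m).
  by rewrite -Rpower_pow; [rewrite Rpower_mult Rinv_r ?Rpower_1; lra|lra].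
apply: Rle_Rpower_l; first by apply: Rlt_le; apply: Rinv_0_lt_compat.
by split => //; apply: pow_lt; lra.
Qed.

Lemma ln_le_sub1 x : 0 < x -> ln x <= x - 1.
Proof.
move=> x0; have := exp_ineq1_le (ln x); rewrite exp_ln //; lra.
Qed.

Lemma ln_ge0 x : 1 <= x -> 0 <= ln x.
Proof.
move=> x1; rewrite -ln_1; case: (Req_dec x 1) => [->|h]; first lra.
by apply: Rlt_le; apply: ln_increasing; lra.
Qed.

Lemma ln_mono x y : 0 < x -> x <= y -> ln x <= ln y.
Proof.
move=> x0 xy; case: (Req_dec x y) => [->|h]; first lra.
by apply: Rlt_le; apply: ln_increasing; lra.
Qed.

(** [1 / (n + 1) <= ln ((n + 1) / n)] is the inequality [ln x <= x - 1] at [x = n / (n + 1)]. *)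
Lemma harmonic_le H : (0 < H)%N -> \rsum_(1 <= h < H.+1) / INR h <= 1 + ln (INR H).
Proof.
elim: H => // -[|H] IH _.
  by rewrite big_nat1 INR_1 ln_1; lra.
rewrite big_nat_recr //=; have := IH isT.
set n := H.+1; have n0 : 0 < INR n by apply: lt_0_INR; lia.
suff : / INR n.+1 <= ln (INR n.+1) - ln (INR n) by move=> ? ?; lra.
rewrite S_INR.
have : ln (INR n / (INR n + 1)) <= INR n / (INR n + 1) - 1.
  by apply: ln_le_sub1; apply: Rmult_lt_0_compat => //; apply: Rinv_0_lt_compat; lra.
rewrite /Rdiv ln_mult ?ln_Rinv; try lra; last by apply: Rinv_0_lt_compat; lra.
have -> : INR n * / (INR n + 1) - 1 = - / (INR n + 1) by field; lra.
lra.
Qed.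

(** Asymptotic conditions are collected as nested conjunctions under this quantifier, so that
    thresholds need not be tracked. *)
Definition for_large (P : R -> Prop) : Prop := exists M0, forall M, M0 <= M -> P M.

Lemma for_large_and P Q : for_large P -> for_large Q -> for_large (fun M => P M /\ Q M).
Proof.
move=> [M1 h1] [M2 h2]; exists (Rmax M1 M2) => M hM.
by split; [apply: h1|apply: h2]; apply: Rle_trans hM; [apply: Rmax_l|apply: Rmax_r].
Qed.

Lemma for_large_mono (P Q : R -> Prop) : (forall M, P M -> Q M) -> for_large P -> for_large Q.
Proof. by move=> PQ [M0 h]; exists M0 => M /h /PQ. Qed.

Lemma for_large_ge c : for_large (fun M => c <= M).
Proof. by exists c. Qed.

Lemma for_large_all d (P : nat -> R -> Prop) :
  (forall j, (j < d)%N -> for_large (P j)) -> for_large (fun M => forall j, (j < d)%N -> P j M).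
Proof.
elim: d => [|d IH] h; first by exists 0.
have := for_large_and (h d (leqnn _)) (IH (fun j hj => h j (ltnW hj))).
apply: for_large_mono => M [h1 h2] j; rewrite ltnS leq_eqVlt => /orP[/eqP-> //|]; exact: h2.
Qed.

Lemma for_large_pow C a b : a < b -> for_large (fun M => C * Rpower M a <= Rpower M b).
Proof.
move=> ab; have [C' [C1 CC]] : exists C', 1 <= C' /\ C <= C'.
  by exists (Rmax C 1); split; [apply: Rmax_r|apply: Rmax_l].
exists (Rpower C' (/ (b - a))) => M hM.
have -> : Rpower M b = Rpower M (b - a) * Rpower M a by rewrite -Rpower_plus; congr Rpower; ring.
apply: Rmult_le_compat_r; first by apply: Rlt_le; apply: Rpower_gt0.
apply: Rle_trans CC _.
have -> : C' = Rpower (Rpower C' (/ (b - a))) (b - a).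
  by rewrite Rpower_mult Rinv_l ?Rpower_1; lra.
apply: Rle_Rpower_l; first lra.
by split=> //; apply: Rpower_gt0.
Qed.

Lemma for_large_const C b : 0 < b -> for_large (fun M => C <= Rpower M b).
Proof.
move=> b0; have := for_large_and (for_large_ge 1) (for_large_pow C b0).
by apply: for_large_mono => M [M1]; rewrite Rpower_O; lra.
Qed.

Lemma for_large_ln C k b : 0 < b -> for_large (fun M => C * (1 + ln M) ^ k <= Rpower M b).
Proof.
(* [ln M <= M^a / a] bounds [(1 + ln M)^k] by a constant times [M^(a k) <= M^(b/2)]; the other half
   of [b] absorbs the constants. *)
move=> b0; pose a := b / 2 / (INR k + 1).
have k0 := pos_INR k.
have a0 : 0 < a by apply: Rmult_lt_0_compat; [lra|apply: Rinv_0_lt_compat; lra].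
have h1 := for_large_pow (Rabs C * (1 + / a) ^ k) (_ : b / 2 < b).
have := for_large_and (for_large_ge 1) (h1 ltac:(lra)); apply: for_large_mono => M [M1 h].
apply: Rle_trans h.
have l0 := ln_ge0 M1.
have hl : 1 + ln M <= (1 + / a) * Rpower M a.
  have p1 : 1 <= Rpower M a by apply: Rpower_ge1; lra.
  have : ln (Rpower M a) <= Rpower M a - 1 by apply: ln_le_sub1; lra.
  rewrite /Rpower ln_exp -/(Rpower M a) => h.
  have : / a * (a * ln M) <= / a * Rpower M a.
    by apply: Rmult_le_compat_l; [apply: Rlt_le; apply: Rinv_0_lt_compat|lra].
  by rewrite -Rmult_assoc Rinv_l; lra.
have hk : (1 + ln M) ^ k <= (1 + / a) ^ k * Rpower M (b / 2).
  apply: Rle_trans (pow_incr _ _ k (conj _ hl)) _; first lra.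
  rewrite Rpow_mult_distr; apply: Rmult_le_compat_l.
    apply: pow_le; have := Rinv_0_lt_compat a a0; lra.
  rewrite -Rpower_pow ?Rpower_mult; last exact: Rpower_gt0.
  apply: Rle_Rpower => //; rewrite /a.
  have -> : b / 2 / (INR k + 1) * INR k = b / 2 * (INR k / (INR k + 1)) by field; lra.
  have : INR k / (INR k + 1) <= 1.
    apply: (Rmult_le_reg_r (INR k + 1)); first lra.
    by rewrite /Rdiv Rmult_assoc Rinv_l; lra.
  by move=> ?; nra.
have lk : 0 <= (1 + ln M) ^ k by apply: pow_le; lra.
apply: Rle_trans (_ : Rabs C * (1 + ln M) ^ k <= _).
  by apply: Rmult_le_compat_r => //; apply: Rle_abs.
by rewrite Rmult_assoc; apply: Rmult_le_compat_l => //; apply: Rabs_pos.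
Qed.

Lemma nat_floor x : 0 <= x -> exists n : nat, INR n <= x < INR n + 1.
Proof.
move=> x0; have [h1 h2] := archimed x.
have hz : (0 < up x)%Z by apply: lt_IZR; lra.
exists (Z.to_nat (up x - 1)); rewrite INR_IZR_INZ Z2Nat.id; last by lia.
by rewrite minus_IZR; lra.
Qed.

(** * Exponential sums with power phases *)

(* The interval is cut into blocks of length [H ~ Y]; the relation between [Y],
   [A] and [T] makes the first derivative after [k] differencings at most 1/2. *)
Lemma vdc_interval k c1 c2 c3 : 0 < c1 <= c2 -> 0 <= c3 -> exists C, 0 < C /\
  forall A T Y l (g : nat -> R -> R) a b,
  1 <= A -> 0 < T -> 2 <= Y <= A ->
  Rpower Y (INR k + / 2) * (2 * c2 * T) = A ^ k.+1 -> 1 + ln A <= l ->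
  (forall i x, A <= x <= 2 * A -> derivable_pt_lim (g i) x (g i.+1 x)) ->
  (forall x, A <= x <= 2 * A -> c1 * T / A ^ k.+1 <= g k.+1 x <= c2 * T / A ^ k.+1) ->
  (forall x, A <= x <= 2 * A -> Rabs (g k.+2 x) <= c3 * T / A ^ k.+2) ->
  (forall n, (a <= n < b)%N -> A <= INR n <= 2 * A) ->
  Cmod (\csum_(a <= n < b) expi (g 0%N (INR n))) <=
    3 * A * Rpower (C * l ^ k / Rpower Y (/ 2)) (/ INR (2 ^ k)).
Proof.
move=> [c10 c12] c30.
have K0 : 0 <= c3 / c1 by apply: Rmult_le_pos => //; apply: Rlt_le; apply: Rinv_0_lt_compat.
have [C0 [C0p hC]] := vdc_bound k K0.
(* The constant in [lam * H ^ k.+1 >= c4 * Y^(1/2)]: [c1 / c2] is the ratio of [lam] to [mu], one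
   factor 1/2 is the value of [mu * Y^(k + 1/2)], and the power of 2 comes from [H >= Y / 2]. *)
pose c4 := c1 / (2 * c2 * 2 ^ k.+1).
have p2 : 0 < 2 ^ k.+1 by apply: pow_lt; lra.
have c4p : 0 < c4.
  by apply: Rmult_lt_0_compat => //; apply: Rinv_0_lt_compat; apply: Rmult_lt_0_compat; lra.
exists (C0 * (2 + / c4)); split.
  by have := Rinv_0_lt_compat _ c4p => ?; apply: Rmult_lt_0_compat; lra.
move=> A T Y l g a b A1 T0 [Y2 YA] hY hl dg g1 g2 hab.
have [H [HY YH]] := @nat_floor Y ltac:(lra).
have HA : INR H <= A by lra.
have H1 : 1 <= INR H by lra.
have H0 : (0 < H)%N by case: (H) H1 => //; rewrite INR_0; lra.
have Ak : 0 < A ^ k.+1 by apply: pow_lt; lra.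
have Akk : A ^ k.+2 = A * A ^ k.+1 by [].
have Yk : 0 < Rpower Y (/ 2) by apply: Rpower_gt0.
have l1 : 1 <= l by have := ln_ge0 A1; lra.
have lk : 1 <= l ^ k by apply: pow_R1_Rle.
pose lam := c1 * T / A ^ k.+1; pose mu := c2 * T / A ^ k.+1.
have iA : 0 < / A ^ k.+1 by apply: Rinv_0_lt_compat.
have lam0 : 0 < lam by apply: Rmult_lt_0_compat => //; apply: Rmult_lt_0_compat.
have lammu : lam <= mu.
  by apply: Rmult_le_compat_r; [lra|apply: Rmult_le_compat_r; lra].
have Yh : Rpower Y (INR k + / 2) = Y ^ k * Rpower Y (/ 2).
  by rewrite Rpower_plus Rpower_pow //; lra.
have Yh1 : 1 <= Rpower Y (/ 2) by apply: Rpower_ge1; lra.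
have Yhh : Rpower Y (/ 2) * Rpower Y (/ 2) = Y.
  by rewrite -Rpower_plus (_ : / 2 + / 2 = 1) ?Rpower_1; lra.
have Ykp : 0 < Y ^ k by apply: pow_lt; lra.
(* The exponent [k + 1/2] lies halfway between [k], for which first differences must stay below 1/2,
   and [k + 1], for which [lam * H ^ k.+1] is the denominator in the bound. That denominator is thus
   of order [Y^(1/2)], and this is the saving. *)
have muY : mu * (Y ^ k * Rpower Y (/ 2)) = / 2.
  rewrite /mu -Yh -hY; field; split; first lra; split; first lra.
  by have := Rpower_gt0 Y (INR k + / 2); lra.
have HYk : INR H ^ k <= Y ^ k by apply: pow_incr; lra.
have Hkp : 0 < INR H ^ k by apply: pow_lt; lra.
have muH : mu * INR H ^ k <= / 2.
  rewrite -muY; apply: Rmult_le_compat_l; first lra.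
  by apply: Rle_trans HYk _; nra.
have lamH : lam * INR H ^ k <= / 2 by nra.
set Z := C0 * (2 + / c4) * l ^ k / Rpower Y (/ 2).
have ic4 : 0 < / c4 by apply: Rinv_0_lt_compat.
have Z0 : 0 < Z.
  apply: Rmult_lt_0_compat; last exact: Rinv_0_lt_compat.
  by apply: Rmult_lt_0_compat; [apply: Rmult_lt_0_compat; lra|lra].
have mp : (0 < 2 ^ k)%N by rewrite expn_gt0.
have lamHk : c4 * Rpower Y (/ 2) <= lam * INR H ^ k.+1.
  have hYH : (Y / 2) ^ k.+1 <= INR H ^ k.+1 by apply: pow_incr; lra.
  apply: Rle_trans (Rmult_le_compat_l _ _ _ (Rlt_le _ _ lam0) hYH).
  apply: Req_le; rewrite /Rdiv Rpow_mult_distr pow_inv.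
  have -> : lam = c1 / c2 * mu by rewrite /lam /mu; field; split; lra.
  have -> : Y ^ k.+1 = Y ^ k * Rpower Y (/ 2) * Rpower Y (/ 2) by rewrite /= -{1}Yhh; ring.
  transitivity (c1 / c2 * (mu * (Y ^ k * Rpower Y (/ 2))) * Rpower Y (/ 2) * / 2 ^ k.+1); last by ring.
  by rewrite muY /c4; field; split; lra.
have hblock c d : (a <= c)%N -> (d <= b)%N -> (d - c <= H)%N ->
    Cmod (\csum_(c <= n < d) expi (g 0%N (INR n))) <= INR H * Rpower Z (/ INR (2 ^ k)).
  move=> hc hd hcd; case: (leqP d c) => dc.
    rewrite big_geq // Cmod_0; apply: Rmult_le_pos; first lra.
    by apply: Rlt_le; apply: Rpower_gt0.
  have -> : \csum_(c <= n < d) expi (g 0%N (INR n)) = \csum_(0 <= n < d - c) expi (g 0%N (INR c + INR n)%R).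
    rewrite -{1}[c]add0n big_addn; apply: eq_bigr => n _.
    by rewrite plus_INR Rplus_comm.
  have hcA := hab c ltac:(lia).
  have hdA := hab d.-1 ltac:(lia).
  have ed : INR d.-1 = INR c + (INR (d - c) - 1).
    by rewrite -[1]INR_1 -minus_INR; [rewrite -plus_INR; congr INR; lia|lia].
  have hph : vdc_phase (c3 / c1) H k (fun n => g 0%N (INR c + INR n)) lam (d - c).
    apply: (@vdc_phase_deriv _ _ _ g (INR c) (INR (d - c) - 1) _ _ mu (c3 * T / A ^ k.+2)) => //.
    - by move=> i x hx; apply: dg; lra.
    - by move=> x hx; apply: g1; lra.
    - by move=> x hx; apply: g2; lra.
    - rewrite /lam Akk.
      have -> : c3 / c1 * (c1 * T / A ^ k.+1) = c3 * T / (A * A ^ k.+1) * A by field; repeat split; lra.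
      apply: Rmult_le_compat_l => //; apply: Rmult_le_pos; first by apply: Rmult_le_pos; lra.
      by apply: Rlt_le; apply: Rinv_0_lt_compat; apply: Rmult_lt_0_compat; lra.
    - by lra.
  have hlH : \rsum_(1 <= h < H) / INR h <= l.
    apply: Rle_trans (Rle_trans _ _ _ (harmonic_le H0) _); last first.
      by apply: Rle_trans hl; apply: Rplus_le_compat_l; apply: ln_mono; lra.
    by rewrite [X in _ <= X]big_nat_recr //=; have := Rinv_0_lt_compat (INR H); lra.
  have hS := hC _ _ _ _ _ lam0 lamH hcd H0 hlH hph.
  set S := Cmod _ in hS *.
  have S0 : 0 <= S by apply: Cmod_ge_0.
  have HmP : 0 < INR H ^ (2 ^ k) by apply: pow_lt; lra.
  suff hSH : S / INR H <= Rpower Z (/ INR (2 ^ k)).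
    have -> : S = INR H * (S / INR H) by field; lra.
    by apply: Rmult_le_compat_l; lra.
  have iH : 0 < / INR H by apply: Rinv_0_lt_compat; lra.
  apply: pow_le_Rpower_inv => //; first by apply: Rmult_le_pos; lra.
  rewrite /Rdiv Rpow_mult_distr pow_inv.
  apply: (Rmult_le_reg_r (INR H ^ (2 ^ k))) => //.
  rewrite Rmult_assoc Rinv_l ?Rmult_1_r; last lra.
  apply: Rle_trans hS _.
  have -> : Z * INR H ^ (2 ^ k) = C0 * INR H ^ (2 ^ k) * (2 * l ^ k / Rpower Y (/ 2) + l ^ k / (c4 * Rpower Y (/ 2))).
    by rewrite /Z; field; split; lra.
  apply: Rmult_le_compat_l; first by nra.
  apply: Rplus_le_compat.
    apply: Rle_trans (_ : 2 * / Rpower Y (/ 2) <= _).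
      have -> : 2 * / Rpower Y (/ 2) = / (Rpower Y (/ 2) / 2) by field; lra.
      by apply: Rinv_le_contravar; nra.
    by apply: Rmult_le_compat_r; [apply: Rlt_le; apply: Rinv_0_lt_compat|lra].
  apply: Rmult_le_compat_l; first lra.
  by apply: Rinv_le_contravar => //; apply: Rmult_lt_0_compat.
have Zp := Rpower_gt0 Z (/ INR (2 ^ k)).
case: (leqP b a) => hba.
  rewrite big_geq // Cmod_0; nra.
apply: Rle_trans (block_sum_le H0 _ hblock) _; first by nra.
have hE : INR (b - a) <= 2 * A.
  have h1 := hab a ltac:(lia); have h2 := hab b.-1 ltac:(lia).
  have -> : INR (b - a) = INR b.-1 - INR a + 1.
    by rewrite -minus_INR -?S_INR; [congr INR; lia|lia].
  lra.
have -> : (INR (b - a) / INR H + 1) * (INR H * Rpower Z (/ INR (2 ^ k))) =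
   (INR (b - a) + INR H) * Rpower Z (/ INR (2 ^ k)) by field; lra.
by apply: Rmult_le_compat_r; lra.
Qed.

(** * Moebius and von Mangoldt functions *)

Section DivisorSums.
Variables (T : Type) (idx : T) (op : Monoid.com_law idx).

Lemma big_nat_eq1 (F : nat -> T) a b m : (a <= m < b)%N ->
  \big[op/idx]_(a <= i < b | i == m) F i = F m.
Proof.
move=> hm; rewrite -big_filter (_ : filter _ _ = [:: m]) ?big_seq1 //.
rewrite (@filter_pred1_uniq _ (index_iota a b)) ?iota_uniq //.
by rewrite mem_index_iota.
Qed.

Lemma big_multiples (G : nat -> T) b N : (0 < b)%N ->
  (forall m, (N <= m)%N -> G m = idx) ->
  \big[op/idx]_(1 <= m < N | (b %| m)%N) G m = \big[op/idx]_(1 <= d < N) G (b * d)%N.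
Proof.
move=> b0 hG.
rewrite [RHS](eq_big_nat _ _ (F2 := fun d => \big[op/idx]_(1 <= m < N | m == (b * d)%N) G m)); last first.
  move=> d hd; case: (ltnP (b * d) N) => h.
    by rewrite big_nat_eq1 //; nia.
  rewrite hG // big_nat_cond big1 // => m /andP[hm /eqP e]; lia.
under [RHS]eq_bigr do rewrite big_mkcond.
rewrite [RHS]exchange_big /= big_mkcond; apply: eq_big_nat => m hm.
case: ifP => hb; last first.
  by rewrite big1 // => d _; case: eqP => // e; move: hb; rewrite e dvdn_mulr.
rewrite -big_mkcond (eq_bigl (fun d => d == (m %/ b)%N)); last first.
  by move=> d; rewrite -[in LHS](divnK hb) mulnC eqn_pmul2l // eq_sym.
by rewrite (big_nat_eq1 (fun=> G m)) //; have := leq_div m b; have := divnK hb; nia.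
Qed.

(** Substitution [m = b * d]. As [f] vanishes from [N] on, [b] and [d] may range independently below
    [N]. *)
Lemma big_divisors (f : nat -> nat -> T) N :
  (forall b m, (N <= m)%N -> f b m = idx) ->
  \big[op/idx]_(1 <= b < N) \big[op/idx]_(1 <= d < N) f b (b * d)%N =
  \big[op/idx]_(1 <= m < N) \big[op/idx]_(1 <= b < N | (b %| m)%N) f b m.
Proof.
move=> hf; under [RHS]eq_bigr do rewrite big_mkcond.
rewrite [RHS]exchange_big /=; apply: eq_big_nat => b hb.
by rewrite -big_mkcond /= big_multiples //; [lia|move=> m; apply: hf].
Qed.

End DivisorSums.

Definition squarefree n := all (fun p => logn p n == 1%N) (primes n).
Definition moebius (n : nat) : R :=
  if squarefree n then (-1) ^ size (primes n) else 0.
(** [primes n] lists the distinct prime divisors, so a single entry characterises the prime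
    powers. *)
Definition mangoldt (n : nat) : R := if primes n is [:: p] then ln (INR p) else 0.

Lemma moebius_le1 n : Rabs (moebius n) <= 1.
Proof.
rewrite /moebius; case: ifP => _; last by rewrite Rabs_R0; lra.
by rewrite pow_1_abs; lra.
Qed.

Lemma moebius_mul_prime p e : prime p -> (0 < e)%N ->
  moebius (p * e) = if (p %| e)%N then 0 else - moebius e.
Proof.
move=> pp e0; have p0 := prime_gt0 pp; have p1 := prime_gt1 pp.
have mem_p : p \in primes (p * e) by rewrite mem_primes pp muln_gt0 p0 e0 dvdn_mulr.
case: ifP => hpe.
  rewrite /moebius; suff -> : squarefree (p * e) = false by [].
  apply/allP => /(_ p mem_p); rewrite lognM // logn_prime // eqxx.
  have : (0 < logn p e)%N by rewrite logn_gt0 mem_primes pp e0.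
  by case: logn.
have hperm : perm_eq (primes (p * e)) (p :: primes e).
  apply: uniq_perm; rewrite ?primes_uniq //= ?primes_uniq ?mem_primes ?hpe ?andbF //.
  by move=> q; rewrite primesM // primes_prime // !inE.
have sz : size (primes (p * e)) = (size (primes e)).+1 by rewrite (perm_size hperm).
rewrite /moebius sz /squarefree (perm_all _ hperm) /=.
have lp : logn p e = 0%N by rewrite logn_coprime // prime_coprime // hpe.
rewrite lognM // lp logn_prime // eqxx addn0 eqxx /=.
have -> : all (fun p0 => logn p0 (p * e) == 1)%N (primes e) = all (fun p0 => logn p0 e == 1)%N (primes e).
  apply: eq_in_all => q hq; rewrite lognM //.
  have qp : prime q by move: hq; rewrite mem_primes => /andP[].
  rewrite logn_prime //; case: (eqVneq q p) => [e1|//].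
  by move: hq; rewrite e1 mem_primes hpe !andbF.
by case: all; ring.
Qed.

(** With [p] the least prime factor of [n], each divisor [e] prime to [p] cancels against [p * e],
    and [p * e] contributes 0 when [p] divides [e]. *)
Lemma sum_moebius n N : (0 < n < N)%N ->
  \rsum_(1 <= b < N | (b %| n)%N) moebius b = if n == 1%N then 1 else 0.
Proof.
move=> /andP[n0 nN]; case: eqP => [->|/eqP n1].
  rewrite (eq_bigl (fun b => b == 1%N)) => [|b]; last by rewrite dvdn1.
  by rewrite big_nat_eq1; [rewrite /moebius /=|lia].
have n2 : (1 < n)%N by lia.
set p := pdiv n; have pp : prime p by apply: pdiv_prime.
have p0 := prime_gt0 pp.
have pn : (p %| n)%N by apply: pdiv_dvd.
rewrite (bigID (fun b => p %| b)%N) /=.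
have -> : \rsum_(1 <= b < N | (b %| n)%N && (p %| b)%N) moebius b =
    \rsum_(1 <= e < N | (e %| n)%N && ~~ (p %| e)%N) (- moebius e).
  rewrite [LHS](eq_bigl (fun b => (p %| b) && (b %| n))%N) => [|b]; last by rewrite andbC.
  rewrite big_mkcondr.
  have := @big_multiples _ _ Rplus (fun m => if (m %| n)%N then moebius m else 0) p N p0.
  move=> /= -> => [|m hm]; last by case: ifP => // /dvdn_leq; lia.
  rewrite [RHS]big_mkcond; apply: eq_big_nat => e he.
  rewrite moebius_mul_prime //; last lia.
  case: (boolP (p %| e)%N) => hpe; first by rewrite andbF; case: ifP.
  rewrite andbT -[in LHS](divnK pn) mulnC dvdn_pmul2r //.
  rewrite -{2}(divnK pn) Gauss_dvdl //.
  by rewrite coprime_sym prime_coprime.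
rewrite -big_split /= big1 // => i _; ring.
Qed.

Lemma mangoldt_ge0 n : 0 <= mangoldt n.
Proof.
rewrite /mangoldt; case e : (primes n) => [|p [|q s]]; try lra.
apply: ln_ge0; apply: (le_INR 1); apply/leP.
have : p \in primes n by rewrite e inE.
by rewrite mem_primes => /andP[/prime_gt0].
Qed.

Lemma mangoldt_le_ln n : (0 < n)%N -> mangoldt n <= ln (INR n).
Proof.
move=> n0; have h1 : 1 <= INR n by apply: (le_INR 1); lia.
rewrite /mangoldt; case e : (primes n) => [|p [|q s]]; try by apply: ln_ge0.
have : p \in primes n by rewrite e inE.
rewrite mem_primes => /and3P[/prime_gt0 p0 _ /dvdn_leq hp].
by apply: ln_mono; [apply: lt_0_INR; lia|apply: le_INR; have := hp n0; lia].
Qed.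

Lemma primes1_eq n p : primes n = [:: p] -> n = (p ^ logn p n)%N /\ prime p.
Proof.
move=> e; have : p \in primes n by rewrite e inE.
rewrite mem_primes => /and3P[pp n0 pn]; split=> //.
rewrite -p_part part_pnat_id // /pnat n0 e /= andbT; exact/eqP.
Qed.

(** Induction through [n = p * m] with [p] the least prime factor: the only prime power dividing [n]
    but not [m] is [p ^ (logn p m).+1], of weight [ln p]. *)
Lemma sum_mangoldt n N : (0 < n < N)%N ->
  \rsum_(1 <= c < N | (c %| n)%N) mangoldt c = ln (INR n).
Proof.
elim/ltn_ind: n => n IH /andP[n0 nN].
case: (ltnP 1 n) => n1; last first.
  have -> : n = 1%N by lia.
  rewrite (eq_bigl (fun b => b == 1%N)) => [|b]; last by rewrite dvdn1.
  by rewrite big_nat_eq1; [rewrite /mangoldt /= INR_1 ln_1|lia].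
set p := pdiv n; have pp : prime p by apply: pdiv_prime.
have p0 := prime_gt0 pp; have p1 := prime_gt1 pp.
have pn : (p %| n)%N by apply: pdiv_dvd.
set m := (n %/ p)%N; have en : n = (p * m)%N by rewrite mulnC divnK.
have m0 : (0 < m)%N by move: n0; rewrite en muln_gt0 => /andP[].
have mn : (m < n)%N by rewrite en; nia.
rewrite (bigID (fun c => c %| m)%N) /=.
rewrite (eq_bigl (fun c => c %| m)%N) => [|c]; last first.
  by apply/andP/idP => [[]|h] //; split=> //; rewrite en dvdn_mull.
rewrite IH //; last lia.
have e2 : INR n = INR p * INR m by rewrite en mult_INR.
rewrite e2 ln_mult; [|apply: lt_0_INR; lia|apply: lt_0_INR; lia].
rewrite Rplus_comm; congr (_ + _).
set v := logn p m; set P := (p ^ v.+1)%N.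
have Pn : (P %| n)%N by rewrite pfactor_dvdn // en lognM // logn_prime // eqxx.
have Pm : ~~ (P %| m)%N by rewrite pfactor_dvdn // ltnn.
have hP : mangoldt P = ln (INR p) by rewrite /mangoldt primesX // primes_prime.
rewrite -hP -(@big_nat_eq1 _ _ Rplus mangoldt 1 N P); last first.
  by have := dvdn_leq n0 Pn; have := expn_gt0 p v.+1; rewrite p0 /= -/P; lia.
rewrite big_mkcond [RHS]big_mkcond; apply: eq_big_nat => c hc.
case: (eqVneq c P) => [->|cP]; first by rewrite Pn Pm.
case: ifP => // /andP[cn cm].
rewrite /mangoldt; case e : (primes c) => [|q [|r s]] //.
have [ec qp] := primes1_eq e; exfalso.
have hq : (logn q c <= logn q n)%N by rewrite -pfactor_dvdn // -ec.
have hq' : ~~ (logn q c <= logn q m)%N by rewrite -pfactor_dvdn // -ec.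
move: hq; rewrite en lognM // (logn_prime q pp); case: (eqVneq q p) => [e3|_].
  rewrite /= add1n => hq; rewrite e3 in hq hq' ec.
  have hqv : logn p c = v.+1 by apply/eqP; rewrite eqn_leq hq ltnNge.
  by move/eqP: cP; apply; rewrite ec hqv.
by rewrite /= add0n => h; rewrite h in hq'.
Qed.

(** A non-prime of positive weight is some [p ^ i] with [i >= 2], so [p ^ 2 < s ^ 2] and
    [2 ^ i < 2 ^ L]. This leaves at most [s * L] pairs [(p, i)], each of weight at most [ln N]. *)
Lemma sum_mangoldt_nonprime N s L : (N <= s ^ 2)%N -> (N <= 2 ^ L)%N -> (0 < N)%N ->
  \rsum_(1 <= n < N | ~~ prime n) mangoldt n <= INR s * INR L * ln (INR N).
Proof.
move=> hs hL N0; have l0 : 0 <= ln (INR N) by apply: ln_ge0; apply: (le_INR 1); lia.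
apply: Rle_trans (_ : \rsum_(1 <= n < N) \rsum_(0 <= p < s) \rsum_(0 <= i < L)
   (if n == (p ^ i)%N then ln (INR N) else 0) <= _).
  rewrite big_mkcond; apply: rsum_le => n hn _.
  have t0 p i : 0 <= if n == (p ^ i)%N then ln (INR N) else 0 by case: ifP => _; lra.
  have r0 p : 0 <= \rsum_(0 <= i < L) (if n == (p ^ i)%N then ln (INR N) else 0).
    by apply: rsum_ge0.
  have rr0 : 0 <= \rsum_(0 <= p < s) \rsum_(0 <= i < L) (if n == (p ^ i)%N then ln (INR N) else 0).
    by apply: rsum_ge0.
  case: ifP => // np; have ml := @mangoldt_le_ln n ltac:(lia).
  have mN : ln (INR n) <= ln (INR N) by apply: ln_mono; [apply: lt_0_INR|apply: le_INR]; lia.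
  rewrite {1}/mangoldt; case e : (primes n) => [|p [|q r]] //.
  have [en pp] := primes1_eq e; have p1 := prime_gt1 pp.
  set i := logn p n in en.
  have i2 : (1 < i)%N.
    case: (i) en => [|[|//]] en; first by move: e; rewrite en.
    by move: np; rewrite en expn1 pp.
  have ps : (p < s)%N.
    rewrite -(ltn_exp2r _ _ (_ : 0 < 2)%N) //; apply: leq_trans hs.
    apply: leq_ltn_trans (_ : n < N)%N; last lia.
    by rewrite {1}en leq_exp2l.
  have iL : (i < L)%N.
    rewrite -(ltn_exp2l _ _ (_ : 1 < 2)%N) //; apply: leq_trans hL.
    apply: leq_ltn_trans (_ : n < N)%N; last lia.
    by rewrite {1}en leq_exp2r //; lia.
  have hpl : ln (INR p) <= ln (INR N).
    by move: ml; rewrite /mangoldt e; lra.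
  apply: Rle_trans hpl _.
  rewrite (bigD1_seq p) ?mem_index_iota ?iota_uniq //=.
  rewrite (bigD1_seq i) ?mem_index_iota ?iota_uniq //= -en eqxx.
  have a1 : 0 <= \rsum_(0 <= i0 < L | i0 != i) (if n == (p ^ i0)%N then ln (INR N) else 0) by apply: rsum_ge0.
  have a2 : 0 <= \rsum_(0 <= p0 < s | p0 != p) \rsum_(0 <= i0 < L) (if n == (p0 ^ i0)%N then ln (INR N) else 0) by apply: rsum_ge0.
  lra.
rewrite exchange_big /=.
apply: Rle_trans (_ : \rsum_(0 <= p < s) \rsum_(0 <= i < L) ln (INR N) <= _); last first.
  by apply: Req_le; rewrite !rsum_const !subn0; ring.
apply: rsum_le => p _ _; rewrite exchange_big /=; apply: rsum_le => i _ _.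
rewrite -big_mkcond.
case: (boolP (1 <= p ^ i < N)%N) => h; first by rewrite (@big_nat_eq1 _ _ Rplus (fun=> ln (INR N))) //; lra.
rewrite big_nat_cond big1 // => n /andP[h1 /eqP h2]; lia.
Qed.

(** * Vaughan's identity *)

(** Partial summation, applied later to the weight [ln]. The weighted sum is [w a] times the full
    sum plus increments of [w] times tails; these coefficients are non-negative and add up to the
    last weight. *)
Lemma abel_bound a b (w : nat -> R) (z : nat -> C) E W : 0 <= E -> 0 <= W ->
  (forall c, (a <= c)%N -> Cmod (\csum_(c <= n < b) z n) <= E) ->
  (forall n, (a <= n)%N -> (n.+1 < b)%N -> w n <= w n.+1) ->
  (forall n, (a <= n < b)%N -> 0 <= w n <= W) ->
  Cmod (\csum_(a <= n < b) (w n * z n)) <= W * E.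
Proof.
move=> E0 W0 hz hw hW.
case: (leqP b a) => ba; first by rewrite big_geq // Cmod_0; nra.
(* Shifting all weights by [x] makes the claim inductive: once [w a - x] is split off, the weights
   are [w n - w a] and the first one vanishes. *)
suff key m x : (b - a <= m)%N -> x <= w a ->
    Cmod (\csum_(a <= n < b) (RtoC (w n - x) * z n)) <= (w b.-1 - x) * E.
  have := key _ 0 (leqnn _) (proj1 (hW a ltac:(lia))).
  have h := hW b.-1 ltac:(lia).
  rewrite (eq_bigr (fun n => (w n * z n)%C)) => [|n _]; last by rewrite Rminus_0_r.
  by move/Rle_trans; apply; nra.
elim: m a ba x hz hw hW => [|m IH] a ba x hz hw hW hm xa; first by lia.
rewrite (eq_bigr (fun n => (RtoC (w a - x) * z n + RtoC (w n - w a) * z n)%C)) => [|n _]; last first.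
  by rewrite !RtoC_minus; ring.
rewrite big_split /= -csum_mull.
apply: Rle_trans (Cmod_triangle _ _) _.
have h1 : Cmod (RtoC (w a - x) * \csum_(a <= n < b) z n) <= (w a - x) * E.
  rewrite Cmod_mult Cmod_R Rabs_pos_eq; last lra.
  by apply: Rmult_le_compat_l; [lra|apply: hz].
set X := Cmod (RtoC (w a - x) * _) in h1 *.
rewrite big_ltn // Rminus_diag Cmult_0_l Cplus_0_l.
case: (ltnP a.+1 b) => hab; last first.
  rewrite (_ : b.-1 = a); last by lia.
  by rewrite big_geq // Cmod_0; lra.
have := IH a.+1 hab (w a) (fun c hc => hz c ltac:(lia)) (fun n hn => hw n ltac:(lia))
  (fun n hn => hW n ltac:(lia)) ltac:(lia) (hw a (leqnn _) hab).
lra.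
Qed.

Lemma csum_dyadic (z : nat -> C) L :
  \csum_(1 <= c < 2 ^ L) z c = \csum_(0 <= i < L) \csum_(2 ^ i <= c < 2 ^ i.+1) z c.
Proof.
elim: L => [|L IH]; first by rewrite !big_geq.
rewrite [RHS]big_nat_recr //= -IH (@big_cat_nat _ _ _ (2 ^ L)%N) //=; first by rewrite expn_gt0.
by rewrite leq_exp2l.
Qed.

Section Vaughan.
Variables (M U V L : nat) (F : nat -> C) (E : R).
Hypotheses (VM : (V < M)%N) (U1 : (1 <= U)%N) (V1 : (1 <= V)%N) (UM : (U < M)%N).
Hypothesis hL : (2 * M <= 2 ^ L)%N.
Hypothesis E0 : 0 <= E.
Hypothesis F1 : forall n, Cmod (F n) <= 1.
Hypothesis type1 : forall D a b, (0 < D <= U * V)%N ->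
  (forall n, (a <= n < b)%N -> (M <= D * n < 2 * M)%N) ->
  Cmod (\csum_(a <= n < b) F (D * n)%N) <= INR M / INR D * E.
Hypothesis type2 : forall d c1 c2 a b, (0 < d)%N -> (0 < c2 < c1)%N ->
  (c1 * d * U < 2 * M)%N ->
  (forall n, (a <= n < b)%N -> (M <= c1 * d * n < 2 * M)%N) ->
  Cmod (\csum_(a <= n < b) (F (c1 * d * n)%N * Cconj (F (c2 * d * n)%N))) <=
  INR M / INR (c1 * d) * E.

Let N := (2 * M)%N.
Let ell := ln (INR N).
Let Phi n : C := if (M <= n < N)%N then F n else RtoC 0.

Let M0 : 0 < INR M. Proof. by apply: lt_0_INR; lia. Qed.
Let N1 : 1 <= INR N. Proof. by apply: (le_INR 1); lia. Qed.
Let ell0 : 0 <= ell. Proof. exact: ln_ge0. Qed.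

Let PhiN n : (N <= n)%N -> Phi n = RtoC 0.
Proof. by move=> h; rewrite /Phi ifF //; lia. Qed.

Let PhiM n : (n < M)%N -> Phi n = RtoC 0.
Proof. by move=> h; rewrite /Phi ifF //; lia. Qed.

Let harm : \rsum_(1 <= d < N) / INR d <= 1 + ell.
Proof.
have := @harmonic_le N ltac:(lia); rewrite big_nat_recr /=; last by lia.
by have := Rinv_0_lt_compat (INR N); rewrite /ell; lra.
Qed.

Let mangoldt_le c : (0 < c < N)%N -> mangoldt c <= ell.
Proof.
move=> hc; apply: Rle_trans (mangoldt_le_ln _) _; first by lia.
by apply: ln_mono; [apply: lt_0_INR|apply: le_INR]; lia.
Qed.

(** Summed over [b c d = n] this is [mangoldt n * Phi n], by Moebius inversion. The part [c <= V]
    adds up to 0 because [V < M]; the part [c > V] is split at [b = U]. *)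
Let G b c d : C := (RtoC (moebius b * mangoldt c) * Phi (b * c * d)%N)%C.

Let split_sum c : (1 <= c < N)%N -> (RtoC (mangoldt c) * Phi c)%C =
  \csum_(1 <= b < N) \csum_(1 <= d < N) G b c d.
Proof.
move=> hc.
have := @big_divisors _ _ Cplus (fun b m => (RtoC (moebius b * mangoldt c) * Phi (c * m)%N)%C) N.
move=> /= h; transitivity (\csum_(1 <= b < N) \csum_(1 <= d < N)
    (RtoC (moebius b * mangoldt c) * Phi (c * (b * d))%N)); last first.
  by apply: eq_bigr => b _; apply: eq_bigr => d _; rewrite /G mulnA (mulnC c).
rewrite h => [|b m hm]; last by rewrite PhiN ?Cmult_0_r //; nia.
rewrite (@eq_big_nat _ _ _ _ _ _ (fun m => if m == 1%N then (RtoC (mangoldt c) * Phi (c * m)%N)%C else RtoC 0)).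
  rewrite -big_mkcond (@big_nat_eq1 _ _ Cplus (fun m => RtoC (mangoldt c) * Phi (c * m)%N)%C); last by lia.
  by rewrite muln1.
move=> m hm; transitivity (RtoC (\rsum_(1 <= b < N | (b %| m)%N) moebius b) * RtoC (mangoldt c) * Phi (c * m)%N)%C.
  rewrite RtoC_rsum !csum_mulr; apply: eq_bigr => b _.
  by rewrite RtoC_mult.
rewrite sum_moebius //; case: ifP => _; ring.
Qed.

Let inner_log b : (0 < b < N)%N ->
  \csum_(1 <= c < N) \csum_(1 <= d < N) G b c d =
  (RtoC (moebius b) * \csum_(1 <= m < N) (RtoC (ln (INR m)) * Phi (b * m)%N))%C.
Proof.
move=> hb.
have := @big_divisors _ _ Cplus (fun c m => (RtoC (moebius b * mangoldt c) * Phi (b * m)%N)%C) N.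
move=> /= h; rewrite csum_mull.
transitivity (\csum_(1 <= c < N) \csum_(1 <= d < N)
    (RtoC (moebius b * mangoldt c) * Phi (b * (c * d))%N)).
  by apply: eq_bigr => c _; apply: eq_bigr => d _; rewrite /G mulnA.
rewrite h => [|c m hm]; last by rewrite PhiN ?Cmult_0_r //; nia.
apply: eq_big_nat => m hm; rewrite -(sum_mangoldt hm) RtoC_rsum csum_mulr csum_mull.
by apply: eq_bigr => c _; rewrite RtoC_mult; ring.
Qed.

Let Phi_interval (w : nat -> C) D : (0 < D)%N -> exists a b,
  (forall n, (a <= n < b)%N -> (M <= D * n < 2 * M)%N) /\
  \csum_(1 <= n < N) (w n * Phi (D * n)%N) = \csum_(a <= n < b) (w n * F (D * n)%N).
Proof.
move=> D0.
have [a [b [hab e]]] := @csum_convex (fun n => M <= D * n < 2 * M)%N N (fun n => w n * F (D * n)%N)%C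
  ltac:(move=> i j k hijk hi hk; nia).
exists a, b; split=> [n /hab[]//|]; rewrite -e [RHS]big_mkcond /= [RHS]big_ltn; last by lia.
rewrite ifF ?Cplus_0_l; last by lia.
by apply: eq_bigr => n _; rewrite /Phi /N; case: ifP => _ //; rewrite Cmult_0_r.
Qed.

(** The full sum over [c] turns [mangoldt] into [ln], a monotone weight removed by partial
    summation. What remains are type I sums with [D = b <= U]. *)
Let S1 : Cmod (\csum_(1 <= b < N | (b <= U)%N) \csum_(1 <= c < N) \csum_(1 <= d < N) G b c d) <=
  INR M * E * (1 + ell) ^ 2.
Proof.
apply: Rle_trans (Cmod_csum _ _ _ _) _.
apply: Rle_trans (_ : \rsum_(1 <= b < N | (b <= U)%N) (ell * (INR M * E) * / INR b) <= _).
  apply: rsum_le => b hb bU; rewrite inner_log // Cmod_mult Cmod_R.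
  have b0 : 0 < INR b by apply: lt_0_INR; lia.
  set X := Cmod _; have : X <= ell * (INR M / INR b * E); last first.
    have := moebius_le1 b; have := Cmod_ge_0 (\csum_(1 <= m < N) (RtoC (ln (INR m)) * Phi (b * m)%N)); rewrite -/X => x0 m1 h.
    apply: Rle_trans (_ : X <= _); first by nra.
    by apply: Rle_trans h _; apply: Req_le; field; lra.
  have [a [b' [hab e]]] := @Phi_interval (fun m => RtoC (ln (INR m))) b ltac:(lia).
  rewrite /X e; apply: abel_bound => //.
  - apply: Rmult_le_pos => //; apply: Rmult_le_pos; [lra|by apply: Rlt_le; apply: Rinv_0_lt_compat].
  - by move=> c hc; apply: type1 => [|n hn]; [nia|apply: hab; lia].
  - move=> n hn hn'; apply: ln_mono; last by apply: le_INR; lia.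
    by apply: lt_0_INR; have := hab n ltac:(lia); nia.
  - move=> n /hab hn; split; first by apply: ln_ge0; apply: (le_INR 1); nia.
    by apply: ln_mono; [apply: lt_0_INR|apply: le_INR]; nia.
apply: Rle_trans (rsum_le_cond _ _) _.
  move=> b hb; apply: Rmult_le_pos; first by apply: Rmult_le_pos => //; nra.
  by apply: Rlt_le; apply: Rinv_0_lt_compat; apply: lt_0_INR; lia.
rewrite -rsum_mull.
apply: Rle_trans (Rmult_le_compat_l _ _ _ _ harm) _; first by apply: Rmult_le_pos => //; nra.
have q : 0 <= INR M * E by nra.
nra.
Qed.

(** Type I sums with [D = b * c <= U * V]. Two of the logarithms come from the harmonic sums over
    [b] and [c], the third from [mangoldt]. *)
Let S2 : Cmod (\csum_(1 <= b < N | (b <= U)%N) \csum_(1 <= c < N | (c <= V)%N) \csum_(1 <= d < N) G b c d) <=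
  INR M * E * (1 + ell) ^ 3.
Proof.
apply: Rle_trans (Cmod_csum _ _ _ _) _.
have q : 0 <= INR M * E by nra.
have i0 b : (1 <= b < N)%N -> 0 < / INR b by move=> hb; apply: Rinv_0_lt_compat; apply: lt_0_INR; lia.
apply: Rle_trans (_ : \rsum_(1 <= b < N | (b <= U)%N) (/ INR b * (ell * (INR M * E) * (1 + ell))) <= _).
  apply: rsum_le => b hb bU; apply: Rle_trans (Cmod_csum _ _ _ _) _.
  apply: Rle_trans (_ : \rsum_(1 <= c < N | (c <= V)%N) (/ INR b * (ell * (INR M * E)) * / INR c) <= _).
    apply: rsum_le => c hc cV; rewrite -csum_mull Cmod_mult Cmod_R.
    have [a [b' [hab e]]] := @Phi_interval (fun=> RtoC 1) (b * c) ltac:(nia).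
    have h1 : Cmod (\csum_(1 <= d < N) Phi (b * c * d)%N) <= INR M / INR (b * c) * E.
      rewrite (_ : \csum_(1 <= d < N) _ = \csum_(a <= n < b') F (b * c * n)%N).
        by apply: type1 => //; nia.
      transitivity (\csum_(1 <= n < N) (1 * Phi (b * c * n)%N)); first by apply: eq_bigr => n _; ring.
      by rewrite e; apply: eq_bigr => n _; ring.
    have h2 : Rabs (moebius b * mangoldt c) <= ell.
      rewrite Rabs_mult (Rabs_pos_eq _ (mangoldt_ge0 c)).
      have := moebius_le1 b; have := mangoldt_ge0 c; have := @mangoldt_le c ltac:(lia).
      have := Rabs_pos (moebius b); nra.
    apply: Rle_trans (Rmult_le_compat _ _ _ _ _ _ h2 h1) _; [exact: Rabs_pos|exact: Cmod_ge_0|].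
    rewrite mult_INR; apply: Req_le; field.
    by split; apply: not_0_INR; lia.
  have b0 : 0 <= / INR b * (ell * (INR M * E)).
    by apply: Rmult_le_pos; [apply: Rlt_le; apply: i0|nra].
  apply: Rle_trans (rsum_le_cond _ _) _.
    by move=> c /i0 hc; apply: Rmult_le_pos => //; lra.
  rewrite -rsum_mull; apply: Rle_trans (Rmult_le_compat_l _ _ _ b0 harm) _.
  by apply: Req_le; ring.
have p0 : 0 <= ell * (INR M * E) * (1 + ell) by apply: Rmult_le_pos; nra.
apply: Rle_trans (rsum_le_cond _ _) _.
  by move=> c /i0 hc; apply: Rmult_le_pos => //; lra.
rewrite -rsum_mulr; apply: Rle_trans (Rmult_le_compat_r _ _ _ p0 harm) _.
set x := INR M * E in q *; have -> : (1 + ell) * (ell * x * (1 + ell)) = x * (ell * (1 + ell) ^ 2) by ring.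
by apply: Rmult_le_compat_l => //; have := pow2_ge_0 (1 + ell); simpl; nra.
Qed.

Let count_multiples q : (0 < q)%N ->
  \rsum_(1 <= b < N | (b * q < N)%N) 1 <= INR N / INR q.
Proof.
move=> q0; have qp : 0 < INR q by apply: lt_0_INR; lia.
set K := (N %/ q)%N.
have hK : INR K <= INR N / INR q.
  apply: (Rmult_le_reg_r (INR q)) => //.
  rewrite /Rdiv Rmult_assoc Rinv_l ?Rmult_1_r; last lra.
  by rewrite -mult_INR; apply: le_INR; have := leq_trunc_div N q; rewrite -/K; lia.
apply: Rle_trans hK.
have hb b : (b * q < N)%N -> (b < K.+1)%N.
  by move=> h; rewrite ltnS leq_divRL //; lia.
apply: Rle_trans (_ : \rsum_(1 <= b < N | (b < K.+1)%N) 1 <= _).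
  rewrite big_mkcond [X in _ <= X]big_mkcond; apply: rsum_le => b _ _.
  by case: ifP => [/hb ->|_]; [lra|case: ifP; lra].
case: (leqP K.+1 N) => KN.
  by rewrite -(big_nat_widen 1 _ _ xpredT) // rsum_const Rmult_1_r; apply: le_INR; lia.
apply: Rle_trans (rsum_le_cond _ _) _; first by move=> *; lra.
by rewrite rsum_const Rmult_1_r; apply: le_INR; lia.
Qed.

(** The correlations that appear when the square in the type II estimate is opened. *)
Let Psi d c1 c2 : C := \csum_(1 <= b < N | (U < b)%N) (Phi (b * c1 * d)%N * Cconj (Phi (b * c2 * d)%N)).

Let Phi1 n : Cmod (Phi n) <= 1.
Proof. by rewrite /Phi; case: ifP => _ //; rewrite Cmod_0; lra. Qed.

Let Psi_diag d c : (0 < d)%N -> (0 < c)%N -> Cmod (Psi d c c) <= INR N / INR (c * d).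
Proof.
move=> d0 c0; apply: Rle_trans (Cmod_csum _ _ _ _) _.
apply: Rle_trans (count_multiples (_ : 0 < c * d)%N); last by nia.
rewrite big_mkcond [X in _ <= X]big_mkcond; apply: rsum_le => b _ _.
rewrite mulnA Cmod_mult Cmod_conj.
case: (ltnP (b * c * d) N) => h; last first.
  by rewrite PhiN // Cmod_0; case: ifP; lra.
have := Phi1 (b * c * d); have := Cmod_ge_0 (Phi (b * c * d)).
by case: ifP => _; nra.
Qed.

(** A non-empty sum has some [b > U] with [c1 * d * b < 2 * M], which bounds [D = c1 * d] by
    [2 M / U] and makes the type II hypothesis applicable. *)
Let Psi_lt d c1 c2 : (0 < d)%N -> (0 < c2 < c1)%N -> Cmod (Psi d c1 c2) <= INR M / INR (c1 * d) * E.
Proof.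
move=> d0 hc.
have cd0 : 0 < INR (c1 * d) by apply: lt_0_INR; nia.
pose P b := [&& (U < b)%N, (M <= c1 * d * b < N)%N & (M <= c2 * d * b < N)%N].
have [a [b [hab e]]] := @csum_convex P N (fun n => F (c1 * d * n)%N * Cconj (F (c2 * d * n)%N))%C
  ltac:(rewrite /P /N; move=> i j k hijk hi hk; nia).
have -> : Psi d c1 c2 = \csum_(a <= n < b) (F (c1 * d * n)%N * Cconj (F (c2 * d * n)%N)).
  rewrite -e [RHS]big_mkcond /= [RHS]big_ltn; last by lia.
  rewrite Cplus_0_l.
  rewrite /Psi big_mkcond; apply: eq_bigr => n _.
  rewrite /P /Phi -!(mulnA n) !(mulnC n).
  case: ifP => _ //=; case: ifP => _ /=; last by rewrite Cmult_0_l.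
  by case: ifP => _ //=; rewrite (_ : Cconj (RtoC 0) = RtoC 0) ?Cmult_0_r // /Cconj /= Ropp_0.
case: (ltnP a b) => ab; last first.
  rewrite big_geq // Cmod_0; apply: Rmult_le_pos => //.
  by apply: Rmult_le_pos; [lra|apply: Rlt_le; apply: Rinv_0_lt_compat].
have [ha _] := hab a ltac:(lia); have haP := ha; move: haP; rewrite /P /N => haP.
apply: type2 => //; first by nia.
by move=> n /hab[]; rewrite /P /N => /and3P[].
Qed.

Let Psi_le d c1 c2 B : (0 < d)%N -> (0 < B)%N -> (B <= c1)%N -> (B <= c2)%N ->
  Cmod (Psi d c1 c2) <= (if c1 == c2 then INR N / (INR B * INR d) else 0) + INR M / (INR B * INR d) * E.
Proof.
move=> d0 B0 h1 h2.
have Bd : 0 < INR B * INR d by apply: Rmult_lt_0_compat; apply: lt_0_INR; lia.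
have inv c : (B <= c)%N -> / INR (c * d) <= / (INR B * INR d).
  by move=> hc; rewrite -mult_INR; apply: Rinv_le_contravar; [apply: lt_0_INR|apply: le_INR]; nia.
have q : 0 <= INR M / (INR B * INR d) * E.
  by apply: Rmult_le_pos => //; apply: Rmult_le_pos; [lra|apply: Rlt_le; apply: Rinv_0_lt_compat].
case: eqP => [->|ne].
  apply: Rle_trans (Psi_diag d0 _) _; first by lia.
  have := Rmult_le_compat_l _ _ _ (Rle_trans _ _ _ Rle_0_1 N1) (inv _ h2); rewrite /Rdiv; rewrite /Rdiv in q; lra.
have key a b : (B <= a)%N -> (B <= b)%N -> (b < a)%N -> Cmod (Psi d a b) <= 0 + INR M / (INR B * INR d) * E.
  move=> ha hb hab; apply: Rle_trans (Psi_lt d0 _) _; first by lia.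
  rewrite Rplus_0_l; apply: Rmult_le_compat_r => //; apply: Rmult_le_compat_l; first lra.
  exact: inv.
case: (ltnP c2 c1) => h; first exact: key.
rewrite -Cmod_conj (_ : Cconj _ = Psi d c2 c1); first by apply: key => //; lia.
by rewrite /Psi csum_conj; apply: eq_bigr => b _; rewrite Cmult_conj Cconj_conj Cmult_comm.
Qed.

(** For fixed [d] the coefficient of the variable [b] is [moebius b] alone, so no divisor function
    enters Cauchy-Schwarz. The dyadic blocks in [c] make the range of [b] uniform. *)
Let T d i : C := \csum_(2 ^ i <= c < 2 ^ i.+1 | (V < c < N)%N) \csum_(1 <= b < N | (U < b)%N) G b c d.

Let t d i b : C := \csum_(2 ^ i <= c < 2 ^ i.+1 | (V < c < N)%N) (RtoC (mangoldt c) * Phi (b * c * d)%N).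

Let Tt d i : T d i = \csum_(1 <= b < N | (U < b)%N) (RtoC (moebius b) * t d i b).
Proof.
rewrite /T /t exchange_big /=; apply: eq_bigr => b _; rewrite csum_mull.
by apply: eq_bigr => c _; rewrite /G RtoC_mult; ring.
Qed.

(** Opening the square, at most [B = 2 ^ i] diagonal pairs contribute [N / (B d)] each, and at most
    [B ^ 2] pairs contribute [M E / (B d)] each. *)
Let t_sq d i : (0 < d)%N -> \rsum_(1 <= b < N | (U < b)%N) Cmod (t d i b) ^ 2 <=
  ell ^ 2 * (INR N / INR d + INR (2 ^ i) * INR M / INR d * E).
Proof.
move=> d0; set B := (2 ^ i)%N; have B0 : (0 < B)%N by rewrite expn_gt0.
have eB : (2 ^ i.+1 = 2 * B)%N by rewrite expnS.
have dp : 0 < INR d by apply: lt_0_INR; lia.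
have Bp : 0 < INR B by apply: lt_0_INR; lia.
set X := \rsum_(1 <= b < N | _) _.
have X0 : 0 <= X by apply: rsum_ge0 => b _ _; apply: pow2_ge_0.
have -> : X = Cmod (RtoC X) by rewrite Cmod_R Rabs_pos_eq.
have -> : RtoC X = \csum_(B <= c1 < 2 * B | (V < c1 < N)%N) \csum_(B <= c2 < 2 * B | (V < c2 < N)%N)
    (RtoC (mangoldt c1 * mangoldt c2) * Psi d c1 c2).
  rewrite /X RtoC_rsum.
  transitivity (\csum_(1 <= b < N | (U < b)%N) \csum_(B <= c1 < 2 * B | (V < c1 < N)%N) \csum_(B <= c2 < 2 * B | (V < c2 < N)%N)
      (RtoC (mangoldt c1 * mangoldt c2) * (Phi (b * c1 * d)%N * Cconj (Phi (b * c2 * d)%N)))).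
    apply: eq_bigr => b _; rewrite Cmod2_conj /t eB -/B csum_conj csum_mulr.
    apply: eq_bigr => c1 _; rewrite csum_mull; apply: eq_bigr => c2 _.
    have -> : Cconj (RtoC (mangoldt c2) * Phi (b * c2 * d)%N) = (RtoC (mangoldt c2) * Cconj (Phi (b * c2 * d)%N))%C.
      by rewrite Cmult_conj; congr Cmult; rewrite /Cconj /= Ropp_0.
    by rewrite RtoC_mult; ring.
  rewrite exchange_big /=; apply: eq_bigr => c1 _; rewrite exchange_big /=; apply: eq_bigr => c2 _.
  by rewrite /Psi csum_mull.
set Q1 := INR N / (INR B * INR d); set Q2 := INR M / (INR B * INR d) * E.
have Q1p : 0 <= Q1.
  by apply: Rmult_le_pos; [lra|apply: Rlt_le; apply: Rinv_0_lt_compat; nra].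
have Q2p : 0 <= Q2.
  by apply: Rmult_le_pos => //; apply: Rmult_le_pos; [lra|apply: Rlt_le; apply: Rinv_0_lt_compat; nra].
have e2 : 0 <= ell ^ 2 by apply: pow2_ge_0.
apply: Rle_trans (csum_le_const (c := ell ^ 2 * (Q1 + INR B * Q2)) _ _) _.
- by apply: Rmult_le_pos => //; nra.
- move=> c1 hc1 hc1'; apply: Rle_trans (Cmod_csum _ _ _ _) _.
  apply: Rle_trans (_ : \rsum_(B <= c2 < 2 * B) (ell ^ 2 * ((if c2 == c1 then Q1 else 0) + Q2)) <= _).
    rewrite big_mkcond; apply: rsum_le => c2 hc2 _.
    have pos : 0 <= (if c2 == c1 then Q1 else 0) + Q2 by case: ifP; lra.
    case: ifP => hc2'; last by apply: Rmult_le_pos.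
    rewrite Cmod_mult Cmod_R Rabs_mult !Rabs_pos_eq; try exact: mangoldt_ge0.
    have := @Psi_le d c1 c2 B d0 B0 ltac:(lia) ltac:(lia); rewrite eq_sym -/Q1 -/Q2 => h.
    have m1 := @mangoldt_le c1 ltac:(lia); have m2 := @mangoldt_le c2 ltac:(lia).
    have g1 := mangoldt_ge0 c1; have g2 := mangoldt_ge0 c2.
    by apply: Rmult_le_compat => //; [nra|apply: Cmod_ge_0|rewrite /= Rmult_1_r; apply: Rmult_le_compat].
  rewrite -rsum_mull; apply: Rmult_le_compat_l => //.
  rewrite big_split /= -big_mkcond (@big_nat_eq1 _ _ Rplus (fun=> Q1)); last by lia.
  by rewrite rsum_const (_ : (2 * B - B = B)%N); [lra|lia].
rewrite (_ : (2 * B - B = B)%N); last by lia.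
by apply: Req_le; rewrite /Q1 /Q2; field; lra.
Qed.

Let s := sqrt (8 / INR V + 2 * E).

(** Cauchy-Schwarz in [b], which takes at most [N / (B d)] values, against [t_sq]. Blocks with
    [2 B <= V] are empty, and for the others [4 / B <= 8 / V]. *)
Let T_le d i : (0 < d)%N -> Cmod (T d i) <= INR M / INR d * ell * s.
Proof.
move=> d0; set B := (2 ^ i)%N; have B0 : (0 < B)%N by rewrite expn_gt0.
have eB : (2 ^ i.+1 = 2 * B)%N by rewrite expnS.
have dp : 0 < INR d by apply: lt_0_INR; lia.
have Bp : 0 < INR B by apply: lt_0_INR; lia.
have Vp : 0 < INR V by apply: lt_0_INR; lia.
have s0 : 0 <= s by apply: sqrt_pos.
have Md : 0 <= INR M / INR d by apply: Rmult_le_pos; [lra|apply: Rlt_le; apply: Rinv_0_lt_compat].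
have rhs0 : 0 <= INR M / INR d * ell * s by apply: Rmult_le_pos => //; apply: Rmult_le_pos.
case: (leqP (2 * B) V) => BV.
  rewrite /T eB -/B big_nat_cond big1 ?Cmod_0 // => c hc; lia.
suff hsq : Cmod (T d i) ^ 2 <= (INR M / INR d * ell * s) ^ 2.
  by apply: Rnot_lt_le => h; nra.
rewrite Tt.
(* [t d i b] vanishes where [chi] does; [chi] is the second factor in Cauchy-Schwarz. *)
pose chi b : R := if (b * (B * d) < N)%N then 1 else 0.
have h1 : Cmod (\csum_(1 <= b < N | (U < b)%N) (RtoC (moebius b) * t d i b)) <=
    \rsum_(1 <= b < N | (U < b)%N) (chi b * Cmod (t d i b)).
  apply: Rle_trans (Cmod_csum _ _ _ _) _; apply: rsum_le => b hb bU.
  rewrite Cmod_mult Cmod_R /chi; have m1 := moebius_le1 b; have t0 := Cmod_ge_0 (t d i b).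
  case: ifP => hN; first by nra.
  rewrite (_ : t d i b = RtoC 0) ?Cmod_0; first by lra.
  rewrite /t big_nat_cond big1 // => c /andP[hc _].
  by rewrite PhiN ?Cmult_0_r //; nia.
apply: Rle_trans (pow_incr _ _ 2 (conj (Cmod_ge_0 _) h1)) _.
apply: Rle_trans (rsum_cauchy _ _ _ _ _) _.
have h2 : \rsum_(1 <= b < N | (U < b)%N) chi b ^ 2 <= INR N / (INR B * INR d).
  rewrite -mult_INR; apply: Rle_trans (count_multiples (_ : 0 < B * d)%N); last by nia.
  rewrite big_mkcond [X in _ <= X]big_mkcond; apply: rsum_le => b _ _.
  by rewrite /chi; case: ifP => _; case: ifP => _; rewrite /=; lra.
apply: Rle_trans (Rmult_le_compat _ _ _ _ _ _ h2 (t_sq i d0)) _.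
- by apply: rsum_ge0 => b _ _; apply: pow2_ge_0.
- by apply: rsum_ge0 => b _ _; apply: pow2_ge_0.
have iV : 0 < / INR V by apply: Rinv_0_lt_compat.
rewrite (Rpow_mult_distr _ s) (Rpow_mult_distr _ ell) /s pow2_sqrt; last by rewrite /Rdiv; lra.
have -> : INR N = 2 * INR M by rewrite mult_INR.
have -> : 2 * INR M / (INR B * INR d) * (ell ^ 2 * (2 * INR M / INR d + INR B * INR M / INR d * E)) =
   (INR M / INR d) ^ 2 * ell ^ 2 * (4 / INR B + 2 * E) by field; lra.
apply: Rmult_le_compat_l.
  by apply: Rmult_le_pos; apply: pow2_ge_0.
apply: Rplus_le_compat_r.
have BV' : INR V <= 2 * INR B by rewrite -(mult_INR 2); apply: le_INR; lia.
have -> : 8 / INR V = 4 / (INR V / 2) by field; lra.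
by apply: Rmult_le_compat_l; [lra|apply: Rinv_le_contravar; lra].
Qed.

Let S3 : Cmod (\csum_(1 <= c < N | (V < c)%N) \csum_(1 <= b < N | (U < b)%N) \csum_(1 <= d < N) G b c d) <=
  INR M * (1 + ell) ^ 2 * (INR L * s).
Proof.
have s0 : 0 <= s by apply: sqrt_pos.
have L0 := pos_INR L.
have -> : \csum_(1 <= c < N | (V < c)%N) \csum_(1 <= b < N | (U < b)%N) \csum_(1 <= d < N) G b c d =
    \csum_(1 <= d < N) \csum_(0 <= i < L) T d i.
  transitivity (\csum_(1 <= d < N) \csum_(1 <= c < N | (V < c)%N) \csum_(1 <= b < N | (U < b)%N) G b c d).
    rewrite [RHS]exchange_big /=; apply: eq_bigr => c _.
    by rewrite [RHS]exchange_big.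
  apply: eq_bigr => d _; rewrite (big_nat_widen 1 N (2 ^ L)) //.
  by rewrite big_mkcond csum_dyadic; apply: eq_bigr => i _; rewrite -big_mkcond.
apply: Rle_trans (Cmod_csum _ _ _ _) _.
apply: Rle_trans (_ : \rsum_(1 <= d < N) (INR M * ell * s * INR L * / INR d) <= _).
  apply: rsum_le => d hd _; apply: Rle_trans (csum_le_const (c := INR M / INR d * ell * s) _ _) _.
  - apply: Rle_trans (@T_le d 0%N ltac:(lia)); exact: Cmod_ge_0.
  - by move=> i _ _; apply: T_le; lia.
  by rewrite subn0; apply: Req_le; rewrite /Rdiv; ring.
have p : 0 <= INR M * ell * s * INR L.
  by apply: Rmult_le_pos => //; apply: Rmult_le_pos => //; nra.
rewrite -rsum_mull; apply: Rle_trans (Rmult_le_compat_l _ _ _ p harm) _.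
have -> : INR M * ell * s * INR L * (1 + ell) = INR M * (ell * (1 + ell)) * (INR L * s) by ring.
apply: Rmult_le_compat_r; first by nra.
by apply: Rmult_le_compat_l; [lra|nra].
Qed.

(** [A] is the part [b <= U] with all [c], [B] the part [b <= U], [c <= V], and [D] the part
    [b > U], [c > V]. Hence [A - B + D] is the part [c > V] of the triple sum, which is all of it
    since the part [c <= V] is 0. *)
Lemma vaughan_bound :
  Cmod (\csum_(M <= n < 2 * M) (RtoC (mangoldt n) * F n)) <=
  INR M * (1 + ln (INR (2 * M))) ^ 3 * (2 * E + INR L * sqrt (8 / INR V + 2 * E)).
Proof.
rewrite -/N -/ell -/s.
have -> : \csum_(M <= n < N) (RtoC (mangoldt n) * F n) = \csum_(1 <= n < N) (RtoC (mangoldt n) * Phi n).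
  rewrite [RHS](@big_cat_nat _ _ _ M) //=; try lia.
  rewrite [X in (X + _)%C]big_nat_cond [X in (X + _)%C]big1 => [|n hn]; last by rewrite PhiM ?Cmult_0_r //; lia.
  by rewrite Cplus_0_l; apply: eq_big_nat => n hn; rewrite /Phi hn.
have h1 := S1; have h2 := S2; have h3 := S3.
set A := \csum_(1 <= b < N | (b <= U)%N) \csum_(1 <= c < N) \csum_(1 <= d < N) G b c d in h1.
set B := \csum_(1 <= b < N | (b <= U)%N) \csum_(1 <= c < N | (c <= V)%N) \csum_(1 <= d < N) G b c d in h2.
set D := \csum_(1 <= c < N | _) _ in h3.
have hz : \csum_(1 <= c < N | (c <= V)%N) \csum_(1 <= b < N) \csum_(1 <= d < N) G b c d = RtoC 0.
  rewrite big_nat_cond big1 // => c /andP[hc cV].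
  by rewrite -split_sum // PhiM ?Cmult_0_r //; lia.
have -> : \csum_(1 <= n < N) (RtoC (mangoldt n) * Phi n) = (A + - B + D)%C.
  transitivity (\csum_(1 <= c < N) \csum_(1 <= b < N) \csum_(1 <= d < N) G b c d).
    by apply: eq_big_nat => c /split_sum.
  pose W c b := \csum_(1 <= d < N) G b c d.
  have hsplit c : \csum_(1 <= b < N) W c b =
      (\csum_(1 <= b < N | (b <= U)%N) W c b + \csum_(1 <= b < N | (U < b)%N) W c b)%C.
    by rewrite (bigID (fun b => b <= U)%N) /=; congr Cplus; apply: eq_bigl => b; rewrite ltnNge.
  rewrite -/(W _ _) (bigID (fun c => c <= V)%N) /= -/(W _ _).
  have -> : \csum_(1 <= c < N | (c <= V)%N) \csum_(1 <= b < N) W c b = RtoC 0 by exact: hz.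
  rewrite Cplus_0_l (eq_bigl (fun c => V < c)%N) => [|c]; last by rewrite ltnNge.
  rewrite (eq_bigr _ (fun c _ => hsplit c)) big_split /=; congr Cplus.
  have -> : A = \csum_(1 <= c < N) \csum_(1 <= b < N | (b <= U)%N) W c b by rewrite /A exchange_big.
  rewrite [X in (X + - _)%C](bigID (fun c => c <= V)%N) /=.
  have -> : B = \csum_(1 <= c < N | (c <= V)%N) \csum_(1 <= b < N | (b <= U)%N) W c b by rewrite /B exchange_big.
  rewrite [X in (_ + X + _)%C](eq_bigl (fun c => V < c)%N) => [|c]; last by rewrite ltnNge.
  by ring.
apply: Rle_trans (Cmod_triangle _ _) _.
have := Cmod_triangle A (- B); rewrite Cmod_opp.
have s0 : 0 <= s by apply: sqrt_pos.
have L0 := pos_INR L.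
have q : 0 <= INR M * E by nra.
have e1 : (1 + ell) ^ 2 <= (1 + ell) ^ 3 by apply: Rle_pow; [lra|lia].
have g1 := Rmult_le_compat_l _ _ _ q e1.
have Ls : 0 <= INR M * (INR L * s) by apply: Rmult_le_pos; nra.
have g2 := Rmult_le_compat_l _ _ _ Ls e1.
lra.
Qed.

End Vaughan.

(** * Chebyshev's lower bound *)

Lemma INR_expn (a i : nat) : INR (a ^ i)%N = INR a ^ i.
Proof. by elim: i => [|k IH]; [rewrite expn0 INR_1|rewrite expnS mult_INR IH]. Qed.

Lemma INR_2 : INR 2 = 2.
Proof. by rewrite /INR; lra. Qed.

(** Legendre's formula for the logarithm of a factorial. *)
Lemma sum_ln_mangoldt m N : (m < N)%N ->
  \rsum_(1 <= k < m.+1) ln (INR k) = \rsum_(1 <= c < N) (INR (m %/ c) * mangoldt c).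
Proof.
move=> mN.
rewrite (@eq_big_nat _ _ _ 1 m.+1 _ (fun k => \rsum_(1 <= c < N | (c %| k)%N) mangoldt c)) => [|k hk]; last first.
  by rewrite sum_mangoldt //; lia.
under eq_bigr do rewrite big_mkcond.
rewrite exchange_big /=; apply: eq_big_nat => c hc.
rewrite divn_count_dvd (big_morph INR plus_INR INR_0) rsum_mulr.
by apply: eq_bigr => k _; case: (c %| k)%N; rewrite /= ?INR_1 ?INR_0; ring.
Qed.

(** The logarithm of the central binomial coefficient is at least [n ln 2], because [n + k >= 2 k]
    for [k <= n], and at most the sum of [mangoldt], because integer division satisfies
    [2 n / c <= 2 (n / c) + 1]. *)
Lemma chebyshev_lower n : (0 < n)%N ->
  INR n / 2 <= \rsum_(1 <= c < (2 * n).+1) mangoldt c.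
Proof.
move=> n0; set N := (2 * n).+1.
have e2 := @sum_ln_mangoldt (2 * n) N (leqnn _).
have e1 := @sum_ln_mangoldt n N ltac:(lia).
have hdiff : INR n * ln 2 <= \rsum_(1 <= k < N) ln (INR k) - 2 * \rsum_(1 <= k < n.+1) ln (INR k).
  rewrite (@big_cat_nat _ _ _ n.+1 1 N) //=; last by lia.
  have -> : \rsum_(n.+1 <= k < N) ln (INR k) = \rsum_(1 <= k < n.+1) ln (INR (k + n)%N).
    rewrite -{1}[n.+1]add1n big_addn (_ : (N - n = n.+1)%N) //; lia.
  suff : INR n * ln 2 + \rsum_(1 <= k < n.+1) ln (INR k) <= \rsum_(1 <= k < n.+1) ln (INR (k + n)%N) by lra.
  have -> : INR n * ln 2 = \rsum_(1 <= k < n.+1) ln 2 by rewrite rsum_const subSS subn0.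
  rewrite -big_split /=; apply: rsum_le => k hk _.
  have k0 : 0 < INR k by apply: lt_0_INR; lia.
  rewrite -ln_mult; try lra; apply: ln_mono; first lra.
  by rewrite plus_INR; have : INR k <= INR n by [apply: le_INR; lia]; lra.
apply: Rle_trans (_ : INR n * ln 2 <= _).
  by have := ln_lt_2; have := pos_INR n; nra.
apply: Rle_trans hdiff _; rewrite e1 e2 rsum_mull.
suff : \rsum_(1 <= c < N) (INR (2 * n %/ c) * mangoldt c) <=
  \rsum_(1 <= c < N) mangoldt c + \rsum_(1 <= c < N) (2 * (INR (n %/ c) * mangoldt c)) by lra.
rewrite -big_split /=; apply: rsum_le => c hc _.
have hdiv : INR (2 * n %/ c) <= 2 * INR (n %/ c) + 1.
  rewrite -INR_2 -mult_INR -S_INR; apply: le_INR.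
  have : (2 * n %/ c < (2 * (n %/ c)).+2)%N.
    by rewrite ltn_divLR; [have := ltn_ceil n (_ : 0 < c)%N; nia|lia].
  by lia.
by have := mangoldt_ge0 c; nra.
Qed.

Lemma rsum_dyadic (z : nat -> R) h K : (h <= K)%N ->
  \rsum_(2 ^ h <= c < 2 ^ K) z c = \rsum_(h <= i < K) \rsum_(2 ^ i <= c < 2 ^ i.+1) z c.
Proof.
move/subnK <-; elim: (K - h)%N => [|k IH]; first by rewrite !big_geq.
rewrite addSn [RHS]big_nat_recr ?leq_addl //= -IH (@big_cat_nat _ _ _ (2 ^ (k + h))%N) //=.
  by rewrite leq_exp2l // leq_addl.
by rewrite leq_exp2l.
Qed.

(** Pigeonhole: the blocks [h <= i < K] carry a total weight of at least [X / 8], whereas all of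
    them falling short of the claimed bound would leave at most [X y^(-eps) <= X / 9]. Starting at
    half of [K] keeps the chosen block above about the square root of [X]. *)
Lemma dyadic_primes eps : 0 < eps -> exists K0, forall K, (K0 <= K)%N ->
  exists i, (K <= (2 * i).+1)%N /\ (i < K)%N /\
  INR (2 ^ i) * Rpower (INR (2 ^ i)) (- eps) <=
  \rsum_(2 ^ i <= n < 2 ^ i.+1 | prime n) mangoldt n.
Proof.
move=> eps0.
(* 152 is 8 times 19: the primes below [y], the non-primes and [N] itself cost 2, 16 and 1 times
   [y l^2], which together must stay below [X / 8]. *)
have [Y0 hY0] := for_large_and (@for_large_ln 152 2 1 ltac:(lra)) (for_large_and (@for_large_const 9 eps eps0) (for_large_ge 2)).
have [H1 [_ hH1]] := @nat_floor (Rmax Y0 0) (Rmax_r _ _).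
exists (2 * H1.+1)%N => K hK.
set h := K./2; have hh : (H1.+1 <= h)%N by rewrite /h; lia.
have hK2 : (K = 2 * h \/ K = (2 * h).+1)%N by rewrite /h; lia.
set y := INR (2 ^ h); set X := INR (2 ^ K).
have yY0 : Y0 <= y.
  apply: Rle_trans (Rmax_l Y0 0) _; apply: Rle_trans (_ : INR H1.+1 <= _); first by rewrite S_INR; lra.
  by apply: le_INR; have := ltn_expl h (isT : 1 < 2)%N; lia.
have [c1 [c2 y2]] := hY0 _ yY0.
rewrite Rpower_1 in c1; last lra.
have y0 : 0 < y by lra.
have Xy : y * y <= X <= 2 * (y * y).
  rewrite /X /y -mult_INR -INR_2 -mult_INR !multE -expnD -expnS.
  by split; apply: le_INR; apply/leP; rewrite leq_exp2l //; lia.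
have X1 : 1 <= X by nra.
set l := 1 + ln y in c1.
have l1 : 1 <= l by have := @ln_ge0 y ltac:(lra); rewrite /l; lra.
have lnX : ln X <= 2 * l.
  apply: Rle_trans (ln_mono _ (proj2 Xy)) _; first lra.
  rewrite !ln_mult; try nra.
  by have := @ln_le_sub1 2 ltac:(lra); rewrite /l; lra.
have lnX0 : 0 <= ln X by apply: ln_ge0.
have KX : INR K <= 2 * ln X.
  rewrite /X INR_expn INR_2 ln_pow; last lra.
  by have := ln_lt_2; have := pos_INR K; nra.
set N := (2 ^ K)%N.
have N0 : (0 < N)%N by rewrite expn_gt0.
pose Th i := \rsum_(2 ^ i <= n < 2 ^ i.+1 | prime n) mangoldt n.
have tot : X / 8 <= \rsum_(h <= i < K) Th i.
  have hc := @chebyshev_lower (2 ^ K.-1) (ltac:(by rewrite expn_gt0)).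
  have eK : (2 * 2 ^ K.-1 = N)%N by rewrite -expnS prednK //; lia.
  rewrite eK in hc.
  have e4 : INR (2 ^ K.-1) / 2 = X / 4 by rewrite /X -/N -eK mult_INR INR_2; field.
  rewrite e4 big_nat_recr // /= in hc.
  have hl : mangoldt N <= ln X by apply: mangoldt_le_ln.
  have ids : \rsum_(1 <= n < N) mangoldt n =
     \rsum_(1 <= n < N | prime n) mangoldt n + \rsum_(1 <= n < N | ~~ prime n) mangoldt n by rewrite (bigID prime).
  have hnp : \rsum_(1 <= n < N | ~~ prime n) mangoldt n <= INR (2 ^ h.+1) * INR K * ln X.
    by apply: sum_mangoldt_nonprime => //; rewrite -expnM /N leq_exp2l //; lia.
  have e5 : INR (2 ^ h.+1) = 2 * y by rewrite expnS mult_INR INR_2.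
  have spl : \rsum_(1 <= n < N | prime n) mangoldt n =
      \rsum_(1 <= n < 2 ^ h | prime n) mangoldt n + \rsum_(2 ^ h <= n < N | prime n) mangoldt n.
    by rewrite (@big_cat_nat _ _ _ (2 ^ h)%N) //= ?expn_gt0 // /N leq_exp2l //; lia.
  have hlow : \rsum_(1 <= n < 2 ^ h | prime n) mangoldt n <= y * ln X.
    apply: Rle_trans (rsum_le_const (c := ln X) _ _) _ => //.
      move=> n hn _; apply: Rle_trans (mangoldt_le_ln _) _; first by lia.
      apply: ln_mono; first by apply: lt_0_INR; lia.
      apply: le_INR; have : (2 ^ h <= 2 ^ K)%N by rewrite leq_exp2l //; lia.
      by lia.
    by apply: Rmult_le_compat_r => //; apply: le_INR; lia.
  have hd : \rsum_(2 ^ h <= n < N | prime n) mangoldt n = \rsum_(h <= i < K) Th i.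
    rewrite big_mkcond /N rsum_dyadic; last by lia.
    by apply: eq_bigr => i _; rewrite -big_mkcond.
  rewrite -hd; rewrite e5 in hnp.
  have hKl : INR K * ln X <= 2 * (2 * l) * (2 * l).
    apply: Rmult_le_compat => //; [exact: pos_INR|lra].
  have h6 : 2 * y * INR K * ln X <= 16 * (y * l ^ 2) by nra.
  have l2 : ln X <= 2 * l ^ 2 by simpl; nra.
  have l20 : 0 <= l ^ 2 by apply: pow2_ge_0.
  have yl : y * ln X <= 2 * (y * l ^ 2).
    by have := Rmult_le_compat_l _ _ _ (Rlt_le _ _ y0) l2; lra.
  have ly : ln X <= y * l ^ 2 by nra.
  have : 152 * (y * l ^ 2) <= X.
    by have := Rmult_le_compat_l _ _ _ (Rlt_le _ _ y0) c1; lra.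
  lra.
case: (boolP [exists i : 'I_K, (h <= i)%N && Rle_dec (INR (2 ^ i) * Rpower (INR (2 ^ i)) (- eps)) (Th i)]).
  move=> /existsP[i /andP[hi]]; case: Rle_dec => // hle _.
  by exists i; split; [lia|split=> //; apply: ltn_ord].
move=> /existsPn hn; exfalso.
have : \rsum_(h <= i < K) Th i <= \rsum_(h <= i < K) (INR (2 ^ i) * Rpower y (- eps)).
  apply: rsum_le => i hi _.
  have iK : (i < K)%N by lia.
  have := hn (Ordinal iK); rewrite /= (_ : (h <= i)%N = true) /=; last by lia.
  case: Rle_dec => // hle _.
  apply: Rle_trans (Rlt_le _ _ (Rnot_le_lt _ _ hle)) _.
  apply: Rmult_le_compat_l; first exact: pos_INR.
  apply: Rpower_anti; last lra.
  by split=> //; apply: le_INR; apply/leP; rewrite leq_exp2l //; lia.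
rewrite -rsum_mulr.
have geo : \rsum_(h <= i < K) INR (2 ^ i) <= X.
  have hKK : (h <= K)%N by lia.
  rewrite /X; move/subnK: hKK => <-; elim: (K - h)%N => [|k IH].
    by rewrite big_geq //; apply: pos_INR.
  rewrite addSn big_nat_recr ?leq_addl //= expnS mult_INR INR_2; lra.
have c2' : Rpower y (- eps) * 9 <= 1.
  rewrite Rpower_Ropp; apply: (Rmult_le_reg_l (Rpower y eps)); first exact: Rpower_gt0.
  by rewrite -Rmult_assoc Rinv_r; have := Rpower_gt0 y eps; lra.
have p := Rpower_gt0 y (- eps); nra.
Qed.

(** * Detecting small fractional parts *)

Lemma floorZ_bounds x : IZR (floorZ x) <= x < IZR (floorZ x) + 1.
Proof. by have := archimed x; rewrite /floorZ minus_IZR; lra. Qed.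

Lemma floorZ_eq x (m : Z) : IZR m <= x < IZR m + 1 -> floorZ x = m.
Proof.
move=> h; have h' := floorZ_bounds x.
have h1 : (m < floorZ x + 1)%Z by apply: lt_IZR; rewrite plus_IZR; lra.
have h2 : (floorZ x < m + 1)%Z by apply: lt_IZR; rewrite plus_IZR; lra.
lia.
Qed.

Lemma dist_int_le x (z : Z) : dist_int x <= Rabs (x - IZR z).
Proof.
have h := floorZ_bounds x; rewrite /dist_int.
case: (Z_le_gt_dec z (floorZ x)) => hz.
  have hz' : IZR z <= IZR (floorZ x) by apply: IZR_le.
  by apply: Rle_trans (Rmin_l _ _) _; rewrite Rabs_pos_eq; lra.
have hz' : IZR (floorZ x) + 1 <= IZR z by rewrite -plus_IZR; apply: IZR_le; lia.
by apply: Rle_trans (Rmin_r _ _) _; rewrite Rabs_minus_sym Rabs_pos_eq; lra.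
Qed.

Lemma dist_int_attained x : exists z : Z, dist_int x = Rabs (x - IZR z) /\ Rabs (x - IZR z) <= / 2.
Proof.
have h := floorZ_bounds x; rewrite /dist_int /Rmin; case: Rle_dec => hr.
  by exists (floorZ x); rewrite Rabs_pos_eq; lra.
by exists (floorZ x + 1)%Z; rewrite plus_IZR Rabs_minus_sym Rabs_pos_eq; lra.
Qed.

Lemma Cmod_1_expi_dist x : dist_int x <= Cmod (1 - expi x).
Proof.
have [z [-> h]] := dist_int_attained x.
have -> : expi x = expi (x - IZR z).
  have {1}-> : x = (x - IZR z) + IZR z by ring.
  by rewrite expiD expi_IZR Cmult_1_r.
exact: Cmod_1_expi_ge.
Qed.

Definition dirichlet_kernel (K : nat) (x : R) : C := \csum_(0 <= k < K) expi (INR k * x)%R.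

Lemma dirichlet_kernel_le K x w : 0 < w <= dist_int x ->
  Cmod (dirichlet_kernel K x) ^ 2 <= 4 / w ^ 2.
Proof.
move=> [w0 hw]; have hd := Cmod_1_expi_dist x.
have e : (dirichlet_kernel K x * (1 - expi x) = 1 - expi (INR K * x)%R)%C.
  rewrite /dirichlet_kernel; elim: K => [|K IH].
    by rewrite big_geq // INR_0 Rmult_0_l expi0; ring.
  rewrite big_nat_recr //= Cmult_plus_distr_r IH S_INR Rmult_plus_distr_r Rmult_1_l expiD.
  by ring.
have h : Cmod (dirichlet_kernel K x) * Cmod (1 - expi x) <= 2.
  rewrite -Cmod_mult e; apply: Rle_trans (Cmod_triangle _ _) _.
  by rewrite Cmod_opp Cmod_expi Cmod_1; lra.
set D := Cmod _ in h *; have D0 : 0 <= D by apply: Cmod_ge_0.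
have Dw : D * w <= 2 by nra.
apply: (Rmult_le_reg_r (w ^ 2)); first by apply: pow_lt.
have -> : 4 / w ^ 2 * w ^ 2 = 4 by field; lra.
rewrite -Rpow_mult_distr; have Dw0 : 0 <= D * w by apply: Rmult_le_pos; lra.
by simpl; nra.
Qed.

Section Detection.
Variables (a b : nat) (g : nat -> R).
Hypothesis g0 : forall n, 0 <= g n.
Let W := \rsum_(a <= n < b) g n.

(** In the opened square the [J] diagonal pairs form the main term, and every other pair is an
    exponential sum of size at most [Er]. *)
Lemma mean_square J (phi : nat -> nat -> R) Er : 0 <= Er ->
  (forall i j, (i < J)%N -> (j < J)%N -> i != j ->
    Cmod (\csum_(a <= n < b) (RtoC (g n) * expi (phi i n - phi j n)%R)) <= Er) ->
  Rabs (\rsum_(a <= n < b) (g n * Cmod (\csum_(0 <= j < J) expi (phi j n)) ^ 2) - INR J * W)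
    <= INR J ^ 2 * Er.
Proof.
move=> Er0 hE; rewrite -Cmod_R.
pose S i j := \csum_(a <= n < b) (RtoC (g n) * expi (phi i n - phi j n)%R).
have -> : RtoC (\rsum_(a <= n < b) (g n * Cmod (\csum_(0 <= j < J) expi (phi j n)) ^ 2) - INR J * W) =
    \csum_(0 <= i < J) \csum_(0 <= j < J) (S i j - RtoC (if j == i then W else 0)).
  rewrite RtoC_minus RtoC_rsum.
  have -> : \csum_(a <= n < b) RtoC (g n * Cmod (\csum_(0 <= j < J) expi (phi j n)) ^ 2) =
      \csum_(0 <= i < J) \csum_(0 <= j < J) S i j.
    transitivity (\csum_(a <= n < b) \csum_(0 <= i < J) \csum_(0 <= j < J) (RtoC (g n) * expi (phi i n - phi j n)%R)).
      apply: eq_bigr => n _; rewrite RtoC_mult Cmod2_conj csum_conj csum_mulr csum_mull.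
      apply: eq_bigr => i _; rewrite csum_mull csum_mull; apply: eq_bigr => j _.
      by rewrite expi_conj -expiD.
    by rewrite exchange_big /=; apply: eq_bigr => i _; rewrite exchange_big.
  have -> : RtoC (INR J * W) = \csum_(0 <= i < J) \csum_(0 <= j < J) RtoC (if j == i then W else 0).
    rewrite -{1}(subn0 J) -rsum_const RtoC_rsum; apply: eq_big_nat => i hi.
    by rewrite -RtoC_rsum -big_mkcond (@big_nat_eq1 _ _ Rplus (fun=> W)).
  have opp F G : (\csum_(0 <= i < J) F i - \csum_(0 <= i < J) G i = \csum_(0 <= i < J) (F i - G i))%C.
    rewrite /Cminus big_split /=; congr Cplus.
    by rewrite (_ : forall z : C, - z = RtoC (-1) * z)%C ?csum_mull => [|z]; [apply: eq_bigr => i _; ring|ring].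
  by rewrite opp; apply: eq_bigr => i _; rewrite opp.
have J0 := pos_INR J.
have -> : INR J ^ 2 * Er = INR (J - 0) * (INR (J - 0) * Er) by rewrite subn0; ring.
apply: csum_le_const; first by rewrite subn0; nra.
move=> i hi _; apply: csum_le_const => // j hj _.
case: (eqVneq j i) => [->|ji]; last first.
  by rewrite (_ : S i j - 0 = S i j)%C; last (by ring); apply: hE; [lia|lia|rewrite eq_sym].
suff -> : S i i = RtoC W by rewrite /Cminus Cplus_opp_r Cmod_0.
rewrite /S /W RtoC_rsum; apply: eq_bigr => n _.
by rewrite Rminus_diag expi0 Cmult_1_r.
Qed.

Lemma kernel_mean (x : nat -> R) K Er : 0 <= Er ->
  (forall i j, (i < K)%N -> (j < K)%N -> i != j ->
    Cmod (\csum_(a <= n < b) (RtoC (g n) * expi ((INR i - INR j) * x n)%R)) <= Er) ->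
  Rabs (\rsum_(a <= n < b) (g n * Cmod (dirichlet_kernel K (x n)) ^ 2) - INR K * W) <= INR K ^ 2 * Er.
Proof.
move=> Er0 hE; apply: (@mean_square K (fun k n => INR k * x n)) => // i j hi hj ij.
by under eq_bigr do rewrite -Rmult_minus_distr_r; apply: hE.
Qed.

(** Otherwise the squared kernel is at most [4 / w^2 <= K / 2] on the support of [g], and its mean
    at most [K W / 2]; but [kernel_mean] makes it larger than that. *)
Lemma detect1 (x : nat -> R) K w Er : 0 < W -> 0 < w -> 8 / w ^ 2 <= INR K ->
  0 <= Er -> 2 * INR K * Er < W ->
  (forall i j, (i < K)%N -> (j < K)%N -> i != j ->
    Cmod (\csum_(a <= n < b) (RtoC (g n) * expi ((INR i - INR j) * x n)%R)) <= Er) ->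
  exists n, (a <= n < b)%N /\ 0 < g n /\ dist_int (x n) < w.
Proof.
move=> W0 w0 hK Er0 KEr hE.
have w2 : 0 < / w ^ 2 by apply: Rinv_0_lt_compat; apply: pow_lt.
have [h1 _] := proj1 (Rcomplements.Rabs_le_between _ _) (kernel_mean Er0 hE).
apply: NNPP => hn.
have : \rsum_(a <= n < b) (g n * Cmod (dirichlet_kernel K (x n)) ^ 2) <= \rsum_(a <= n < b) (4 / w ^ 2 * g n).
  apply: rsum_le => n hab _; case: (Req_dec (g n) 0) => [->|gn].
    by rewrite Rmult_0_l Rmult_0_r; lra.
  have gp : 0 < g n by have := g0 n; lra.
  have hw : w <= dist_int (x n) by apply: Rnot_lt_le => h; apply: hn; exists n.
  have := dirichlet_kernel_le K (conj w0 hw); nra.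
rewrite -rsum_mull -/W => h2.
have K0 : 0 < INR K by rewrite /Rdiv in hK; lra.
rewrite /Rdiv in h2 hK; have : 8 * / w ^ 2 * W <= INR K * W by apply: Rmult_le_compat_r; lra.
nra.
Qed.

(** Pairs of frequencies are enumerated by Euclidean division, so that [mean_square] also covers a
    product of two kernels. *)
Lemma csum_pairs (F : nat -> nat -> C) K m : (0 < K)%N ->
  \csum_(0 <= j < K * m) F (j %% K)%N (j %/ K)%N = \csum_(0 <= l < m) \csum_(0 <= k < K) F k l.
Proof.
move=> K0; elim: m => [|m IH]; first by rewrite muln0 !big_geq.
rewrite [RHS]big_nat_recr //= -IH (@big_cat_nat _ _ _ (K * m)%N) //=; last by nia.
congr Cplus; rewrite -{1}[(K * m)%N]add0n big_addn (_ : (K * m.+1 - K * m = K)%N); last by nia.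
apply: eq_big_nat => k hk.
by rewrite (addnC k) (mulnC K) modnMDl modn_small ?divnMDl ?divn_small ?addn0 //; lia.
Qed.

Lemma kernel_mean2 (x y : nat -> R) K Er : 0 <= Er -> (0 < K)%N ->
  (forall i j k l, (i < K)%N -> (j < K)%N -> (k < K)%N -> (l < K)%N -> (i, k) != (j, l) ->
    Cmod (\csum_(a <= n < b) (RtoC (g n) * expi ((INR i - INR j) * x n + (INR k - INR l) * y n)%R)) <= Er) ->
  Rabs (\rsum_(a <= n < b) (g n * (Cmod (dirichlet_kernel K (x n)) ^ 2 * Cmod (dirichlet_kernel K (y n)) ^ 2))
    - INR K ^ 2 * W) <= INR K ^ 4 * Er.
Proof.
move=> Er0 K0 hE.
have := @mean_square (K * K) (fun j n => INR (j %% K) * x n + INR (j %/ K) * y n) Er Er0.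
have e n : \csum_(0 <= j < K * K) expi (INR (j %% K) * x n + INR (j %/ K) * y n)%R =
    (dirichlet_kernel K (x n) * dirichlet_kernel K (y n))%C.
  rewrite (csum_pairs (fun k l => expi (INR k * x n + INR l * y n)%R) K K0) /dirichlet_kernel csum_mull.
  apply: eq_bigr => l _; rewrite csum_mulr; apply: eq_bigr => k _; exact: expiD.
have -> : \rsum_(a <= n < b) (g n * Cmod (\csum_(0 <= j < K * K) expi (INR (j %% K) * x n + INR (j %/ K) * y n)%R) ^ 2) =
    \rsum_(a <= n < b) (g n * (Cmod (dirichlet_kernel K (x n)) ^ 2 * Cmod (dirichlet_kernel K (y n)) ^ 2)).
  by apply: eq_bigr => n _; rewrite e Cmod_mult Rpow_mult_distr.
rewrite mult_INR (_ : INR K * INR K = INR K ^ 2); last by ring.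
rewrite (_ : (INR K ^ 2) ^ 2 = INR K ^ 4); last by ring.
apply=> i j hi hj ij.
rewrite (eq_bigr (fun n => (RtoC (g n) * expi ((INR (i %% K) - INR (j %% K)) * x n + (INR (i %/ K) - INR (j %/ K)) * y n)%R)%C)) => [|n _]; last first.
  by congr (_ * expi _)%C; ring.
apply: hE; rewrite ?ltn_mod ?ltn_divLR //.
apply/eqP => -[h1 h2]; move/eqP: ij; apply.
by rewrite (divn_eq i K) (divn_eq j K) h1 h2.
Qed.

(** Otherwise at each [n] of the support one of the squared kernels [p], [q] is at most [4 / w^2],
    so [p q <= 4 / w^2 (p + q)]. Summed with weights, the left side is at least [3/4 K^2 W], while
    the right side is at most [K/4] times [5/2 K W], that is [5/8 K^2 W]. *)
Lemma detect2 (x y : nat -> R) K w Er : 0 < W -> 0 < w -> 16 / w ^ 2 <= INR K ->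
  0 <= Er -> 4 * INR K ^ 2 * Er <= W ->
  (forall i j k l, (i < K)%N -> (j < K)%N -> (k < K)%N -> (l < K)%N -> (i, k) != (j, l) ->
    Cmod (\csum_(a <= n < b) (RtoC (g n) * expi ((INR i - INR j) * x n + (INR k - INR l) * y n)%R)) <= Er) ->
  exists n, (a <= n < b)%N /\ 0 < g n /\ dist_int (x n) < w /\ dist_int (y n) < w.
Proof.
move=> W0 w0 hK Er0 KEr hE.
have w2 : 0 < / w ^ 2 by apply: Rinv_0_lt_compat; apply: pow_lt.
have Kp : 0 < INR K by rewrite /Rdiv in hK; lra.
have K0 : (0 < K)%N by apply/ltP; apply: INR_lt; rewrite INR_0.
have [h1 _] := proj1 (Rcomplements.Rabs_le_between _ _) (kernel_mean2 Er0 K0 hE).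
have hx : forall i j, (i < K)%N -> (j < K)%N -> i != j ->
    Cmod (\csum_(a <= n < b) (RtoC (g n) * expi ((INR i - INR j) * x n)%R)) <= Er.
  move=> i j hi hj ij; have := hE i j 0%N 0%N hi hj K0 K0.
  rewrite xpair_eqE eqxx andbT => /(_ ij); apply: Rle_trans; apply: Req_le.
  by congr Cmod; apply: eq_bigr => n _; congr (_ * expi _)%C; ring.
have hy : forall i j, (i < K)%N -> (j < K)%N -> i != j ->
    Cmod (\csum_(a <= n < b) (RtoC (g n) * expi ((INR i - INR j) * y n)%R)) <= Er.
  move=> i j hi hj ij; have := hE 0%N 0%N i j K0 K0 hi hj.
  rewrite xpair_eqE eqxx andTb => /(_ ij); apply: Rle_trans; apply: Req_le.
  by congr Cmod; apply: eq_bigr => n _; congr (_ * expi _)%C; ring.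
have [_ h2] := proj1 (Rcomplements.Rabs_le_between _ _) (kernel_mean Er0 hx).
have [_ h3] := proj1 (Rcomplements.Rabs_le_between _ _) (kernel_mean Er0 hy).
apply: NNPP => hn.
have : \rsum_(a <= n < b) (g n * (Cmod (dirichlet_kernel K (x n)) ^ 2 * Cmod (dirichlet_kernel K (y n)) ^ 2)) <=
   \rsum_(a <= n < b) (4 / w ^ 2 * (g n * Cmod (dirichlet_kernel K (x n)) ^ 2 + g n * Cmod (dirichlet_kernel K (y n)) ^ 2)).
  apply: rsum_le => n hab _; case: (Req_dec (g n) 0) => [->|gn].
    by rewrite !Rmult_0_l; lra.
  have gp : 0 < g n by have := g0 n; lra.
  set p := Cmod _ ^ 2; set q := Cmod _ ^ 2.
  have p0 : 0 <= p by apply: pow2_ge_0.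
  have q0 : 0 <= q by apply: pow2_ge_0.
  have W4 : 0 < 4 / w ^ 2 by rewrite /Rdiv; lra.
  suff : p * q <= 4 / w ^ 2 * (p + q) by nra.
  case: (Rlt_dec (dist_int (x n)) w) => hxw; last first.
    have := dirichlet_kernel_le K (conj w0 (Rnot_lt_le _ _ hxw)); rewrite -/p; nra.
  case: (Rlt_dec (dist_int (y n)) w) => hyw; last first.
    have := dirichlet_kernel_le K (conj w0 (Rnot_lt_le _ _ hyw)); rewrite -/q; nra.
  by case: hn; exists n.
rewrite -rsum_mull big_split /=.
set A := \rsum_(a <= n < b) _ in h1 *; set B := \rsum_(a <= n < b) _ in h2 *; set D := \rsum_(a <= n < b) _ in h3 *.
rewrite -[w * (w * 1)]/(w ^ 2) => h4.
have K1 : 1 <= INR K by apply: (le_INR 1); lia.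
have e1 : INR K ^ 2 * Er <= W / 4 by lra.
have e2 : INR K ^ 4 * Er <= INR K ^ 2 * (W / 4).
  have -> : INR K ^ 4 * Er = INR K ^ 2 * (INR K ^ 2 * Er) by ring.
  by apply: Rmult_le_compat_l => //; apply: pow2_ge_0.
have BD : B + D <= 5 / 2 * (INR K * W) by nra.
have h5 : 4 / w ^ 2 * (B + D) <= INR K / 4 * (5 / 2 * (INR K * W)).
  rewrite /Rdiv in hK *; apply: Rle_trans (_ : 4 * / w ^ 2 * (5 * / 2 * (INR K * W)) <= _).
    by apply: Rmult_le_compat_l; lra.
  by apply: Rmult_le_compat_r; [nra|lra].
have : 0 < INR K ^ 2 * W by apply: Rmult_lt_0_compat => //; apply: pow_lt.
have e3 : INR K / 4 * (5 / 2 * (INR K * W)) = 5 / 8 * (INR K ^ 2 * W) by field.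
lra.
Qed.

End Detection.

(** * Pseudo-polynomials at primes *)

(** The falling factorial: the coefficient in the [i]-th derivative of a power with exponent [x]. *)
Fixpoint falling (x : R) (i : nat) : R :=
  if i is i'.+1 then falling x i' * (x - INR i') else 1.

Lemma falling_nat n i : (n < i)%N -> falling (INR n) i = 0.
Proof.
elim: i => // i IH; rewrite ltnS leq_eqVlt => /orP[/eqP->|/IH h] /=; last by rewrite h; ring.
by ring.
Qed.

Lemma falling_neq0 x i : (forall z : Z, x <> IZR z) -> falling x i <> 0.
Proof.
move=> hx; elim: i => [|i IH] /=; first lra.
apply: Rmult_integral_contrapositive_currified => //.
by have := hx (Z.of_nat i); rewrite -INR_IZR_INZ; lra.
Qed.

Lemma derivable_pt_lim_rsum d (F F' : nat -> R -> R) x :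
  (forall j, (j < d)%N -> derivable_pt_lim (F j) x (F' j x)) ->
  derivable_pt_lim (fun y => \rsum_(0 <= j < d) F j y) x (\rsum_(0 <= j < d) F' j x).
Proof.
elim: d => [|d IH] hF.
  rewrite big_geq // => eps he; exists (mkposreal 1 ltac:(lra)) => h _ _.
  by rewrite !big_geq // (_ : (0 - 0) / h - 0 = 0) ?Rabs_R0 // /Rdiv; ring.
have h := derivable_pt_lim_plus _ _ _ _ _ (IH (fun j hj => hF j (ltnW hj))) (hF d (leqnn _)).
rewrite big_nat_recr //= => eps he; have [del hd] := h eps he; exists del => y y0 hy.
by rewrite !big_nat_recr //=; apply: hd.
Qed.

Section PowerSums.
Variables (d t : nat) (alpha theta : nat -> R).
Hypotheses (td : (t < d)%N) (alpha_gt0 : forall j, (j < d)%N -> 0 < alpha j).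
Hypothesis theta_ge1 : forall j, (j < d)%N -> 1 <= theta j.
Hypothesis theta_lt : forall j, (j < t)%N -> theta j < theta t.
Hypothesis theta_t : forall z : Z, theta t <> IZR z.
Hypothesis theta_int : forall j, (t < j < d)%N -> exists z : Z, theta j = IZR z.

(** The coefficients [c] stay free, so that the phases of type I and of type II form one family.
    Throughout, [t] marks the largest non-integral exponent. *)
Definition power_sum_deriv (c : nat -> R) (i : nat) (x : R) : R :=
  \rsum_(0 <= j < d) (c j * falling (theta j) i * Rpower x (theta j - INR i)).

Lemma power_sum_derivP c i x : 0 < x ->
  derivable_pt_lim (power_sum_deriv c i) x (power_sum_deriv c i.+1 x).
Proof.
move=> x0; apply: (@derivable_pt_lim_rsum d
  (fun j y => c j * falling (theta j) i * Rpower y (theta j - INR i))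
  (fun j y => c j * falling (theta j) i.+1 * Rpower y (theta j - INR i.+1))) => j hj.
have -> : c j * falling (theta j) i.+1 * Rpower x (theta j - INR i.+1) =
    (c j * falling (theta j) i) * ((theta j - INR i) * Rpower x (theta j - INR i - 1)).
  by rewrite S_INR /= (_ : theta j - (INR i + 1) = theta j - INR i - 1); ring.
by apply: derivable_pt_lim_scal; apply: derivable_pt_lim_power.
Qed.

(* Beyond the largest exponent only the non-integral exponents survive in the
   derivative, and the largest of those dominates. *)
Lemma power_sum_deriv_main i : (forall j, (j < d)%N -> theta j < INR i) ->
  for_large (fun M => forall c D x, 0 < D -> 0 < x -> M <= D * x ->
    (forall j, (j < t)%N ->
       Rabs (c j) <= alpha j / alpha t * Rpower D (theta j - theta t) * Rabs (c t)) ->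
    Rabs (power_sum_deriv c i x - c t * falling (theta t) i * Rpower x (theta t - INR i)) <=
    / 2 * (Rabs (c t) * Rabs (falling (theta t) i) * Rpower x (theta t - INR i))).
Proof.
move=> hi; set ff := Rabs (falling (theta t) i).
have ffp : 0 < ff by apply: Rabs_pos_lt; apply: falling_neq0.
have dp : 0 < INR d by apply: lt_0_INR; lia.
have at0 := alpha_gt0 td.
(* Each of the fewer than [d] smaller exponents is allotted a share [1 / (2 d)] of the main term. *)
have h1 : for_large (fun M => forall j, (j < t)%N ->
    alpha j / alpha t * Rabs (falling (theta j) i) * Rpower M (theta j - theta t) <= ff / (2 * INR d)).
  apply: for_large_all => j hj.
  have := for_large_and (for_large_ge 1) (@for_large_pow (alpha j / alpha t * Rabs (falling (theta j) i) * / (ff / (2 * INR d))) (theta j - theta t) 0 ltac:(have := theta_lt hj; lra)).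
  apply: for_large_mono => M [M1]; rewrite Rpower_O; last lra.
  move=> h; have q0 : 0 < ff / (2 * INR d).
    by apply: Rmult_lt_0_compat => //; apply: Rinv_0_lt_compat; lra.
  have := Rmult_le_compat_r _ _ _ (Rlt_le _ _ q0) h; rewrite Rmult_1_l; apply: Rle_trans.
  by apply: Req_le; field; repeat split; lra.
apply: for_large_mono (for_large_and (for_large_ge 1) h1) => M [M1 {}h1] c D x D0 x0 hM hc.
set xt := Rpower x (theta t - INR i); have xt0 : 0 < xt by apply: Rpower_gt0.
have tm F : \rsum_(0 <= j < d) F j = F t + \rsum_(0 <= j < d | j != t) F j.
  by rewrite (bigD1_seq t) //= ?mem_index_iota ?iota_uniq ?td.
rewrite /power_sum_deriv tm -/xt.
rewrite [X in Rabs X](_ : _ = \rsum_(0 <= j < d | j != t) (c j * falling (theta j) i * Rpower x (theta j - INR i))); last by ring.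
set E := Rabs (c t) * ff * xt.
have E0 : 0 <= E by apply: Rmult_le_pos; [apply: Rmult_le_pos; [apply: Rabs_pos|lra]|lra].
have abs_sum F P : Rabs (\rsum_(0 <= j < d | P j) F j) <= \rsum_(0 <= j < d | P j) Rabs (F j).
  apply: (big_ind2 (fun x y => Rabs x <= y)); first by rewrite Rabs_R0; lra.
    by move=> x1 x2 y1 y2 ? ?; have := Rabs_triang x1 y1; lra.
  by move=> j _; lra.
apply: Rle_trans (abs_sum _ _) _.
have -> : / 2 * E = INR (d - 0) * (E / (2 * INR d)) by rewrite subn0; field; lra.
apply: rsum_le_const.
  by apply: Rmult_le_pos => //; apply: Rlt_le; apply: Rinv_0_lt_compat; lra.
move=> j /andP[_ jd] jt.
have Ed : 0 <= E / (2 * INR d).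
  by apply: Rmult_le_pos => //; apply: Rlt_le; apply: Rinv_0_lt_compat; lra.
case: (ltnP j t) => hj; last first.
  have [z hz] := @theta_int j ltac:(lia).
  have z1 : (1 <= z)%Z by apply: le_IZR; rewrite -hz; apply: theta_ge1.
  have hzn : theta j = INR (Z.to_nat z) by rewrite hz INR_IZR_INZ Z2Nat.id //; lia.
  rewrite hzn falling_nat ?Rmult_0_r ?Rmult_0_l ?Rabs_R0 //.
  by apply/ltP; apply: INR_lt; rewrite -hzn; apply: hi.
rewrite !Rabs_mult (Rabs_pos_eq (Rpower _ _)); last by apply: Rlt_le; apply: Rpower_gt0.
have -> : Rpower x (theta j - INR i) = Rpower x (theta j - theta t) * xt.
  by rewrite /xt -Rpower_plus; congr Rpower; ring.
have hneg : theta j - theta t <= 0 by have := theta_lt hj; lra.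
have hDx : Rpower D (theta j - theta t) * Rpower x (theta j - theta t) <= Rpower M (theta j - theta t).
  by rewrite Rpower_mult_distr //; apply: Rpower_anti => //; lra.
have pD := Rpower_gt0 D (theta j - theta t); have px := Rpower_gt0 x (theta j - theta t).
have ff0 := Rabs_pos (falling (theta j) i); have ct0 := Rabs_pos (c t).
have aa : 0 < alpha j / alpha t by apply: Rmult_lt_0_compat; [apply: alpha_gt0|apply: Rinv_0_lt_compat].
have hcj := hc j hj; have hj1 := h1 j hj.
set fj := Rabs (falling _ _) in ff0 hj1 *; set Dj := Rpower D _ in hDx pD hcj.
set xj := Rpower x _ in hDx px *; set aj := alpha j / alpha t in aa hcj hj1.
set ct := Rabs (c t) in ct0 hcj E E0 Ed *.
apply: Rle_trans (_ : aj * Dj * ct * fj * (xj * xt) <= _).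
  by apply: Rmult_le_compat_r; [nra|apply: Rmult_le_compat_r].
apply: Rle_trans (_ : aj * fj * (Dj * xj) * (ct * xt) <= _); first by apply: Req_le; ring.
apply: Rle_trans (_ : ff / (2 * INR d) * (ct * xt) <= _).
  apply: Rmult_le_compat_r; first by nra.
  apply: Rle_trans hj1; apply: Rmult_le_compat_l => //; nra.
by apply: Req_le; rewrite /E; field; lra.
Qed.

Lemma Cmod_csum_expi_opp a b u :
  Cmod (\csum_(a <= n < b) expi (- u n)) = Cmod (\csum_(a <= n < b) expi (u n)).
Proof.
by rewrite -Cmod_conj csum_conj; congr Cmod; apply: eq_bigr => n _; rewrite expi_conj Ropp_involutive.
Qed.

(** [e j] stands for [D^theta_j] (type I) or [D^theta_j - r^theta_j] with [r < D] (type II).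
    [vdc_interval] is applied with [A = M / D] and with [T] the size at [A] of the term of index
    [t]. The bound on [D] keeps [A] above [M^(1/4) / 2]; the upper bound on [beta] makes the block
    length [Y] at least [M^sg], the lower bound makes it at most [A]. *)
Lemma power_sum_exp_bound : exists rho, 0 < rho /\ for_large (fun M => forall D beta e a b,
  1 <= D <= 2 * Rpower M (3 / 4) -> Rpower M (- / 16) <= Rabs beta <= Rpower M (/ 16) ->
  (forall j, (j <= t)%N -> 0 <= e j <= Rpower D (theta j - theta t) * e t) ->
  Rpower D (theta t - 1) <= e t <= Rpower D (theta t) ->
  (forall n, (a <= n < b)%N -> M <= D * INR n <= 2 * M) ->
  Cmod (\csum_(a <= n < b) expi (beta *
    \rsum_(0 <= j < d) (alpha j * e j * Rpower (INR n) (theta j)))%R) <= M / D * Rpower M (- rho)).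
Proof.
have [B hB] : exists B, 1 <= B /\ forall j, (j < d)%N -> theta j <= B.
  have [B hB] := for_large_and (for_large_ge 1) (@for_large_all d (fun j M => theta j <= M) (fun j _ => for_large_ge _)).
  by exists B; apply: hB; lra.
(* [k] must exceed all exponents, and [(k + 1) / 4] must exceed [1 + theta t + 1/16], so that
   [(M^(1/4) / 2)^(k + 1)] outgrows [M T]. *)
have [k' [_ hk']] := @nat_floor (4 * B + 8) ltac:(lra).
have {hk' k'} [k hk] : exists k, 4 * B + 8 <= INR k by exists k'.+1; rewrite S_INR; lra.
have [B1 {}hB] := hB.
have tt1 := theta_ge1 td; have ttB := hB t td; have at0 := alpha_gt0 td.
pose F1 := Rabs (falling (theta t) k.+1); pose F2 := Rabs (falling (theta t) k.+2).
have F1p : 0 < F1 by apply: Rabs_pos_lt; apply: falling_neq0.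
have F2p : 0 < F2 by apply: Rabs_pos_lt; apply: falling_neq0.
pose w := Rpower 2 (theta t - INR k.+1).
have w0 : 0 < w by apply: Rpower_gt0.
have kS : INR k.+1 = INR k + 1 by rewrite S_INR.
have w1 : w <= 1 by rewrite -(Rpower_O 2); [apply: Rle_Rpower; lra|lra].
pose c1 := F1 / 2 * w; pose c2 := 3 / 2 * F1; pose c3 := 3 / 2 * F2.
have c1p : 0 < c1 by apply: Rmult_lt_0_compat; lra.
have c12 : c1 <= c2 by rewrite /c1 /c2; nra.
have c2p : 0 < c2 by lra.
have c30 : 0 <= c3 by rewrite /c3; lra.
have [C [C0 hC]] := @vdc_interval k c1 c2 c3 (conj c1p c12) c30.
pose sg := / (INR k + / 2); have sg0 : 0 < sg by apply: Rinv_0_lt_compat; lra.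
have sgk : sg * (INR k + / 2) = 1 by rewrite /sg Rinv_l; lra.
pose m := INR (2 ^ k); have m0 : 0 < m by apply: lt_0_INR; have : (0 < 2 ^ k)%N by [rewrite expn_gt0]; lia.
(* [C l^k / Y^(1/2)] is at most [M^(-sg/4)]; its root of order [m = 2 ^ k] is [M^(-2 rho)], and half
   of this exponent pays for the factor 3. *)
pose rho := sg / 4 / m / 2.
have im0 : 0 < / m by apply: Rinv_0_lt_compat.
have rho0 : 0 < rho by rewrite /rho /Rdiv; apply: Rmult_lt_0_compat; [apply: Rmult_lt_0_compat; lra|lra].
exists rho; split=> //.
have i1 j : (j < d)%N -> theta j < INR k.+1 by move=> /hB; lra.
have i2 j : (j < d)%N -> theta j < INR k.+2 by move=> /hB; rewrite S_INR; lra.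
have E1 := power_sum_deriv_main i1; have E2 := power_sum_deriv_main i2.
have E3 := for_large_ln C k (_ : 0 < sg / 4).
have E4 := @for_large_pow 3 (- (2 * rho)) (- rho) ltac:(lra).
have E5 := @for_large_const (/ (c2 * alpha t)) (/ 16) ltac:(lra).
have E6 := @for_large_pow (2 ^ k.+1 * (2 * c2 * alpha t)) (1 + (theta t + / 16)) (INR k.+1 / 4) ltac:(lra).
have E7 := @for_large_const 2 sg sg0.
have := for_large_and E1 (for_large_and E2 (for_large_and (E3 ltac:(lra)) (for_large_and E4
  (for_large_and E5 (for_large_and E6 (for_large_and E7 (for_large_ge 1))))))).
apply: for_large_mono => M [{}E1 [{}E2 [{}E3 [{}E4 [{}E5 [{}E6 [{}E7 M1]]]]]]].
move=> D beta e a b [D1 DM] [b1 b2] he [et1 et2] hab.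
pose A := M / D; have A0 : 0 < A by apply: Rmult_lt_0_compat; [lra|apply: Rinv_0_lt_compat; lra].
have DA : D * A = M by rewrite /A; field; lra.
have M14 : Rpower M (/ 4) / 2 <= A.
  have e1 : Rpower M (/ 4) * Rpower M (3 / 4) = M.
    by rewrite -Rpower_plus (_ : / 4 + 3 / 4 = 1) ?Rpower_1; lra.
  have p1 := Rpower_gt0 M (/ 4); have p2 := Rpower_gt0 M (3 / 4).
  apply: (Rmult_le_reg_r (2 * Rpower M (3 / 4))); first lra.
  have -> : Rpower M (/ 4) / 2 * (2 * Rpower M (3 / 4)) = D * A by rewrite DA -[RHS]e1; field.
  nra.
have et0 : 0 < e t by have := Rpower_gt0 D (theta t - 1); lra.
have bet0 : 0 < Rabs beta by have := Rpower_gt0 M (- / 16); lra.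
pose ct := Rabs beta * alpha t * e t.
have ct0 : 0 < ct by apply: Rmult_lt_0_compat => //; apply: Rmult_lt_0_compat.
pose T := ct * Rpower A (theta t).
have T0 : 0 < T by apply: Rmult_lt_0_compat => //; apply: Rpower_gt0.
have Tup : T <= alpha t * Rpower M (theta t + / 16).
  have -> : Rpower M (theta t + / 16) = Rpower M (/ 16) * (Rpower D (theta t) * Rpower A (theta t)).
    by rewrite Rpower_mult_distr ?DA -?Rpower_plus; try lra; congr Rpower; ring.
  have pA := Rpower_gt0 A (theta t).
  have -> : T = alpha t * (Rabs beta * (e t * Rpower A (theta t))) by rewrite /T /ct; ring.
  apply: Rmult_le_compat_l; first lra.
  apply: Rmult_le_compat => //; [lra|nra|].
  by apply: Rmult_le_compat_r; lra.
have Tlow : alpha t * Rpower M (- / 16) * A <= T.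
  have pA := Rpower_gt0 A (theta t - 1); have pM := Rpower_gt0 M (- / 16).
  have eA : Rpower A (theta t) = Rpower A (theta t - 1) * A.
    by rewrite -{3}(Rpower_1 A) // -Rpower_plus; congr Rpower; ring.
  have -> : T = alpha t * (Rabs beta * (e t * Rpower A (theta t - 1))) * A by rewrite /T /ct eA; ring.
  apply: Rmult_le_compat_r; first lra.
  apply: Rmult_le_compat_l; first lra.
  rewrite -[X in X <= _]Rmult_1_r; apply: Rmult_le_compat => //; try lra.
  apply: Rle_trans (_ : Rpower D (theta t - 1) * Rpower A (theta t - 1) <= _).
    by rewrite Rpower_mult_distr ?DA; [apply: Rpower_ge1| |]; lra.
  by apply: Rmult_le_compat_r; lra.
have AhA : Rpower A (/ 2) * Rpower A (/ 2) = A.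
  by rewrite -Rpower_plus (_ : / 2 + / 2 = 1) ?Rpower_1; lra.
have Ah0 := Rpower_gt0 A (/ 2).
have Ah : Rpower M (/ 8) / 2 <= Rpower A (/ 2).
  apply: Rnot_lt_le => hlt.
  have e8 : Rpower M (/ 8) * Rpower M (/ 8) = Rpower M (/ 4) by rewrite -Rpower_plus; congr Rpower; field.
  have p8 := Rpower_gt0 M (/ 8); nra.
have AT : Rpower A (/ 2) <= 2 * c2 * T.
  have e16 : Rpower M (- / 16) * Rpower M (/ 8) = Rpower M (/ 16) by rewrite -Rpower_plus; congr Rpower; field.
  have p16 := Rpower_gt0 M (- / 16); have p8 := Rpower_gt0 M (/ 8).
  have ca : 0 < c2 * alpha t by apply: Rmult_lt_0_compat.
  have h1 : 1 <= c2 * alpha t * Rpower M (/ 16).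
    have := Rmult_le_compat_l _ _ _ (Rlt_le _ _ ca) E5; rewrite Rinv_r; lra.
  apply: Rle_trans (_ : 2 * c2 * (alpha t * Rpower M (- / 16) * A) <= _); last first.
    by apply: Rmult_le_compat_l; lra.
  have -> : 2 * c2 * (alpha t * Rpower M (- / 16) * A) =
     (c2 * alpha t) * Rpower M (- / 16) * (2 * Rpower A (/ 2)) * Rpower A (/ 2) by rewrite -{1}AhA; ring.
  have : c2 * alpha t * Rpower M (- / 16) * Rpower M (/ 8) <= c2 * alpha t * Rpower M (- / 16) * (2 * Rpower A (/ 2)).
    by apply: Rmult_le_compat_l; [nra|lra].
  have -> : c2 * alpha t * Rpower M (- / 16) * Rpower M (/ 8) = c2 * alpha t * Rpower M (/ 16) by rewrite -e16; ring.
  by move=> h2; nra.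
(* The relation demanded of [Y] has the solution [Q^sg]. So [Y >= M^sg] amounts to [Q >= M], and
   [Y <= A] to [A^(1/2) <= 2 c2 T]. *)
pose Q := A ^ k.+1 / (2 * c2 * T).
have cT : 0 < 2 * c2 * T by apply: Rmult_lt_0_compat; lra.
have Ak0 : 0 < A ^ k.+1 by apply: pow_lt.
have Q0 : 0 < Q by apply: Rmult_lt_0_compat => //; apply: Rinv_0_lt_compat.
have QM : M <= Q.
  apply: (Rmult_le_reg_r (2 * c2 * T)) => //.
  have -> : Q * (2 * c2 * T) = A ^ k.+1 by rewrite /Q; field; split; lra.
  have p2 : 0 < 2 ^ k.+1 by apply: pow_lt; lra.
  apply: Rle_trans (pow_incr (Rpower M (/ 4) / 2) A k.+1 _); last first.
    by split=> //; have := Rpower_gt0 M (/ 4); lra.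
  rewrite /Rdiv Rpow_mult_distr pow_inv -Rpower_pow ?Rpower_mult; last exact: Rpower_gt0.
  apply: (Rmult_le_reg_r (2 ^ k.+1)) => //.
  rewrite Rmult_assoc [X in _ <= X]Rmult_assoc Rinv_l ?Rmult_1_r; last lra.
  rewrite (_ : / 4 * INR k.+1 = INR k.+1 / 4); last by field.
  apply: Rle_trans E6.
  rewrite Rpower_plus Rpower_1; last lra.
  set R1 := Rpower _ _ in Tup *.
  have h : M * (2 ^ k.+1 * (2 * c2)) * T <= M * (2 ^ k.+1 * (2 * c2)) * (alpha t * R1).
    by apply: Rmult_le_compat_l => //; apply: Rmult_le_pos; [lra|nra].
  by nra.
pose Y := Rpower Q sg.
have YM : Rpower M sg <= Y by apply: Rle_Rpower_l; lra.
have YA : Y <= A.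
  have -> : A = Rpower (Rpower A (INR k + / 2)) sg by rewrite Rpower_mult Rmult_comm sgk Rpower_1.
  apply: Rle_Rpower_l; first lra.
  split=> //; apply: (Rmult_le_reg_r (2 * c2 * T)) => //.
  have -> : Q * (2 * c2 * T) = A ^ k.+1 by rewrite /Q; field; split; lra.
  have -> : A ^ k.+1 = Rpower A (INR k + / 2) * Rpower A (/ 2).
    by rewrite -Rpower_pow // kS -Rpower_plus; congr Rpower; field.
  by apply: Rmult_le_compat_l => //; apply: Rlt_le; apply: Rpower_gt0.
have hY : Rpower Y (INR k + / 2) * (2 * c2 * T) = A ^ k.+1.
  by rewrite Rpower_mult sgk Rpower_1 // /Q; field; split; lra.
have A1 : 1 <= A by lra.
have AM : A <= M by rewrite -DA; nra.
have hl : 1 + ln A <= 1 + ln M by apply: Rplus_le_compat_l; apply: ln_mono.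
(* The sign makes the derivative of order [k + 1] positive; by conjugation it does not change the
   modulus of the sum. *)
have [s [hs hsp]] : exists s, (s = 1 \/ s = -1) /\ 0 < s * beta * falling (theta t) k.+1.
  have hne : beta * falling (theta t) k.+1 <> 0.
    apply: Rmult_integral_contrapositive_currified; last exact: falling_neq0.
    by move=> hb0; move: bet0; rewrite hb0 Rabs_R0; lra.
  case: (Rlt_dec 0 (beta * falling (theta t) k.+1)) => h; first by exists 1; split; [left|lra].
  by exists (-1); split; [right|lra].
have hsa : Rabs s = 1 by case: hs => ->; [rewrite Rabs_R1|rewrite Rabs_left]; lra.
pose c j := s * beta * (alpha j * e j).
have -> : Cmod (\csum_(a <= n < b) expi (beta *
    \rsum_(0 <= j < d) (alpha j * e j * Rpower (INR n) (theta j)))%R) =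
   Cmod (\csum_(a <= n < b) expi (power_sum_deriv c 0 (INR n))).
  pose u n := beta * \rsum_(0 <= j < d) (alpha j * e j * Rpower (INR n) (theta j)).
  have hg n : power_sum_deriv c 0 (INR n) = s * u n.
    rewrite /power_sum_deriv /u -Rmult_assoc rsum_mull; apply: eq_bigr => j _.
    by rewrite /c /= INR_0 Rminus_0_r; ring.
  rewrite -/(u _); case: hs => hs.
    by congr Cmod; apply: eq_bigr => n _; rewrite hg hs Rmult_1_l.
  rewrite -Cmod_csum_expi_opp; congr Cmod; apply: eq_bigr => n _; rewrite hg hs.
  by congr expi; rewrite /u; ring.
have cct : Rabs (c t) = ct.
  by rewrite /c /ct !Rabs_mult hsa (Rabs_pos_eq (alpha t)) ?(Rabs_pos_eq (e t)); lra.
have hcj j : (j < t)%N -> Rabs (c j) <= alpha j / alpha t * Rpower D (theta j - theta t) * Rabs (c t).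
  move=> jt; have aj0 : 0 < alpha j by apply: alpha_gt0; lia.
  have [e0 e1] := he j ltac:(lia).
  rewrite cct /c /ct !Rabs_mult hsa (Rabs_pos_eq (alpha j)) ?(Rabs_pos_eq (e j)); try lra.
  have -> : alpha j / alpha t * Rpower D (theta j - theta t) * (Rabs beta * alpha t * e t) =
    1 * Rabs beta * (alpha j * (Rpower D (theta j - theta t) * e t)) by field; lra.
  apply: Rmult_le_compat_l; first lra.
  by apply: Rmult_le_compat_l; lra.
have hD0 : 0 < D by lra.
have xD x : A <= x <= 2 * A -> M <= D * x by move=> hx; rewrite -DA; apply: Rmult_le_compat_l; lra.
have powA i : Rpower A (theta t - INR i) = Rpower A (theta t) / A ^ i.
  by rewrite /Rminus Rpower_plus Rpower_Ropp Rpower_pow.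
have xpow x i : A <= x <= 2 * A -> theta t <= INR i -> Rpower x (theta t - INR i) <= Rpower A (theta t) / A ^ i.
  by move=> hx hi; rewrite -powA; apply: Rpower_anti; lra.
have G1 x : A <= x <= 2 * A ->
    c1 * T / A ^ k.+1 <= power_sum_deriv c k.+1 x <= c2 * T / A ^ k.+1.
  move=> hx; have := E1 c D x hD0 ltac:(lra) (xD x hx) hcj.
  rewrite -/F1 cct; set X := Rpower x _.
  have X1 : X <= Rpower A (theta t) / A ^ k.+1 by apply: xpow; lra.
  have X2 : w * (Rpower A (theta t) / A ^ k.+1) <= X.
    by rewrite -powA /w Rpower_mult_distr; [apply: Rpower_anti| |]; lra.
  have -> : c t * falling (theta t) k.+1 * X = ct * F1 * X.
    congr (_ * _); rewrite /F1 -cct -Rabs_mult Rabs_pos_eq //.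
    have -> : c t * falling (theta t) k.+1 = (s * beta * falling (theta t) k.+1) * (alpha t * e t) by rewrite /c; ring.
    by apply: Rmult_le_pos; [lra|nra].
  move=> h; have [h1 h2] := proj1 (Rcomplements.Rabs_le_between _ _) h.
  have -> : c1 * T / A ^ k.+1 = / 2 * (ct * F1) * (w * (Rpower A (theta t) / A ^ k.+1)).
    by rewrite /c1 /T /Rdiv; field; lra.
  have -> : c2 * T / A ^ k.+1 = 3 / 2 * (ct * F1) * (Rpower A (theta t) / A ^ k.+1).
    by rewrite /c2 /T /Rdiv; field; lra.
  have q0 : 0 < ct * F1 by apply: Rmult_lt_0_compat.
  have := Rmult_le_compat_l _ _ _ (Rlt_le _ _ q0) X1.
  have := Rmult_le_compat_l _ _ _ (Rlt_le _ _ q0) X2.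
  by split; lra.
have G2 x : A <= x <= 2 * A -> Rabs (power_sum_deriv c k.+2 x) <= c3 * T / A ^ k.+2.
  move=> hx; have := E2 c D x hD0 ltac:(lra) (xD x hx) hcj.
  rewrite -/F2 cct; set X := Rpower x _.
  have X1 : X <= Rpower A (theta t) / A ^ k.+2 by apply: xpow => //; rewrite S_INR; lra.
  have X0 : 0 < X by apply: Rpower_gt0.
  have -> : c3 * T / A ^ k.+2 = 3 / 2 * (ct * F2) * (Rpower A (theta t) / A ^ k.+2).
    by rewrite /c3 /T /Rdiv; ring.
  have hm : Rabs (c t * falling (theta t) k.+2 * X) = ct * F2 * X.
    by rewrite (Rabs_mult _ X) (Rabs_mult (c t)) cct -/F2 (Rabs_pos_eq X) //; lra.
  set y := power_sum_deriv c k.+2 x; set y0 := c t * _ * X in hm *.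
  have := Rabs_triang (y - y0) y0; rewrite (_ : y - y0 + y0 = y); last by ring.
  have q0 : 0 < ct * F2 by apply: Rmult_lt_0_compat.
  have := Rmult_le_compat_l _ _ _ (Rlt_le _ _ q0) X1.
  lra.
have habA n : (a <= n < b)%N -> A <= INR n <= 2 * A.
  move=> /hab [h1 h2]; split; apply: (Rmult_le_reg_l D) => //; lra.
have dg i x : A <= x <= 2 * A -> derivable_pt_lim (power_sum_deriv c i) x (power_sum_deriv c i.+1 x).
  by move=> hx; apply: power_sum_derivP; lra.
apply: Rle_trans (hC A T Y (1 + ln M) (power_sum_deriv c) a b A1 T0 (conj _ YA) hY hl dg G1 G2 habA) _.
  by lra.
rewrite -/A -/m.
have Yh : Rpower M (sg / 2) <= Rpower Y (/ 2).
  by rewrite (_ : sg / 2 = sg * / 2) // -Rpower_mult; apply: Rle_Rpower_l; [lra|split=> //; apply: Rpower_gt0].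
have hZ : C * (1 + ln M) ^ k / Rpower Y (/ 2) <= Rpower M (- (sg / 4)).
  apply: (Rmult_le_reg_r (Rpower Y (/ 2))); first exact: Rpower_gt0.
  rewrite /Rdiv Rmult_assoc Rinv_l ?Rmult_1_r; last by have := Rpower_gt0 Y (/ 2); lra.
  apply: Rle_trans E3 _.
  have -> : sg / 4 = - (sg / 4) + sg / 2 by field.
  rewrite Rpower_plus; apply: Rmult_le_compat_l => //.
  by apply: Rlt_le; apply: Rpower_gt0.
have Z0 : 0 < C * (1 + ln M) ^ k / Rpower Y (/ 2).
  apply: Rmult_lt_0_compat; last by apply: Rinv_0_lt_compat; apply: Rpower_gt0.
  by apply: Rmult_lt_0_compat => //; apply: pow_lt; have := ln_ge0 M1; lra.
apply: Rle_trans (_ : 3 * A * Rpower M (- (2 * rho)) <= _).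
  apply: Rmult_le_compat_l; first lra.
  have -> : Rpower M (- (2 * rho)) = Rpower (Rpower M (- (sg / 4))) (/ m).
    by rewrite Rpower_mult; congr Rpower; rewrite /rho; field; lra.
  by apply: Rle_Rpower_l; lra.
rewrite (_ : 3 * A * Rpower M (- (2 * rho)) = A * (3 * Rpower M (- (2 * rho)))); last by ring.
by apply: Rmult_le_compat_l; lra.
Qed.

(** * Exponential sums over primes *)

Definition power_sum (x : R) : R := \rsum_(0 <= j < d) (alpha j * Rpower x (theta j)).

Lemma power_sum_mul D n : (0 < D)%N -> (0 < n)%N -> power_sum (INR (D * n)) =
  \rsum_(0 <= j < d) (alpha j * Rpower (INR D) (theta j) * Rpower (INR n) (theta j)).
Proof.
move=> D0 n0; apply: eq_bigr => j _; rewrite mult_INR -Rpower_mult_distr; first by ring.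
  by apply: lt_0_INR; lia.
by apply: lt_0_INR; lia.
Qed.

(** Vaughan's bound with [U] near [M^(1/2)] and [V] near [M^(1/4)]: type I has [D <= U V], type II
    has [D < 2 M / U], so both stay within [D <= 2 M^(3/4)], and [8 / V] is itself a power
    saving. *)
Lemma mangoldt_exp_sum_bound : exists rho, 0 < rho /\ exists M0, forall M : nat, M0 <= INR M ->
  forall beta, Rpower (INR M) (- / 16) <= Rabs beta <= Rpower (INR M) (/ 16) ->
  Cmod (\csum_(M <= n < 2 * M) (RtoC (mangoldt n) * expi (beta * power_sum (INR n))%R)) <=
  INR M * Rpower (INR M) (- rho).
Proof.
have [rho1 [rho1p hW]] := power_sum_exp_bound.
pose rho := Rmin rho1 (/ 4).
have rhop : 0 < rho by apply: Rmin_pos; lra.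
have rho_1 : rho <= rho1 by apply: Rmin_l.
have rho_2 : rho <= / 4 by apply: Rmin_r.
exists (rho / 4); split; first lra.
have := for_large_and hW (for_large_and (@for_large_const 4 (/ 4) ltac:(lra))
  (for_large_and (@for_large_ln 136 4 (rho / 4) ltac:(lra)) (for_large_ge 10))).
move=> [M0 hM0]; exists M0 => M hM beta hbeta.
have {M0 hM0 hM hW} [hW [M4 [Mln M10]]] := hM0 _ hM.
have Mp : 0 < INR M by lra.
have eM a b : Rpower (INR M) a * Rpower (INR M) b = Rpower (INR M) (a + b) by rewrite Rpower_plus.
have M1 : INR M = Rpower (INR M) 1 by rewrite Rpower_1.
have q2 : Rpower (INR M) (/ 2) = Rpower (INR M) (/ 4) * Rpower (INR M) (/ 4) by rewrite eM; congr Rpower; field.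
have q34 : Rpower (INR M) (3 / 4) = Rpower (INR M) (/ 2) * Rpower (INR M) (/ 4) by rewrite eM; congr Rpower; field.
have q1 : INR M = Rpower (INR M) (/ 2) * Rpower (INR M) (/ 2) by rewrite eM {1}M1; congr Rpower; field.
set x := Rpower (INR M) (/ 4) in M4 q2 q34.
set y := Rpower (INR M) (/ 2) in q2 q34 q1.
have [U [U1 U2]] := @nat_floor y ltac:(nra).
have [V [V1 V2]] := @nat_floor x ltac:(lra).
pose L := (trunc_log 2 (2 * M)).+1.
have Mn : (0 < M)%N by apply/ltP; apply: INR_lt; rewrite INR_0.
have hL : (2 * M <= 2 ^ L)%N by apply: ltnW; apply: trunc_log_ltn.
have lnM := ln_ge0 (_ : 1 <= INR M).
have ln2M : ln (INR (2 * M)) <= 1 + ln (INR M).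
  rewrite mult_INR ln_mult; [|rewrite /INR; lra|lra].
  by have := @ln_le_sub1 (INR 2) ltac:(rewrite /INR; lra); rewrite /INR -/(INR M); lra.
have LL : INR L <= 3 * (1 + ln (INR M)).
  rewrite /L S_INR; set l := trunc_log _ _.
  have h1 : (2 ^ l <= 2 * M)%N by apply: trunc_logP => //; lia.
  have h2 : INR (2 ^ l)%N = 2 ^ l.
    by elim: (l) => [|k IH]; [rewrite expn0|rewrite expnS mult_INR IH].
  have : ln (2 ^ l) <= ln (INR (2 * M)).
    by apply: ln_mono; [apply: pow_lt; lra|rewrite -h2; apply: le_INR; lia].
  rewrite ln_pow; last lra.
  have := ln_lt_2; have := pos_INR l; have := lnM ltac:(lra); nra.
have lt_of (a b : nat) : INR a < INR b -> (a < b)%N by move=> h; apply/ltP; apply: INR_lt.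
have E0 : 0 <= Rpower (INR M) (- rho1) by apply: Rlt_le; apply: Rpower_gt0.
have y16 : 16 <= y by nra.
have UV : INR U * INR V <= 2 * Rpower (INR M) (3 / 4).
  by rewrite q34; have := pos_INR U; have := pos_INR V; nra.
pose F n := expi (beta * power_sum (INR n)).
have pos n : (0 < n)%N -> 0 < INR n by move=> h; apply: lt_0_INR; lia.
have := @vaughan_bound M U V L F (Rpower (INR M) (- rho1)) _ _ _ _ hL E0 _ _ _.
move=> h; apply: Rle_trans (h _ _ _ _ _ _ _) _ => {h}.
- by apply: lt_of; nra.
- by apply: lt_of; rewrite INR_0; lra.
- by apply: lt_of; rewrite INR_0; lra.
- by apply: lt_of; nra.
- by move=> n; rewrite Cmod_expi; lra.
- move=> D a b hD hab.
  have Dp := pos D ltac:(lia); have D1 : 1 <= INR D by apply: (le_INR 1); lia.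
  have DUV : INR D <= INR U * INR V by rewrite -mult_INR; apply: le_INR; lia.
  have := hW (INR D) beta (fun j => Rpower (INR D) (theta j)) a b _ hbeta _ _ _.
  rewrite (@eq_big_nat _ _ _ a b _ (fun n => F (D * n)%N)) => [h|n hn]; last first.
    by rewrite /F power_sum_mul //; [lia|have := hab n hn; nia].
  apply: h; first lra.
  - move=> j hj; split; first by apply: Rlt_le; apply: Rpower_gt0.
    by apply: Req_le; rewrite -Rpower_plus; congr Rpower; ring.
  - by split; [apply: Rle_Rpower; lra|lra].
  move=> n /hab hn; rewrite -mult_INR -(mult_INR 2).
  by split; apply: le_INR; lia.
- move=> d' c1 c2 a b d0 hc hU hab.
  set D := (c1 * d')%N; set r := (c2 * d')%N.
  have r0 : (0 < r)%N by rewrite /r; nia.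
  have rD : (r.+1 <= D)%N by rewrite /r /D; nia.
  have rp := pos r r0; have Dp := pos D ltac:(lia); have D1 : 1 <= INR D by apply: (le_INR 1); lia.
  have rD' : INR r + 1 <= INR D by rewrite -S_INR; apply: le_INR; lia.
  have DU : INR D * INR U < 2 * INR M.
    by rewrite -(mult_INR 2) -mult_INR; apply: lt_INR; apply/ltP.
  have D34 : INR D <= 2 * Rpower (INR M) (3 / 4).
    rewrite q34; apply: Rnot_lt_le => hlt.
    have : y / 2 <= INR U by lra.
    by move=> hy; nra.
  have := hW (INR D) beta (fun j => Rpower (INR D) (theta j) - Rpower (INR r) (theta j)) a b _ hbeta _ _ _.
  rewrite (@eq_big_nat _ _ _ a b _ (fun n => F (D * n)%N * Cconj (F (r * n)%N))%C) => [h|n hn]; last first.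
    have n0 : (0 < n)%N by have := hab n hn; nia.
    rewrite /F expi_conj -expiD; congr expi.
    rewrite !power_sum_mul //; last by lia.
    rewrite !rsum_mull.
    transitivity (\rsum_(0 <= j < d) ((beta * (alpha j * Rpower (INR D) (theta j) * Rpower (INR n) (theta j))) +
      (-1) * (beta * (alpha j * Rpower (INR r) (theta j) * Rpower (INR n) (theta j))))).
      by apply: eq_bigr => j _; ring.
    by rewrite big_split /= -(rsum_mull (-1)); ring.
  apply: h => //.
  - move=> j hj.
    have jt : theta j <= theta t.
      by move: hj; rewrite leq_eqVlt => /orP[/eqP->|/theta_lt]; lra.
    have tj1 := theta_ge1 (_ : j < d)%N.
    split.
      have tj0 : 0 <= theta j by have := tj1 ltac:(lia); lra.
      have rD2 : 0 < INR r <= INR D by split; lra.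
      by have := Rle_Rpower_l _ _ _ tj0 rD2; lra.
    (* What remains is [D^(theta_j - theta_t) r^theta_t <= r^theta_j], true because [r < D] and
       [theta_j <= theta_t]. *)
    rewrite Rmult_minus_distr_l -Rpower_plus (_ : theta j - theta t + theta t = theta j); last by ring.
    apply: Rplus_le_compat_l; apply: Ropp_le_contravar.
    have -> : Rpower (INR r) (theta t) = Rpower (INR r) (theta t - theta j) * Rpower (INR r) (theta j).
      by rewrite -Rpower_plus; congr Rpower; ring.
    have p1 := Rpower_gt0 (INR r) (theta j).
    have h1 : Rpower (INR D) (theta j - theta t) * Rpower (INR r) (theta t - theta j) <= 1.
      have e1 : Rpower (INR D) (theta j - theta t) * Rpower (INR D) (theta t - theta j) = 1.
        by rewrite -Rpower_plus (_ : theta j - theta t + (theta t - theta j) = 0) ?Rpower_O //; ring.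
      rewrite -e1; apply: Rmult_le_compat_l; first by apply: Rlt_le; apply: Rpower_gt0.
      by apply: Rle_Rpower_l; lra.
    by rewrite -Rmult_assoc; nra.
  - have tt1 := theta_ge1 td.
    split; last by have := Rpower_gt0 (INR r) (theta t); lra.
    (* As [r <= D - 1], [D^theta - r^theta >= (D - r) D^(theta - 1) >= D^(theta - 1)]. *)
    have eD z : 0 < z -> Rpower z (theta t) = z * Rpower z (theta t - 1).
      by move=> z0; rewrite -{2}(Rpower_1 z) // -Rpower_plus; congr Rpower; ring.
    rewrite !eD //.
    have := @Rle_Rpower_l (INR r) (INR D) (theta t - 1) ltac:(lra) ltac:(lra).
    have := Rpower_gt0 (INR r) (theta t - 1); nra.
  move=> n /hab hn; rewrite -mult_INR -(mult_INR 2).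
  by split; apply: le_INR; rewrite /D; lia.
rewrite Rmult_assoc; apply: Rmult_le_compat_l; first lra.
set l1 := 1 + ln (INR M) in ln2M LL Mln *.
have l1p : 1 <= l1 by rewrite /l1; have := lnM ltac:(lra); lra.
have l2 : 0 <= 1 + ln (INR (2 * M)) <= 2 * l1.
  split; last lra.
  by have := @ln_ge0 (INR (2 * M)) ltac:(rewrite mult_INR /INR -/(INR M); lra); lra.
set z := Rpower (INR M) (- (rho / 2)).
have z0 : 0 < z by apply: Rpower_gt0.
have zz : z * z = Rpower (INR M) (- rho) by rewrite eM; congr Rpower; field.
have z1 : z <= 1.
  by rewrite -(Rpower_O (INR M)) //; apply: Rle_Rpower; lra.
have Ez : Rpower (INR M) (- rho1) <= z * z by rewrite zz; apply: Rle_Rpower; lra.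
have Vz : 8 / INR V <= 16 * (z * z).
  have h1 : / x <= z * z.
    by rewrite zz /x -Rpower_Ropp; apply: Rle_Rpower; lra.
  have h2 : / INR V <= 2 * / x.
    have -> : 2 * / x = / (x / 2) by field; lra.
    by apply: Rinv_le_contravar; lra.
  by rewrite /Rdiv; lra.
have sz : sqrt (8 / INR V + 2 * Rpower (INR M) (- rho1)) <= 5 * z.
  rewrite -[X in _ <= X]sqrt_square; last lra.
  by apply: sqrt_le_1_alt; nra.
set sq := sqrt _ in sz *; have sq0 : 0 <= sq by apply: sqrt_pos.
have h3 : 2 * Rpower (INR M) (- rho1) + INR L * sq <= 17 * l1 * z.
  have a1 : INR L * sq <= 3 * l1 * (5 * z).
    by apply: Rmult_le_compat => //; apply: pos_INR.
  nra.
have h4 : (1 + ln (INR (2 * M))) ^ 3 <= (2 * l1) ^ 3 by apply: pow_incr.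
apply: Rle_trans (_ : (2 * l1) ^ 3 * (17 * l1 * z) <= _).
  apply: Rmult_le_compat => //; first by apply: pow_le; lra.
  by have := pos_INR L; nra.
have -> : (2 * l1) ^ 3 * (17 * l1 * z) = 136 * l1 ^ 4 * z by ring.
have -> : Rpower (INR M) (- (rho / 4)) = Rpower (INR M) (rho / 4) * z by rewrite /z eM; congr Rpower; field.
by apply: Rmult_le_compat_r; lra.
Qed.

Definition prime_weight n : R := if prime n then mangoldt n else 0.

(** The saving is relative to the weight of the block, whose lower bound loses a small power of [M].
    The condition [M >= N^(1/4)] converts powers of [M] into powers of [N]. *)
Definition exp_sum_saving (r N1 : R) : Prop := forall N : nat, N1 <= INR N ->
  exists M : nat, (0 < M)%N /\ (2 * M <= N)%N /\ Rpower (INR N) (/ 4) <= INR M /\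
  0 < \rsum_(M <= n < 2 * M) prime_weight n /\
  forall beta, Rpower (INR M) (- / 16) <= Rabs beta <= Rpower (INR M) (/ 16) ->
  Cmod (\csum_(M <= n < 2 * M) (RtoC (prime_weight n) * expi (beta * power_sum (INR n))%R)) <=
  (\rsum_(M <= n < 2 * M) prime_weight n) * Rpower (INR M) (- r).

(** A block weight of at least [M^(1 - rho/4)] turns the absolute saving [M^(-rho)] into the
    relative one [M^(-3 rho/4)]. The proper prime powers cost at most [M^(1 - rho)] once more, and
    the resulting factor 2 is paid by lowering the exponent to [rho / 2]. *)
Lemma prime_exp_sum_saving : exists r N1, 0 < r /\ exp_sum_saving r N1.
Proof.
have [rho1 [rho1p [M0 hM0]]] := mangoldt_exp_sum_bound.
pose rho := Rmin rho1 (/ 4).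
have rhop : 0 < rho by apply: Rmin_pos; lra.
have rho_1 : rho <= rho1 by apply: Rmin_l.
have rho_2 : rho <= / 4 by apply: Rmin_r.
have [K0 hK0] := @dyadic_primes (rho / 4) ltac:(lra).
have [M1 hM1] := for_large_and (for_large_ge M0) (for_large_and (for_large_ge 1)
  (for_large_and (@for_large_ln 4 2 (/ 4) ltac:(lra)) (@for_large_pow 2 (- (3 * rho / 4)) (- (rho / 2)) ltac:(lra)))).
have [X1 hX1] := for_large_and (@for_large_const M1 (/ 4) ltac:(lra)) (for_large_and (for_large_ge 16) (for_large_ge (INR (2 ^ K0)))).
exists (rho / 2), X1; split; [lra|move=> N hN].
have [h1 [h2 h3]] := hX1 _ hN.
have N0 : (0 < N)%N by apply/ltP; apply: INR_lt; rewrite INR_0; lra.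
set K := trunc_log 2 N.
have [KN NK] : (2 ^ K <= N)%N /\ (N < 2 ^ K.+1)%N by split; [apply: trunc_logP|apply: trunc_log_ltn].
have KK0 : (K0 <= K)%N.
  have : (2 ^ K0 < 2 ^ K.+1)%N by apply: leq_ltn_trans NK; apply/leP; apply: INR_le.
  by rewrite ltn_exp2l.
have [i [Ki [iK hTh]]] := hK0 K KK0.
set M := (2 ^ i)%N; have e2M : (2 * M = 2 ^ i.+1)%N by rewrite expnS.
have Mpos : (0 < M)%N by rewrite expn_gt0.
have MN : (2 * M <= N)%N by rewrite e2M; apply: leq_trans KN; rewrite leq_exp2l.
(* From [N < 2^(K + 1)] and [K <= 2 i + 1]; together with [N >= 16] this yields [M >= N^(1/4)]. *)
have M4N : INR N <= 4 * (INR M * INR M).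
  have -> : 4 = INR 4 by rewrite /INR; lra.
  rewrite -!mult_INR; apply: le_INR; apply/leP; apply: ltnW; apply: leq_trans NK _.
  by rewrite !multE -[4%N]/(2 ^ 2)%N -!expnD leq_exp2l //; lia.
have Mp : 0 < INR M by apply: lt_0_INR; lia.
set x := Rpower (INR N) (/ 4) in h1 *.
have x4 : INR N = (x * x) * (x * x).
  by rewrite /x -!Rpower_plus (_ : / 4 + / 4 + (/ 4 + / 4) = 1) ?Rpower_1; lra.
have x0 : 0 < x by apply: Rpower_gt0.
have xM : x <= INR M.
  have x2 : 2 <= x.
    apply: Rnot_lt_le => hlt; have xx : x * x < 4 by nra.
    by nra.
  apply: Rnot_lt_le => hlt; have MM : INR M * INR M < x * x by nra.
  have xx : 4 * (x * x) <= x * x * (x * x) by apply: Rmult_le_compat_r; nra.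
  lra.
exists M; split=> //; split=> //; split=> //.
have [g1 [g2 [g3 g4]]] := hM1 (INR M) ltac:(lra).
set W := \rsum_(M <= n < 2 * M) prime_weight n.
have WTh : W = \rsum_(2 ^ i <= n < 2 ^ i.+1 | prime n) mangoldt n by rewrite /W e2M [RHS]big_mkcond.
have pM a := Rpower_gt0 (INR M) a.
have Wlow : INR M * Rpower (INR M) (- (rho / 4)) <= W by rewrite WTh.
have W0 : 0 < W by apply: Rlt_le_trans Wlow; apply: Rmult_lt_0_compat.
split=> // beta hbeta.
set l := 1 + ln (INR M) in g3.
have l0 := ln_ge0 g2.
have np : \rsum_(M <= n < 2 * M | ~~ prime n) mangoldt n <= INR M * Rpower (INR M) (- rho).
  apply: Rle_trans (_ : \rsum_(1 <= n < 2 * M | ~~ prime n) mangoldt n <= _).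
    rewrite [X in _ <= X](@big_cat_nat _ _ _ M) //=; last by lia.
    have : 0 <= \rsum_(1 <= n < M | ~~ prime n) mangoldt n by apply: rsum_ge0 => n _ _; apply: mangoldt_ge0.
    lra.
  apply: Rle_trans (@sum_mangoldt_nonprime (2 * M) (2 ^ (i./2).+1) i.+1 _ _ _) _; rewrite ?e2M //.
  - by rewrite -expnM leq_exp2l //; lia.
  - by rewrite expn_gt0.
  rewrite -e2M mult_INR INR_2.
  have ln2M : ln (2 * INR M) <= l.
    by rewrite ln_mult; try lra; have := @ln_le_sub1 2 ltac:(lra); rewrite /l; lra.
  have hi : INR i.+1 <= 2 * l.
    have : ln (2 ^ i.+1) <= l by rewrite -INR_2 -INR_expn -e2M mult_INR INR_2.
    rewrite ln_pow; last lra.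
    by have := ln_lt_2; have := pos_INR i.+1; nra.
  have hs : INR (2 ^ (i./2).+1) <= 2 * Rpower (INR M) (/ 2).
    rewrite expnS mult_INR INR_2; apply: Rmult_le_compat_l; first lra.
    set y := INR _; have y0 : 0 < y by apply: lt_0_INR; have : (0 < 2 ^ i./2)%N by [rewrite expn_gt0]; lia.
    have hy : y * y <= INR M.
      by rewrite /y -mult_INR multE -expnD; apply: le_INR; apply/leP; rewrite leq_exp2l //; lia.
    have -> : y = Rpower (y * y) (/ 2).
      by rewrite -{2 3}(Rpower_1 y) // -Rpower_plus Rpower_mult (_ : (1 + 1) * / 2 = 1) ?Rpower_1 //; field.
    by apply: Rle_Rpower_l; [lra|split=> //; nra].
  have s0 := pos_INR (2 ^ (i./2).+1); have i0 := pos_INR i.+1.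
  have ll0 : 0 <= ln (2 * INR M) by apply: ln_ge0; lra.
  apply: Rle_trans (_ : 2 * Rpower (INR M) (/ 2) * (2 * l) * l <= _).
    apply: Rmult_le_compat => //; first by nra.
    exact: Rmult_le_compat.
  have -> : 2 * Rpower (INR M) (/ 2) * (2 * l) * l = 4 * l ^ 2 * Rpower (INR M) (/ 2) by ring.
  apply: Rle_trans (_ : Rpower (INR M) (/ 4) * Rpower (INR M) (/ 2) <= _).
    by apply: Rmult_le_compat_r => //; apply: Rlt_le.
  rewrite -{3}(Rpower_1 (INR M)) // -!Rpower_plus; apply: Rle_Rpower; lra.
have hS := hM0 M g1 beta hbeta.
have -> : \csum_(M <= n < 2 * M) (RtoC (prime_weight n) * expi (beta * power_sum (INR n))%R) =
   (\csum_(M <= n < 2 * M) (RtoC (mangoldt n) * expi (beta * power_sum (INR n))%R) +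
    RtoC (-1) * \csum_(M <= n < 2 * M | ~~ prime n) (RtoC (mangoldt n) * expi (beta * power_sum (INR n))%R))%C.
  rewrite csum_mull [X in (_ + X)%C]big_mkcond -big_split /=; apply: eq_bigr => n _.
  by rewrite /prime_weight; case: prime => /=; ring.
apply: Rle_trans (Cmod_triangle _ _) _.
rewrite Cmod_mult Cmod_R Rabs_left; last lra.
have h5 : Cmod (\csum_(M <= n < 2 * M | ~~ prime n) (RtoC (mangoldt n) * expi (beta * power_sum (INR n))%R)) <= INR M * Rpower (INR M) (- rho).
  apply: Rle_trans (Cmod_csum _ _ _ _) _; apply: Rle_trans np; apply: rsum_le => n _ _.
  by rewrite Cmod_mult Cmod_expi Cmod_R Rabs_pos_eq; [lra|apply: mangoldt_ge0].
have h6 : INR M * Rpower (INR M) (- rho1) <= INR M * Rpower (INR M) (- rho).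
  by apply: Rmult_le_compat_l; [lra|apply: Rle_Rpower; lra].
apply: Rle_trans (_ : INR M * (2 * Rpower (INR M) (- rho)) <= _); first by move: hS h5 h6; rewrite /power_sum; lra.
apply: Rle_trans (Rmult_le_compat_r _ _ _ (Rlt_le _ _ (pM _)) Wlow).
rewrite Rmult_assoc; apply: Rmult_le_compat_l; first lra.
have -> : Rpower (INR M) (- rho) = Rpower (INR M) (- (rho / 4)) * Rpower (INR M) (- (3 * rho / 4)).
  by rewrite -Rpower_plus; congr Rpower; field.
have := Rmult_le_compat_l _ _ _ (Rlt_le _ _ (pM (- (rho / 4)))) g4; lra.
Qed.

(** * Choice of the prime in the two cases *)

Lemma power_sum_growth : exists B Cf, 1 <= B /\ 0 < Cf /\
  forall x, 1 <= x -> 0 <= power_sum x <= Cf * Rpower x B.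
Proof.
have [B hB] := for_large_and (for_large_ge 1) (@for_large_all d (fun j M => theta j <= M) (fun j _ => for_large_ge _)).
have [B1 {}hB] := hB B ltac:(lra).
have a0 j : (0 <= j < d)%N -> 0 < alpha j by move=> hj; apply: alpha_gt0.
exists B, (1 + \rsum_(0 <= j < d) alpha j); split=> //; split.
  have : 0 <= \rsum_(0 <= j < d) alpha j by apply: rsum_ge0 => j /a0 hj _; lra.
  lra.
move=> x x1; split.
  by apply: rsum_ge0 => j /a0 hj _; apply: Rmult_le_pos; [lra|apply: Rlt_le; apply: Rpower_gt0].
have p := Rpower_gt0 x B.
apply: Rle_trans (_ : \rsum_(0 <= j < d) (alpha j * Rpower x B) <= _).
  apply: rsum_le => j hj _; apply: Rmult_le_compat_l; first by have := a0 j hj; lra.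
  by apply: Rle_Rpower => //; apply: hB.
by rewrite -rsum_mulr; lra.
Qed.

Lemma prime_weight_gt0 n : 0 < prime_weight n -> prime n.
Proof. by rewrite /prime_weight; case: prime => //; lra. Qed.

Lemma prime_weight_ge0 n : 0 <= prime_weight n.
Proof. by rewrite /prime_weight; case: prime; [apply: mangoldt_ge0|lra]. Qed.

Lemma Rabs_INR_sub i j K : (i < K)%N -> (j < K)%N -> Rabs (INR i - INR j) <= INR K.
Proof.
move=> hi hj; apply: Rabs_le.
have := pos_INR i; have := pos_INR j.
have : INR i <= INR K by apply: le_INR; lia.
have : INR j <= INR K by apply: le_INR; lia.
lra.
Qed.

Lemma Rabs_INR_sub_ge1 i j : i != j -> 1 <= Rabs (INR i - INR j).
Proof.
move=> ij; have [h|h] : (i.+1 <= j \/ j.+1 <= i)%N by lia.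
  have := le_INR i.+1 j ltac:(lia); rewrite S_INR Rabs_minus_sym => ?.
  by rewrite Rabs_pos_eq; lra.
have := le_INR j.+1 i ltac:(lia); rewrite S_INR => ?.
by rewrite Rabs_pos_eq; lra.
Qed.

(* If [q * xi] is close to an integer for a small [q], then a prime [p] from a
   much shorter range with [q | floor (f p)] does the job. *)
Lemma small_denominator B Cf r N1 xi N q delta s : let X := INR N in let f := power_sum in
  1 <= B -> 0 < r -> 1 <= X -> 0 < s -> s <= 1 -> (0 < q)%N ->
  (forall x, 1 <= x -> 0 <= f x <= Cf * Rpower x B) -> 0 < Cf ->
  exp_sum_saving r N1 ->
  2 * Rpower X (s / 2) <= Rpower X s -> N1 <= Rpower X (s / 2) ->
  32 * INR q ^ 2 <= Rpower X (s / 128) -> 64 * INR q ^ 2 < Rpower X (s * r / 8) ->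
  dist_int (INR q * xi) < delta ->
  exists n, prime n /\ (n <= N)%N /\
    dist_int (xi * IZR (floorZ (f (INR n)))) <= Cf * Rpower X (s * B) * delta.
Proof.
move=> X f B1 r0 X1 s0 s1 q0 hf Cf0 hS L7 L7' L8 L9 hq.
have X0 : 0 < X by lra.
have pX a := Rpower_gt0 X a.
have qp : 1 <= INR q by apply: (le_INR 1); lia.
(* The prime is sought only up to [X^s], where [f] is at most [Cf X^(s B)]. *)
have [N' [N'1 N'2]] := @nat_floor (Rpower X s) (Rlt_le _ _ (pX _)).
have N'low : Rpower X (s / 2) <= INR N'.
  have := @Rpower_ge1 X (s / 2) X1 ltac:(lra); lra.
have [M [Mpos [MN [Mlow [W0 hE]]]]] := hS N' ltac:(lra).
have M8 : Rpower X (s / 8) <= INR M.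
  apply: Rle_trans Mlow; have -> : s / 8 = s / 2 * / 4 by field.
  by rewrite -Rpower_mult; apply: Rle_Rpower_l; [lra|split].
have M0 : 0 < INR M by have := pX (s / 8); lra.
have M16 : Rpower X (s / 128) <= Rpower (INR M) (/ 16).
  have -> : s / 128 = s / 8 * / 16 by field.
  by rewrite -Rpower_mult; apply: Rle_Rpower_l; [lra|split].
have Mr : Rpower X (s * r / 8) <= Rpower (INR M) r.
  have -> : s * r / 8 = s / 8 * r by field.
  by rewrite -Rpower_mult; apply: Rle_Rpower_l; [lra|split].
set W := \rsum_(M <= n < 2 * M) prime_weight n in W0 hE.
(* Equal to [8 / w^2] for the window [w = 1 / (2 q)]. *)
set K := (32 * q * q)%N.
have KE : INR K = 32 * INR q ^ 2 by rewrite /K !mult_INR (_ : INR 32 = 32); [ring|rewrite INR_IZR_INZ].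
have K0 : 0 < INR K by rewrite KE; nra.
have pMr := Rpower_gt0 (INR M) (- r).
have Mrr : Rpower (INR M) r * Rpower (INR M) (- r) = 1 by rewrite -Rpower_plus Rplus_opp_r Rpower_O.
have iq : 0 < / INR q by apply: Rinv_0_lt_compat; lra.
(* Centring the window at [1 / (2 q)] puts [f n / q] between an integer [z] and [z + 1 / q], so that
   [floor (f n) = z q]. *)
have [n [hn [gn hd]]] : exists n, (M <= n < 2 * M)%N /\ 0 < prime_weight n /\
    dist_int (f (INR n) / INR q - / (2 * INR q)) < / (2 * INR q).
  apply: (@detect1 M (2 * M) prime_weight prime_weight_ge0 _ K _ (W * Rpower (INR M) (- r))) => //.
  - by apply: Rinv_0_lt_compat; lra.
  - by apply: Req_le; rewrite KE; field; lra.
  - by apply: Rmult_le_pos; lra.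
  - have h : 2 * INR K * Rpower (INR M) (- r) < 1.
      by rewrite -Mrr; apply: Rmult_lt_compat_r => //; rewrite KE; lra.
    by change (2 * INR K * (W * Rpower (INR M) (- r)) < W); have := Rmult_lt_compat_l _ _ _ W0 h; lra.
  move=> i j hi hj ij.
  have hb := @Rabs_INR_sub i j K hi hj; have hb1 := Rabs_INR_sub_ge1 ij.
  set bt := (INR i - INR j) * / INR q.
  have abt : Rabs bt = Rabs (INR i - INR j) * / INR q.
    by rewrite /bt Rabs_mult (Rabs_pos_eq (/ INR q)) //; lra.
  have q1 : / INR q <= 1 by rewrite -Rinv_1; apply: Rinv_le_contravar; lra.
  apply: Rle_trans (hE bt _); last first.
    rewrite abt; split.
      rewrite Rpower_Ropp; apply: Rle_trans (_ : / INR q <= _); last by nra.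
      by apply: Rinv_le_contravar; [lra|nra].
    apply: Rle_trans M16; apply: Rle_trans L8; rewrite -KE.
    have := Rabs_pos (INR i - INR j); nra.
  apply: Req_le.
  (* The shift by [1 / (2 q)] contributes only a constant unimodular factor. *)
  transitivity (Cmod (\csum_(M <= n < 2 * M) (expi (- ((INR i - INR j) * / (2 * INR q)))%R * (RtoC (prime_weight n) * expi (bt * f (INR n))%R)))).
    congr Cmod; apply: eq_bigr => n _.
    rewrite (_ : (INR i - INR j) * (f (INR n) / INR q - / (2 * INR q)) = - ((INR i - INR j) * / (2 * INR q)) + bt * f (INR n)); last by rewrite /bt; field; lra.
    by rewrite expiD; ring.
  by rewrite -csum_mull Cmod_mult Cmod_expi Rmult_1_l.
exists n; split; first exact: prime_weight_gt0.
have nN' : INR n <= INR N' by apply: le_INR; lia.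
have XsX : Rpower X s <= X by rewrite -{2}(Rpower_1 X) //; apply: Rle_Rpower.
split; first by apply/leP; apply: INR_le; rewrite -/X; lra.
have n1 : 1 <= INR n by apply: (le_INR 1); lia.
have [f0 fC] := hf _ n1.
have fX : f (INR n) <= Cf * Rpower X (s * B).
  apply: Rle_trans fC _; apply: Rmult_le_compat_l; first lra.
  by rewrite -Rpower_mult; apply: Rle_Rpower_l; lra.
have [z [ez _]] := dist_int_attained (f (INR n) / INR q - / (2 * INR q)).
rewrite {}ez in hd; have [d1 d2] := Rabs_def2 _ _ hd.
have ifq : f (INR n) / INR q * INR q = f (INR n) by field; lra.
have i2q : / (2 * INR q) * INR q = / 2 by field; lra.
have b1 : IZR z * INR q < f (INR n).
  have := Rmult_lt_compat_r (INR q) _ _ ltac:(lra) d2; lra.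
have b2 : f (INR n) < IZR z * INR q + 1.
  have := Rmult_lt_compat_r (INR q) _ _ ltac:(lra) d1; lra.
have ef : floorZ (f (INR n)) = (z * Z.of_nat q)%Z.
  by apply: floorZ_eq; rewrite mult_IZR -INR_IZR_INZ; lra.
have z0 : 0 <= IZR z.
  have z1 : (-1 < z)%Z by apply: lt_IZR; nra.
  by apply: IZR_le; lia.
have zf : IZR z <= f (INR n) by nra.
have [z2 [ez2 _]] := dist_int_attained (INR q * xi).
rewrite ez2 in hq.
apply: Rle_trans (dist_int_le _ (z * z2)%Z) _.
rewrite ef !mult_IZR -INR_IZR_INZ.
have -> : xi * (IZR z * INR q) - IZR z * IZR z2 = IZR z * (INR q * xi - IZR z2) by ring.
rewrite Rabs_mult (Rabs_pos_eq (IZR z)) //.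
apply: Rmult_le_compat => //; [exact: Rabs_pos|lra|lra].
Qed.

(* If no small multiple of [xi] is close to an integer, the points
   [(f p, xi * f p)] are well distributed modulo one. *)
Lemma no_small_denominator r N1 xi N K w : let X := INR N in let f := power_sum in
  0 < r -> 1 <= X -> N1 <= X -> exp_sum_saving r N1 ->
  0 < w <= / 2 -> 16 / w ^ 2 <= INR K ->
  INR K * (1 + Rabs xi) <= Rpower X (/ 64) -> 4 * INR K ^ 2 <= Rpower X (r / 4) ->
  (forall h, (0 < h < K)%N -> Rpower X (- / 64) <= dist_int (INR h * xi)) ->
  exists n, prime n /\ (n <= N)%N /\
    dist_int (xi * IZR (floorZ (f (INR n)))) <= (1 + 2 * Rabs xi) * w.
Proof.
move=> X f r0 X1 XN1 hS [w0 w1] hK L4 L5 hB.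
have X0 : 0 < X by lra.
have [M [Mpos [MN [Mlow [W0 hE]]]]] := hS N XN1.
have M0 : 0 < INR M by apply: lt_0_INR; lia.
have M1 : 1 <= INR M by apply: (le_INR 1); lia.
have M16 : Rpower X (/ 64) <= Rpower (INR M) (/ 16).
  have -> : / 64 = / 4 * / 16 by field.
  by rewrite -Rpower_mult; apply: Rle_Rpower_l; [lra|split=> //; apply: Rpower_gt0].
have M16' : Rpower (INR M) (- / 16) <= Rpower X (- / 64).
  by rewrite !Rpower_Ropp; apply: Rinv_le_contravar => //; apply: Rpower_gt0.
have Mr : Rpower X (r / 4) <= Rpower (INR M) r.
  have -> : r / 4 = / 4 * r by field.
  by rewrite -Rpower_mult; apply: Rle_Rpower_l; [lra|split=> //; apply: Rpower_gt0].
set W := \rsum_(M <= n < 2 * M) prime_weight n in W0 hE.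
have pMr := Rpower_gt0 (INR M) (- r).
have Mrr : Rpower (INR M) r * Rpower (INR M) (- r) = 1 by rewrite -Rpower_plus Rplus_opp_r Rpower_O.
(* If [f n - w] is within [w] of an integer [z], then [f n] lies between [z] and [z + 2 w]. As
   [2 w <= 1], [z] is its floor, and [xi z] is within [2 w |xi|] of [xi f n]. *)
have [n [hn [gn [hx hy]]]] : exists n, (M <= n < 2 * M)%N /\ 0 < prime_weight n /\
    dist_int (f (INR n) - w) < w /\ dist_int (xi * f (INR n)) < w.
  apply: (@detect2 M (2 * M) prime_weight prime_weight_ge0
    (fun n => f (INR n) - w) (fun n => xi * f (INR n)) K _ (W * Rpower (INR M) (- r))) => //.
  - by apply: Rmult_le_pos; lra.
  - have h : 4 * INR K ^ 2 * Rpower (INR M) (- r) <= 1.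
      by rewrite -Mrr; apply: Rmult_le_compat_r; lra.
    by change (4 * INR K ^ 2 * (W * Rpower (INR M) (- r)) <= W); have := Rmult_le_compat_l _ _ _ (Rlt_le _ _ W0) h; lra.
  move=> i j k l hi hj hk hl hne.
  set bt := (INR i - INR j) + (INR k - INR l) * xi.
  apply: Rle_trans (hE bt _); last first.
    split.
      (* For [k = l] the frequency is a nonzero integer. Otherwise its modulus is at least the
         distance of [|k - l| xi] to the nearest integer, which is where the absence of small
         denominators enters. *)
      case: (eqVneq k l) => [kl|kl].
        have ij : i != j by move: hne; rewrite xpair_eqE kl eqxx andbT.
        rewrite /bt kl Rminus_diag Rmult_0_l Rplus_0_r.
        apply: Rle_trans (Rabs_INR_sub_ge1 ij).
        by rewrite -(Rpower_O (INR M)) //; apply: Rle_Rpower; lra.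
      apply: Rle_trans M16' _.
      have [h|h] : (k < l \/ l < k)%N by lia.
        apply: Rle_trans (hB (l - k)%N ltac:(lia)) _.
        apply: Rle_trans (dist_int_le _ (Z.of_nat i - Z.of_nat j)%Z) _.
        rewrite minus_IZR -!INR_IZR_INZ minus_INR; last by lia.
        by rewrite -Rabs_Ropp; apply: Req_le; congr Rabs; rewrite /bt; ring.
      apply: Rle_trans (hB (k - l)%N ltac:(lia)) _.
      apply: Rle_trans (dist_int_le _ (Z.of_nat j - Z.of_nat i)%Z) _.
      rewrite minus_IZR -!INR_IZR_INZ minus_INR; last by lia.
      by apply: Req_le; congr Rabs; rewrite /bt; ring.
    apply: Rle_trans M16; apply: Rle_trans L4; apply: Rle_trans (Rabs_triang _ _) _.
    rewrite Rabs_mult; have a1 := Rabs_INR_sub hi hj; have a2 := Rabs_INR_sub hk hl.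
    by have := Rmult_le_compat_r _ _ _ (Rabs_pos xi) a2; lra.
  apply: Req_le.
  transitivity (Cmod (\csum_(M <= n < 2 * M) (expi (- ((INR i - INR j) * w))%R * (RtoC (prime_weight n) * expi (bt * f (INR n))%R)))).
    congr Cmod; apply: eq_bigr => n _.
    rewrite (_ : (INR i - INR j) * (f (INR n) - w) + (INR k - INR l) * (xi * f (INR n)) = - ((INR i - INR j) * w) + bt * f (INR n)); last by rewrite /bt; ring.
    by rewrite expiD; ring.
  by rewrite -csum_mull Cmod_mult Cmod_expi Rmult_1_l.
exists n; split; first exact: prime_weight_gt0.
split; first by lia.
have [z [ez _]] := dist_int_attained (f (INR n) - w).
rewrite {}ez in hx; have [x1 x2] := Rabs_def2 _ _ hx.
have [z2 [ez2 _]] := dist_int_attained (xi * f (INR n)).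
rewrite {}ez2 in hy.
have -> : floorZ (f (INR n)) = z by apply: floorZ_eq; lra.
apply: Rle_trans (dist_int_le _ z2) _.
have -> : xi * IZR z - IZR z2 = xi * (IZR z - f (INR n)) + (xi * f (INR n) - IZR z2) by ring.
apply: Rle_trans (Rabs_triang _ _) _; rewrite Rabs_mult.
have h : Rabs (IZR z - f (INR n)) <= 2 * w by apply: Rabs_le; lra.
by have := Rmult_le_compat_l _ _ _ (Rabs_pos xi) h; lra.
Qed.

(** Balance of exponents. With [s = 1 / (128 B)] the case of a small denominator gives
    [Cf X^(1/128 - 1/64)]. In the other case the window is [w = X^(-e)], which takes about
    [16 X^(2 e)] frequencies in each direction; [e] is so small that their squares stay below all
    savings. The factors that contain [xi] are absorbed for large [X], the last one by passing from
    [e] to [e / 2]. *)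
Lemma floor_power_sum_at_primes : exists eta, 0 < eta /\
  forall xi, for_large (fun X => forall N : nat, INR N = X ->
    exists n, prime n /\ (n <= N)%N /\
      dist_int (xi * IZR (floorZ (power_sum (INR n)))) <= Rpower X (- eta)).
Proof.
have [r [N1 [r0 hS]]] := prime_exp_sum_saving.
have [B [Cf [B1 [Cf0 hf]]]] := power_sum_growth.
pose s := / (128 * B).
have s0 : 0 < s by apply: Rinv_0_lt_compat; lra.
have sB : s * B = / 128 by rewrite /s; field; lra.
have s1 : s <= / 128 by apply: Rinv_le_contravar; lra.
pose r1 := Rmin r (/ 16).
have r1p : 0 < r1 by apply: Rmin_pos; lra.
have r1r : r1 <= r by apply: Rmin_l.
have r116 : r1 <= / 16 by apply: Rmin_r.
(* [K] and [q] are at most [17 X^(2 e)]; their squares account for [4 * e] in the next conditions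
   and for the constant 289. *)
pose e := s * r1 / 64.
have e0 : 0 < e by rewrite /e; nra.
have e1 : 4 * e < s / 128 by rewrite /e; nra.
have e2 : 4 * e < s * r / 8 by rewrite /e; nra.
have e3 : 4 * e < r / 4 by rewrite /e; nra.
have e4 : 2 * e < / 64 by lra.
exists (e / 2); split; first lra.
move=> xi.
have := for_large_and (for_large_ge N1) (for_large_and (for_large_ge 1)
  (for_large_and (for_large_const 2 e0)
  (for_large_and (for_large_pow (17 * (1 + Rabs xi)) e4)
  (for_large_and (for_large_pow (4 * 289) e3)
  (for_large_and (@for_large_pow (1 + 2 * Rabs xi) (- e) (- (e / 2)) ltac:(lra))
  (for_large_and (@for_large_pow 2 (s / 2) s ltac:(lra))
  (for_large_and (@for_large_const N1 (s / 2) ltac:(lra))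
  (for_large_and (for_large_pow (32 * 289) e1)
  (for_large_and (for_large_pow (65 * 289) e2)
  (@for_large_pow Cf (- / 128) (- (e / 2)) ltac:(lra))))))))))).
apply: for_large_mono => X [c1 [c2 [c3 [c4 [c5 [c6 [c7 [c8 [c9 [c10 c11]]]]]]]]]] N eN; subst X; set X := INR N in c1 c2 c3 c4 c5 c6 c7 c8 c9 c10 c11 *.
have X0 : 0 < X by lra.
have pX a := Rpower_gt0 X a.
set w := Rpower X (- e); set v := Rpower X (2 * e).
have wv : w ^ 2 * v = 1.
  by rewrite /= /w /v Rmult_1_r -!Rpower_plus (_ : - e + - e + 2 * e = 0) ?Rpower_O //; ring.
have w2p : 0 < w ^ 2 by apply: pow_lt; apply: pX.
have vw : 16 / w ^ 2 = 16 * v by have -> : v = / w ^ 2 by [apply: (Rmult_eq_reg_l (w ^ 2)); [rewrite wv Rinv_r|]; lra].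
have v1 : 1 <= v by apply: Rpower_ge1; lra.
have vv : v ^ 2 = Rpower X (4 * e) by rewrite /= Rmult_1_r -Rpower_plus; congr Rpower; ring.
have [k0 [k1 k2]] := @nat_floor (16 * v) ltac:(lra).
set K := k0.+1; have Klow : 16 * v <= INR K by rewrite S_INR; lra.
have Kup : INR K <= 17 * v by rewrite S_INR; lra.
have K0 : 0 < INR K by lra.
have wle : w <= / 2.
  rewrite /w Rpower_Ropp; apply: Rinv_le_contravar; lra.
have xi0 := Rabs_pos xi.
have K2 : INR K ^ 2 <= 289 * Rpower X (4 * e).
  rewrite -vv; have -> : 289 * v ^ 2 = (17 * v) ^ 2 by ring.
  by apply: pow_incr; lra.
case: (classic (exists h, (0 < h < K)%N /\ dist_int (INR h * xi) < Rpower X (- / 64))) => [[q [hq hd]]|hn].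
  have q1 : 0 <= INR q <= INR K by split; [apply: pos_INR|apply: le_INR; lia].
  have q2 : INR q ^ 2 <= 289 * Rpower X (4 * e) by apply: Rle_trans K2; apply: pow_incr.
  have l8 : 32 * INR q ^ 2 <= Rpower X (s / 128) by lra.
  have l9 : 64 * INR q ^ 2 < Rpower X (s * r / 8) by have := pX (4 * e); lra.
  have q0 : (0 < q)%N by lia.
  have s11 : s <= 1 by lra.
  have [n [pn [nN hle]]] := small_denominator B1 r0 c2 s0 s11 q0 hf Cf0 hS c7 c8 l8 l9 hd.
  exists n; split=> //; split=> //.
  apply: Rle_trans hle _; rewrite sB Rmult_assoc -Rpower_plus.
  by rewrite (_ : / 128 + - / 64 = - / 128) //; field.
have hw : 0 < w <= / 2 by split=> //; apply: pX.
have hK : 16 / w ^ 2 <= INR K by rewrite vw.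
have l4 : INR K * (1 + Rabs xi) <= Rpower X (/ 64).
  apply: Rle_trans c4; rewrite -/v.
  have := Rmult_le_compat_r (1 + Rabs xi) _ _ ltac:(lra) Kup; lra.
have l5 : 4 * INR K ^ 2 <= Rpower X (r / 4) by lra.
have hB h : (0 < h < K)%N -> Rpower X (- / 64) <= dist_int (INR h * xi).
  by move=> hh; apply: Rnot_lt_le => hlt; apply: hn; exists h.
have [n [pn [nN hle]]] := no_small_denominator r0 c2 c1 hS hw hK l4 l5 hB.
by exists n; split=> //; split=> //; apply: Rle_trans hle _.
Qed.

End PowerSums.

(** * Transfer to the notions of the statement *)

Lemma pseudo_polyE d alpha theta x : pseudo_poly d alpha theta x = power_sum d alpha theta x.
Proof.
rewrite /pseudo_poly /power_sum.
have key a : List.fold_right Rplus 0 (List.map (fun j => alpha j * Rpower x (theta j)) (List.seq a d)) =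
    \rsum_(a <= j < a + d) (alpha j * Rpower x (theta j)).
  elim: d a => [|d IH] a; first by rewrite addn0 big_geq.
  by rewrite /= IH addSnnS [RHS]big_ltn //; lia.
exact: key.
Qed.

Lemma Zprime_of_nat p : prime p -> Znumtheory.prime (Z.of_nat p).
Proof.
move=> pp; apply/prime_alt; have p1 := prime_gt1 pp; split; first by lia.
move=> n hn [k hk].
have hdiv : (Z.to_nat n %| p)%N.
  apply/dvdnP; exists (Z.to_nat k).
  have k0 : (0 <= k)%Z by nia.
  by apply: Nat2Z.inj; rewrite hk -multE Nat2Z.inj_mul !Z2Nat.id //; lia.
move/primeP: pp => [_ /(_ _ hdiv)] /orP[] /eqP; lia.
Qed.

(** Used to single out the largest non-integral exponent. *)
Lemma exists_last (P : nat -> Prop) d : (exists j, (j < d)%N /\ P j) ->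
  exists t, (t < d)%N /\ P t /\ forall j, (t < j < d)%N -> ~ P j.
Proof.
elim: d => [|d IH] [j [hj Pj]] //.
case: (classic (P d)) => Pd; first by exists d; split=> //; split=> // i; lia.
have jd : (j < d)%N.
  by move: hj; rewrite ltnS leq_eqVlt => /orP[/eqP e|//]; case: Pd; rewrite -e.
have [t [td [Pt ht]]] := IH (ex_intro _ j (conj jd Pj)).
exists t; split; [by lia|split=> // i hi].
by case: (eqVneq i d) => [->//|ne]; apply: ht; lia.
Qed.

Lemma pseudo_poly_floor_at_primes d alpha theta : is_pseudo_poly d alpha theta ->
  exists eta, 0 < eta /\ forall xi, exists N0 : nat, forall N : nat, le N0 N ->
    exists p : nat, (le 1 p /\ le p N) /\ Znumtheory.prime (Z.of_nat p) /\
      dist_int (xi * IZR (floorZ (pseudo_poly d alpha theta (INR p)))) <= Rpower (INR N) (- eta).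
Proof.
move=> [d1 [a0 [th0 [thS [j0 [j0d hj0]]]]]].
have th_mono j k : (j < k)%N -> (k < d)%N -> theta j < theta k.
  elim: k => // k IH; rewrite ltnS leq_eqVlt => /orP[/eqP->|jk] kd; first by apply: thS; lia.
  by have := IH jk ltac:(lia); have := thS k ltac:(lia); lra.
have th1 j : (j < d)%N -> 1 <= theta j.
  by case: j => // j jd; have := th_mono 0%N j.+1 isT jd; lra.
have [t [td [ht htop]]] := @exists_last (fun j => forall z : Z, theta j <> IZR z) d
  ltac:(by exists j0; split; [lia|]).
have thint j : (t < j < d)%N -> exists z : Z, theta j = IZR z.
  by move=> /htop hj; apply: NNPP => hn; apply: hj => z hz; apply: hn; exists z.
have [eta [eta0 h]] := @floor_power_sum_at_primes d t alpha theta td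
  (fun j hj => a0 j ltac:(lia)) th1 (fun j hj => th_mono j t hj td) ht thint.
exists eta; split=> // xi; have [X0 hX] := h xi.
have [N0 [_ hN0]] := @nat_floor (Rmax X0 0) (Rmax_r _ _).
exists N0.+1 => N hN.
have NX : X0 <= INR N.
  by have := le_INR _ _ hN; rewrite S_INR; have := Rmax_l X0 0; lra.
have [n [pn [nN hle]]] := hX _ NX N (erefl _).
exists n; split; first by have := prime_gt0 pn; lia.
by split; [apply: Zprime_of_nat|rewrite pseudo_polyE].
Qed.

End PrimeValues.

Theorem theorem2p9 (d : nat) (alpha theta : nat -> R) :
  is_pseudo_poly d alpha theta ->
  exists eta C : R, 0 < eta /\ 0 < C /\
    forall xi : R, exists N0 : nat, forall N : nat, (N0 <= N)%nat ->
      exists p : nat, (1 <= p <= N)%nat /\ prime (Z.of_nat p) /\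
        dist_int (xi * IZR (floorZ (pseudo_poly d alpha theta (INR p))))
          <= C * Rpower (INR N) (- eta).
Proof.
intros hf; destruct (PrimeValues.pseudo_poly_floor_at_primes hf) as [eta [eta0 h]].
(* All constants have been absorbed into the exponent, so [C = 1] serves. *)
exists eta, 1; split; [exact eta0|split; [exact Rlt_0_1|]].
intros xi; destruct (h xi) as [N0 hN0]; exists N0; intros N hN.
destruct (hN0 N hN) as [p [hp [pp hle]]].
exists p; split; [exact hp|split; [exact pp|]].
rewrite Rmult_1_l; exact hle.
Qed.
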